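(* Let $B\subset W$ be a good lattice, $l=l(B)$, and $A$ a self-dual lattice with $B\subset A\subset B^*$. (i) The subspace $\mathcal{E}^B_0$ is non-zero. The subspaces $\mathcal{E}^{B,-}_0$ and $\mathcal{E}^{B,\pm}_n$, $n\ge1$, are non-zero if and only if $l>0$. The subspaces $\mathcal{E}^{B,\pm}_{n,1}$, $n\ge0$, are non-zero if and only if $l<r$. (ii) When non-zero, the subspaces $\mathcal{E}^{B,\pm}_n$ and $\mathcal{E}^{B,\pm}_{n,1}$, $n\ge0$, are invariant and irreducible under the restriction of the metaplectic (Weil) representation $S^A_\psi$ to $K_B$. The representations of $K_B$ so obtained are pairwise inequivalent. The restriction of the metaplectic representation to $K_B$ is multiplicity free and is the direct sum of these representations. (iii) One has $$\dim\mathcal{E}^{B,+}_0=1+\tfrac12(q^l-1),\qquad \dim\mathcal{E}^{B,-}_0=\tfrac12(q^l-1),$$ $$\dim\mathcal{E}^{B,\pm}_n=\tfrac12q^{2rn-l}(q^{2l}-1)\ (n\ge1),\qquad \dim\mathcal{E}^{B,\pm}_{n,1}=\tfrac12q^{2rn+l}(q^{2(r-l)}-1)\ (n\ge0).$$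
   Context: $k$ is a non-archimedean local field of characteristic $0$ with ring of integers $\mathcal{O}$, uniformizer $\varpi$, residue field $\mathbb{F}_q$ of characteristic $p\neq2$; $\psi$ is a non-trivial unitary character of $(k,+)$ with conductor $\lambda_\psi$ (trivial on $\varpi^{\lambda_\psi}\mathcal{O}$, not on $\varpi^{\lambda_\psi-1}\mathcal{O}$); $\overline\psi$ is the character of $\mathbb{F}_q$ with $\overline\psi(x\bmod\varpi)=\psi(\varpi^{\lambda_\psi-1}x)$. $(W,\beta)$ is a symplectic $k$-space of dimension $2r>0$. A lattice is a compact open $\mathcal{O}$-submodule; $B^*=\{v\in W:\beta(v,b)\in\varpi^{\lambda_\psi}\mathcal{O}\ \forall b\in B\}$; $B$ is good if $\varpi B^*\subset B\subset B^*$, self-dual if $B=B^*$. $K_B$ is the stabilizer of $B$ in $Sp(W)$ (a maximal compact subgroup). $\mathrm{b}^*=B^*/B$ is an $\mathbb{F}_q$-space with symplectic form $\beta_{\mathrm{b}^*}(\bar v,\bar w)=\varpi^{1-\lambda_\psi}\beta(v,w)\bmod\varpi$, of dimension $2l$, $l=l(B)$; $p_{Sp(\mathrm{b}^* )}:K_B\to Sp(\mathrm{b}^* )$ is the induced morphism. $\mathrm{x}=A/B$ is a Lagrangian of $\mathrm{b}^*$. Put $j(g)=l-\dim(\mathrm{x}\cap g\mathrm{x})$ for $g\in Sp(\mathrm b^* )$, $\omega(a)=q^{-1/2}\sum_{t\in\mathbb{F}_q}\overline\psi(\frac12at^2)$ for $a\in\mathbb F_q^\times$ (depends only on $a$ mod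 squares), and let $\theta:Sp(\mathrm{b}^* )\to\mathbb{F}_q^\times/(\mathbb{F}_q^\times)^2$ be the function with $\theta(p_1gp_2)=\theta(p_1)\theta(g)\theta(p_2)$ for $p_1,p_2$ in the stabilizer $P$ of $\mathrm{x}$, $\theta(p)=\det(p_{|\mathrm{x}})$ for $p\in P$, and $\theta(\tau_S)=1$ for $S\subset\{1,\dots,l\}$, where, for a symplectic basis $(\epsilon_i,\phi_i)$ of $\mathrm b^*$ with the $\epsilon_i$ spanning $\mathrm{x}$, $\tau_S \epsilon_i=\phi_i,\ \tau_S\phi_i=-\epsilon_i$ for $i\in S$ and $\tau_S$ fixes $\epsilon_i,\phi_i$ for $i\notin S$. Put $m(g)=\omega(\theta(g))^{-1}\omega(1)^{1-j(g)}$. $\mathcal{H}^A_\psi$ is the Hilbert space of functions $\varphi:W\to\mathbb{C}$ with $\varphi(a+w)=\psi(\frac12\beta(w,a))\varphi(w)$ ($a\in A$) and $\int_{W/A}|\varphi|^2<\infty$. For $g\in Sp(W)$, $$M_A(g)\varphi(w)=[A:A\cap gA]^{-1}\sum_{a\in A/(A\cap gA)}\psi(\tfrac12\beta(a,w))\varphi(g^{-1}(a+w)).$$ $K_B$ is identified with a subgroup of the metaplectic group $Mp(W)$ by a section for which the restriction to $K_B$ of the Weil representation (lattice model $S_\psi^A$ on $\mathcal{H}^A_\psi$) is $S^A_\psi(g)=m(p_{Sp(\mathrm{b}^* )}(g))\,q^{\frac12j(p_{Sp(\mathrm{b}^* )}(g))}M_A(g)$, $g\in K_B$. Subspaces of $\mathcal{H}^A_\psi$: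 $\mathcal{E}^B_0=\{f:\mathrm{Supp} f\subset B^*\}$; $\mathcal{E}^B_n=\{f:\mathrm{Supp} f\subset\varpi^{-n}(B^*\setminus B)\}$ for $n\ge1$; $\mathcal{E}^B_{n,1}=\{f:\mathrm{Supp} f\subset\varpi^{-(n+1)}B\setminus\varpi^{-n}B^*\}$ for $n\ge0$. $\mathcal{E}^+$ (resp. $\mathcal{E}^-$) denotes the subspace of even (resp. odd) functions of $\mathcal{E}$. *)

(* Defs.v *)
From HB Require Import structures.
From mathcomp Require Import all_boot all_order all_algebra.
From mathcomp Require Import sesquilinear finmap complex.
From mathcomp Require Import all_classical all_reals all_analysis.

Set Implicit Arguments.
Unset Strict Implicit.
Unset Printing Implicit Defensive.

Import Order.TTheory GRing.Theory Num.Theory.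
Import numFieldNormedType.Exports.

Local Open Scope classical_set_scope.
Local Open Scope ring_scope.

(* [v 0] is irrelevant: 0 is given valuation +oo here. *)
Definition val_ge (F : fieldType) (v : F -> int) (n : int) (x : F) : Prop :=
  x = 0 \/ n <= v x.

(* A field complete for a normalized discrete valuation, with finite residue
   field. The residue field is a finite field [residue] together with a
   surjection from the valuation ring whose kernel is the maximal ideal;
   [reduction] is irrelevant outside the valuation ring. *)
Record localField := LocalField {
  lf_field :> fieldType;
  valuation : lf_field -> int;
  unif : lf_field;
  residue : finFieldType;
  reduction : lf_field -> residue;
  valM : forall x y,
    x != 0 -> y != 0 -> valuation (x * y) = valuation x + valuation y;
  valD : forall n x y,
    val_ge valuation n x -> val_ge valuation n y -> val_ge valuation n (x + y);
  unif_neq0 : unif != 0;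
  val_unif : valuation unif = 1;
  val_complete : forall u : nat -> lf_field,
    (forall n : int, exists N, forall i j : nat, (N <= i)%N -> (N <= j)%N ->
       val_ge valuation n (u i - u j)) ->
    exists x, forall n : int, exists N, forall i : nat, (N <= i)%N ->
       val_ge valuation n (u i - x);
  red1 : reduction 1 = 1;
  redD : forall x y,
    val_ge valuation 0 x -> val_ge valuation 0 y ->
    reduction (x + y) = reduction x + reduction y;
  redM : forall x y,
    val_ge valuation 0 x -> val_ge valuation 0 y ->
    reduction (x * y) = reduction x * reduction y;
  red_surj : forall t, exists2 x, val_ge valuation 0 x & reduction x = t;
  red_ker : forall x, val_ge valuation 0 x ->
    (reduction x = 0 <-> val_ge valuation 1 x)
}.

Arguments unif {l}.
Arguments reduction {l}.
Arguments valuation {l}.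

Definition intring (K : localField) : set K := val_ge valuation 0.

Definition powideal (K : localField) (n : int) : set K :=
  [set unif ^ n * x | x in @intring K].

(* [W] with its canonical topology of finite-dimensional [K]-space, i.e. the
   product topology in the coordinates of a basis (it does not depend on the
   basis, so the one provided by [vbasis] is used). *)
Definition canonical_top (K : localField) (W : vectType K) : Type := W.

Section CanonicalTopology.
Variables (K : localField) (W : vectType K).

Definition canonical_open : set_system (canonical_top W) :=
  [set U : set W | forall u, U u -> exists n : int, forall w : W,
     (forall i, powideal n (coord (vbasis {:W}) i w)) -> U (u + w)].

Lemma powideal_le (m n : int) (x : K) :
  m <= n -> powideal n x -> powideal m x.
Proof.
have unifX k : valuation (unif ^+ k : K) = k%:Z /\ (unif : K) ^+ k != 0.
  split; last by rewrite expf_neq0 // unif_neq0.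
  elim: k => [|k IHk].
    apply: (addIr (valuation (1 : K))).
    by rewrite -valM ?oner_neq0 // mulr1 add0r.
  by rewrite exprS valM ?expf_neq0 ?unif_neq0 // IHk val_unif.
move=> le_mn [y Oy <-].
have [k nE] : exists k : nat, n = m + k%:Z.
  exists `|n - m|%N.
  by rewrite gez0_abs ?subr_ge0 // [RHS]addrC subrK.
exists (unif ^+ k * y); last first.
  by rewrite mulrA nE expfzDr ?unif_neq0 // -exprnP.
rewrite /intring /val_ge in Oy *; have [->|y0] := eqVneq y 0.
  by left; rewrite mulr0.
case: Oy => [y0'|Oy]; first by rewrite y0' eqxx in y0.
by right; case: (unifX k) => vk k0; rewrite valM // vk addr_ge0.
Qed.

Lemma canonical_openT : canonical_open setT.
Proof. by move=> u _; exists 0. Qed.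

Lemma canonical_openI : setI_closed canonical_open.
Proof.
move=> U V oU oV u [/oU[m mU] /oV[n nV]].
exists (Num.max m n) => w wmn; split; [apply: mU | apply: nV] => i.
  by apply: powideal_le (wmn i); rewrite le_max lexx.
by apply: powideal_le (wmn i); rewrite le_max lexx orbT.
Qed.

Lemma canonical_open_bigU (I : Type) (f : I -> set (canonical_top W)) :
  (forall i, canonical_open (f i)) -> canonical_open (\bigcup_i f i).
Proof.
move=> fo u [i _ /fo[n nf]]; exists n => w wn; exists i => //; exact: nf.
Qed.

HB.instance Definition _ := Choice.on (canonical_top W).
HB.instance Definition _ := isOpenTopological.Build (canonical_top W)
  canonical_openT canonical_openI canonical_open_bigU.

End CanonicalTopology.

Section Characters.
Variables (R : realType) (K : localField).
Implicit Types (psi : K -> R[i]) (lam : int).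

Definition unitary_character psi : Prop :=
  [/\ forall x y, psi (x + y) = psi x * psi y,
      forall x, `|psi x| = 1 &
      continuous (psi : canonical_top K^o -> (R[i] : numFieldType))].

Definition conductor psi lam : Prop :=
  (forall x, powideal lam x -> psi x = 1) /\
  ~ (forall x, powideal (lam - 1) x -> psi x = 1).

Definition lift_red (t : residue K) : K :=
  xget 0 [set x | intring x /\ reduction x = t].

Definition psibar psi lam (t : residue K) : R[i] :=
  psi (unif ^ (lam - 1) * lift_red t).

Definition omega psi lam (a : residue K) : R[i] :=
  (sqrtC #|residue K|%:R)^-1 *
    \sum_(t : residue K) psibar psi lam (2^-1 * a * t ^+ 2).

End Characters.

Definition isometry_group (F : fieldType) (V : vectType F) (b : V -> V -> F) :
  set 'End(V) := [set g | forall u v, b (g u) (g v) = b u v].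

Section Lattices.
Variables (K : localField) (lam : int) (W : vectType K) (beta : W -> W -> K).
Implicit Types L M A B : set W.

Definition is_lattice L : Prop :=
  [/\ L 0,
      forall u v, L u -> L v -> L (u + v),
      forall c u, intring c -> L u -> L (c *: u),
      compact (L : set (canonical_top W)) &
      open (L : set (canonical_top W))].

Definition dual_lattice L : set W :=
  [set v | forall b, L b -> powideal lam (beta v b)].

Definition dilation (c : K) L : set W := [set c *: v | v in L].

Definition good_lattice B : Prop :=
  [/\ is_lattice B,
      dilation unif (dual_lattice B) `<=` B &
      B `<=` dual_lattice B].

Definition selfdual_lattice A : Prop := is_lattice A /\ A = dual_lattice A.

Definition stabilizer B : set 'End(W) :=
  isometry_group beta `&` [set g | [set g v | v in B] = B].

(* Depends only on the class of [w] modulo [M]. *)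
Definition coset_rep M (w : W) : W := xget 0 [set u | M (u - w)].

(* Representatives of [L / M]. *)
Definition coset_reps L M : set W := [set coset_rep M w | w in L].

Definition lattice_index L M : nat := #|` fset_set (coset_reps L M)|.

End Lattices.

(* The quotient [L / M] of an [O]-module [L] by a submodule [M] containing
   [unif L], as a space over the residue field: [qproj], irrelevant outside
   [L], is the projection. *)
Record quotientSpace (K : localField) (W : vectType K) (L M : set W) :=
  QuotientSpace {
  qspace :> vectType (residue K);
  qproj : W -> qspace;
  qprojD : forall u v, L u -> L v -> qproj (u + v) = qproj u + qproj v;
  qprojZ : forall c u, intring c -> L u ->
    qproj (c *: u) = reduction c *: qproj u;
  qproj_surj : forall y, exists2 u, L u & qproj u = y;
  qproj_ker : forall u, L u -> (qproj u = 0 <-> M u)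
}.

Section ResidualSpace.
Variables (K : localField) (lam : int) (W : vectType K) (beta : W -> W -> K).
Variables (L M : set W) (Q : quotientSpace L M).

Definition qlift (y : Q) : W := xget 0 [set u | L u /\ qproj Q u = y].

Definition qform (y z : Q) : residue K :=
  reduction (unif ^ (1 - lam) * beta (qlift y) (qlift z)).

Definition qmorph (g : 'End(W)) : 'End(Q) :=
  linfun (fun y : Q => qproj Q (g (qlift y))).

End ResidualSpace.

Section FiniteSymplectic.
Variables (F : finFieldType) (V : vectType F) (b : V -> V -> F) (l : nat).
Implicit Types (x : {vspace V}) (eps phi : l.-tuple V) (theta : 'End(V) -> F).

Definition symplectic_basis eps phi : Prop :=
  [/\ basis_of {:V} (eps ++ phi),
      forall i j, b (tnth eps i) (tnth eps j) = 0,
      forall i j, b (tnth phi i) (tnth phi j) = 0 &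
      forall i j, b (tnth eps i) (tnth phi j) = (i == j)%:R].

Definition parabolic x : set 'End(V) :=
  isometry_group b `&` [set p | (p @: x)%VS = x].

Definition is_tau eps phi (S : {set 'I_l}) (tau : 'End(V)) : Prop :=
  forall i,
    tau (tnth eps i) = (if i \in S then tnth phi i else tnth eps i) /\
    tau (tnth phi i) = (if i \in S then - tnth eps i else tnth phi i).

Definition restr_det eps (p : 'End(V)) : F :=
  \det (\matrix_(i < l, j < l) coord eps j (p (tnth eps i))).

Definition eq_mod_squares (a c : F) : Prop :=
  exists2 d : F, d != 0 & a = d ^+ 2 * c.

(* Classes of [F^* / (F^* )^2] are given by representatives in [F^*]. *)
Definition is_theta x eps phi theta : Prop :=
  [/\ forall g, isometry_group b g -> theta g != 0,
      forall p1 g p2, parabolic x p1 -> isometry_group b g ->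
        parabolic x p2 ->
        eq_mod_squares (theta (p1 \o g \o p2)%VF)
                       (theta p1 * theta g * theta p2),
      forall p, parabolic x p -> eq_mod_squares (theta p) (restr_det eps p) &
      forall S tau, is_tau eps phi S tau -> eq_mod_squares (theta tau) 1].

Definition jdefect x (g : 'End(V)) : nat := (l - \dim (x :&: g @: x))%N.

End FiniteSymplectic.

Section LatticeModel.
Variables (R : realType) (K : localField) (psi : K -> R[i]).
Variables (W : vectType K) (beta : W -> W -> K) (A : set W).
Implicit Types (f h : W -> R[i]) (E F : set (W -> R[i])).

(* [W / A] is discrete: its Haar measure is the counting measure. *)
Definition hnorm2 f : \bar R :=
  (\esum_(w in coset_reps setT A) ((complex.Re `|f w|) ^+ 2)%:E)%E.

Definition rsum (D : set W) (F : W -> R) : R :=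
  fine (\esum_(w in D) (Num.max (F w) 0)%:E)%E -
  fine (\esum_(w in D) (Num.max (- F w) 0)%:E)%E.

Definition hdot f h : R[i] :=
  let F w := f w * (h w)^*%C in
  Complex (rsum (coset_reps setT A) (fun w => complex.Re (F w)))
          (rsum (coset_reps setT A) (fun w => complex.Im (F w))).

Definition hilbert_space : set (W -> R[i]) :=
  [set f | (forall a w, A a -> f (a + w) = psi (2^-1 * beta w a) * f w) /\
           (hnorm2 f < +oo)%E].

Definition linear_subspace E : Prop :=
  E (fun=> 0) /\
  forall c f h, E f -> E h -> E (fun w => c * f w + h w).

Definition hclosed E : Prop := forall f, hilbert_space f ->
  (forall e : R, 0 < e ->
     exists2 h, E h & (hnorm2 (fun w => (f w - h w)%R) < e%:E)%E) ->
  E f.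

Definition closed_subspace E : Prop :=
  [/\ linear_subspace E, E `<=` hilbert_space & hclosed E].

Definition nonzero_space E : Prop := exists2 f, E f & f <> (fun=> 0).

Definition has_dim E (x : rat) : Prop :=
  exists d : nat, x = d%:R /\
  exists b : 'I_d -> W -> R[i],
    (forall i, E (b i)) /\
    forall f, E f ->
      exists! c : 'rV[R[i]]_d, f = (fun w => \sum_(i < d) c 0 i * b i w).

Definition hilbert_sum (I : Type) (E : I -> set (W -> R[i])) : Prop :=
  [/\ forall i, closed_subspace (E i),
      forall i j, i <> j -> forall f h, E i f -> E j h -> hdot f h = 0 &
      forall f, hilbert_space f -> forall e : R, 0 < e ->
        exists (s : seq I) (h : I -> W -> R[i]), (forall i, E i (h i)) /\
          (hnorm2 (fun w => (f w - \sum_(i <- s) h i w)%R) < e%:E)%E].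

Section Representations.
Variables (G : set 'End(W)) (S : 'End(W) -> (W -> R[i]) -> (W -> R[i])).

Definition invariant_under E : Prop := forall g f, G g -> E f -> E (S g f).

Definition irreducible_rep E : Prop :=
  nonzero_space E /\
  forall F, closed_subspace F -> F `<=` E -> invariant_under F ->
    ~ nonzero_space F \/ F = E.

Definition equivalent_reps E F : Prop :=
  exists T : (W -> R[i]) -> (W -> R[i]),
    [/\ set_bij E F T,
        forall c f h, E f -> E h ->
          T (fun w => c * f w + h w) = (fun w => c * T f w + T h w) &
        forall g f, G g -> E f -> T (S g f) = S g (T f)].

Definition multiplicity_free : Prop := forall E F,
  closed_subspace E -> invariant_under E -> irreducible_rep E ->
  closed_subspace F -> invariant_under F -> irreducible_rep F ->
  equivalent_reps E F -> E = F.

End Representations.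

Definition Mop (g : 'End(W)) f : W -> R[i] :=
  let A' := A `&` [set g a | a in A] in
  fun w => (lattice_index A A')%:R^-1 *
    \sum_(a \in coset_reps A A')
       (psi (2^-1 * beta a w) * f ((g^-1)%VF (a + w))).

Variables (lam : int) (B : set W).

Definition weil_op (bstar : quotientSpace (dual_lattice lam beta B) B) (l : nat)
    (x : {vspace bstar}) (theta : 'End(bstar) -> residue K)
    (g : 'End(W)) f : W -> R[i] :=
  let gbar := qmorph bstar g in
  let j := jdefect l x gbar in
  let m := (omega psi lam (theta gbar))^-1 * omega psi lam 1 ^ (1 - j%:Z) in
  fun w => m * sqrtC #|residue K|%:R ^+ j * Mop g f w.

Definition supported_in (D : set W) : set (W -> R[i]) :=
  [set f | hilbert_space f /\ [set w | f w <> 0] `<=` D].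

Definition Esub (n : nat) : set (W -> R[i]) :=
  if n is 0 then supported_in (dual_lattice lam beta B)
  else supported_in (dilation (unif ^- n) (dual_lattice lam beta B `\` B)).

Definition Esub1 (n : nat) : set (W -> R[i]) :=
  supported_in (dilation (unif ^- n.+1) B `\`
                dilation (unif ^- n) (dual_lattice lam beta B)).

(* Even functions for [odd = false], odd functions for [odd = true]. *)
Definition parity_part (odd : bool) E : set (W -> R[i]) :=
  [set f | E f /\ forall w, f (- w) = (-1) ^+ odd * f w].

Inductive piece : Type := Piece of nat & bool | Piece1 of nat & bool.

Definition Epiece (i : piece) : set (W -> R[i]) :=
  match i with
  | Piece n s => parity_part s (Esub n)
  | Piece1 n s => parity_part s (Esub1 n)
  end.

End LatticeModel.

(* Main.v *)
(* Let [T_m] be the set of transvections [v |-> v + c b(u, v) u] with [u] in [A] and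
   [c] in [unif ^ (m - lam) O].  For [m >= 1] they stabilize [A] and [B], and on
   [unif^-m A] they act diagonally: [M(t) f (v) = psi (c b(u, v)^2 / 2) f (v)].  As
   [A] is self-dual, these characters determine [v] modulo [A] up to sign.  With the
   action of [-1], a stable subspace of functions supported in some [unif^-m A] is
   thus spanned by the functions of given parity supported in single orbits
   [+-w + A], and it contains the one attached to [w] as soon as it contains a
   function of that parity not vanishing at [w].  The eigencharacters also forbid
   equivalences between different pieces.

   For irreducibility it remains to go from one orbit to another inside a layer
   [unif^-n (B* \ B)] or [unif^-(n+1) B \ unif^-n B*].  The stabilizer of [B] is
   transitive on the layer; if [w] is not in [B*], the value of [M(g) f] at [g w] is
   a single nonzero term for [f] supported in [+-w + A].  In the layer [B*], even
   functions are reached through the orbit [A], and odd ones with isometries that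
   stabilize [A] as well.

   Of the Weil constants, only their nonvanishing matters.  An irreducible closed
   subspace embeds in each layer it meets, hence has a vector restricting to a
   single orbit there, and by the eigencharacters this vector vanishes elsewhere. *)

From HB Require Import structures.
From mathcomp Require Import all_boot all_order all_algebra.
From mathcomp Require Import sesquilinear finmap complex.
From mathcomp Require Import all_classical all_reals all_analysis.
From mathcomp Require Import ring zify.
Require Import Defs.

Set Implicit Arguments.
Unset Strict Implicit.
Unset Printing Implicit Defensive.

Import Order.TTheory GRing.Theory Num.Theory.
Import numFieldNormedType.Exports.

Local Open Scope classical_set_scope.
Local Open Scope ring_scope.

(** * The valuation ring and its ideals *)

Section LocalFieldTheory.
Variable K : localField.
Implicit Types (x y c : K) (m n : int) (t : residue K).

(** Witt's theorem would move one vector to another without respecting lattices. Transitivity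
    therefore rests on an explicit isometry, [mover], whose denominators are the pairings of the two
    vectors with an auxiliary vector [a]. If both pairings have the smallest valuation that the
    lattices at hand allow, all coefficients are integral; such an [a] exists because a group is not
    the union of two proper subgroups.

    The obstacle to computing with [Mop] is its average over [A / (A :&: g A)]. It collapses when
    [g] maps [A] into itself, which covers transvections, [-1] and the movers used on odd functions.
    Otherwise only one value is needed, and only its being nonzero: the nonzero terms turn out to be
    equal, so no cancellation can occur.

    Functions are separated by finite products of operators [M(t) - scalar], so neither Schur's
    lemma nor integration over the compact group occurs. Topology enters through two facts:
    compactness of a lattice makes indices finite, and the value of a function at a point is bounded
    by its norm. *)

Lemma val1 : valuation (1 : K) = 0.
Proof.
by apply: (addIr (valuation (1 : K))); rewrite -valM ?oner_neq0 // mulr1 add0r.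
Qed.

Lemma valV x : x != 0 -> valuation x^-1 = - valuation x.
Proof.
move=> x0; apply: (addIr (valuation x)).
by rewrite -valM ?invr_eq0 // mulVf // val1 addNr.
Qed.

Lemma unifz_neq0 n : (unif : K) ^ n != 0.
Proof. by rewrite expfz_neq0 // unif_neq0. Qed.

Lemma val_unifz n : valuation ((unif : K) ^ n) = n.
Proof.
have valn (k : nat) : valuation ((unif : K) ^+ k) = k.
  elim: k => [|k IHk]; first exact: val1.
  by rewrite exprS valM ?expf_neq0 ?unif_neq0 // IHk val_unif.
case: n => k; first by rewrite -exprnP valn.
by rewrite NegzE -exprnN valV ?expf_neq0 ?unif_neq0 // valn.
Qed.

Lemma powidealP n x : powideal n x <-> val_ge valuation n x.
Proof.
split=> [[y Oy <-]|nx].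
  case: Oy => [->|Oy]; first by left; rewrite mulr0.
  have [->|y0] := eqVneq y 0; first by left; rewrite mulr0.
  by right; rewrite valM ?unifz_neq0 // val_unifz lerDl.
exists (unif ^ (- n) * x); last first.
  by rewrite mulrA -expfzDr ?unif_neq0 // subrr expr0z mul1r.
case: nx => [->|nx]; first by left; rewrite mulr0.
have [->|x0] := eqVneq x 0; first by left; rewrite mulr0.
by right; rewrite valM ?unifz_neq0 // val_unifz addrC subr_ge0.
Qed.

Lemma intringE x : intring x <-> powideal 0 x.
Proof. by split=> ?; apply/powidealP. Qed.

Lemma powideal0 n : powideal n (0 : K).
Proof. by apply/powidealP; left. Qed.

Lemma powidealD n x y : powideal n x -> powideal n y -> powideal n (x + y).
Proof. by move=> /powidealP ? /powidealP ?; apply/powidealP; exact: valD. Qed.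

Lemma powidealM m n x y :
  powideal m x -> powideal n y -> powideal (m + n) (x * y).
Proof.
move=> [a Oa <-] [b Ob <-]; exists (a * b).
  case: Oa => [->|Oa]; first by left; rewrite mul0r.
  case: Ob => [->|Ob]; first by left; rewrite mulr0.
  have [->|a0] := eqVneq a 0; first by left; rewrite mul0r.
  have [->|b0] := eqVneq b 0; first by left; rewrite mulr0.
  by right; rewrite valM // addr_ge0.
by rewrite expfzDr ?unif_neq0 // mulrACA.
Qed.

Lemma powidealZ n x c : powideal 0 c -> powideal n x -> powideal n (c * x).
Proof. by move=> c0 nx; rewrite -[n]add0r; exact: powidealM. Qed.

Lemma powideal_nat (k : nat) : powideal 0 (k%:R : K).
Proof.
have p1 : powideal 0 (1 : K) by apply/powidealP; right; rewrite val1.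
elim: k => [|k IHk]; first exact: powideal0.
by rewrite -addn1 natrD; exact: powidealD.
Qed.

Lemma powideal1 : powideal 0 (1 : K).
Proof. exact: (powideal_nat 1). Qed.

Lemma powidealN n x : powideal n x -> powideal n (- x).
Proof.
have p : powideal 0 (-1 : K).
  apply/powidealP; right; have : valuation (-1 : K) *+ 2 = 0.
    by rewrite mulr2n -valM ?oppr_eq0 ?oner_neq0 // mulrNN mulr1 val1.
  by move/eqP; rewrite mulrn_eq0 /= => /eqP->.
by move=> nx; rewrite -mulN1r; exact: powidealZ.
Qed.

Lemma powidealB n x y : powideal n x -> powideal n y -> powideal n (x - y).
Proof. by move=> nx /powidealN; exact: powidealD. Qed.

Lemma powideal_addl n x y : powideal n x -> powideal n (x + y) -> powideal n y.
Proof. by move=> nx /powidealB - /(_ _ nx); rewrite addrAC subrr add0r. Qed.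

Lemma powideal_unifz n : powideal n ((unif : K) ^ n).
Proof. by apply/powidealP; right; rewrite val_unifz. Qed.

Lemma powidealW m n x : powideal n x -> m <= n -> powideal m x.
Proof. by move=> nx le_mn; exact: powideal_le nx. Qed.

Lemma powideal_unifn (k : nat) : powideal 0 ((unif : K) ^+ k).
Proof. by rewrite exprnP; apply: powidealW (powideal_unifz k) _. Qed.

Lemma powideal_unif : powideal 0 (unif : K).
Proof. exact: (powideal_unifn 1). Qed.

Lemma powideal_exists x : exists n, powideal n x.
Proof. by exists (valuation x); apply/powidealP; right. Qed.

Lemma powideal_unif_mul m n x :
  powideal n ((unif : K) ^ m * x) <-> powideal (n - m) x.
Proof.
split=> [nx|nx].
  have := powidealM (powideal_unifz (- m)) nx.
  by rewrite mulrA -expfzDr ?unif_neq0 // addNr expr0z mul1r addrC.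
by have := powidealM (powideal_unifz m) nx; rewrite addrC subrK.
Qed.

Lemma notin_powideal n x : ~ powideal n x -> x != 0 /\ valuation x < n.
Proof.
move=> nx; split; first by apply/eqP => x0; apply: nx; rewrite x0; exact: powideal0.
by rewrite ltNge; apply/negP => le_n; apply: nx; apply/powidealP; right.
Qed.

Lemma powidealV n x :
  ~ powideal (n + 1) x -> x != 0 /\ powideal (- n) x^-1.
Proof.
move=> /notin_powideal[x0 lt_x]; split=> //; apply/powidealP; right.
by rewrite valV // lerN2 -ltzD1.
Qed.

(** An element outside [powideal (n + 1)] has valuation at most [n], so dividing by it lowers the
    valuation by at most [n]. Lower bounds on denominators are always given as such
    non-memberships. *)
Lemma powideal_div m n x y :
  powideal (m + n) y -> ~ powideal (n + 1) x -> powideal m (y / x).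
Proof.
move=> my /powidealV[_ nx]; have := powidealM my nx.
by rewrite addrK.
Qed.

Lemma red0 : reduction (0 : K) = 0.
Proof.
apply: (addIr (reduction 0)); rewrite add0r -redD ?addr0 //;
  exact/powidealP/powideal0.
Qed.

Lemma redN x : powideal 0 x -> reduction (- x) = - reduction x.
Proof.
move=> x0; apply: (addIr (reduction x)); rewrite addNr -redD ?addNr ?red0 //.
  exact/powidealP/powidealN.
exact/powidealP.
Qed.

Lemma redB x y : powideal 0 x -> powideal 0 y ->
  reduction (x - y) = reduction x - reduction y.
Proof.
move=> x0 y0; rewrite redD ?redN //; apply/powidealP => //; exact: powidealN.
Qed.

Lemma red_eq x y : powideal 0 x -> powideal 0 y ->
  reduction x = reduction y <-> powideal 1 (x - y).
Proof.
move=> x0 y0; have xy0 := powidealB x0 y0.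
rewrite powidealP -red_ker; last exact/powidealP.
rewrite redB //; split=> [->|]; first exact: subrr.
by move/eqP; rewrite subr_eq0 => /eqP.
Qed.

Lemma red_nat (k : nat) : reduction (k%:R : K) = k%:R.
Proof.
elim: k => [|k IHk]; first exact: red0.
rewrite -addn1 !natrD redD ?IHk ?red1 //; apply/powidealP;
  [exact: powideal_nat | exact: powideal1].
Qed.

Lemma lift_redP t : powideal 0 (lift_red t : K) /\ reduction (lift_red t : K) = t.
Proof.
rewrite /lift_red; case: xgetP => [x _ [/intringE]//|nex].
by have [x Ox xt] := red_surj t; case: (nex x).
Qed.

Section ResidueCharacteristicNot2.
Hypothesis charF : 2%N \notin [pchar (residue K)].

Lemma two_residue_neq0 : 2 != 0 :> residue K.
Proof. by move: charF; rewrite inE /= . Qed.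

Lemma notin_powideal2 : ~ powideal 1 (2 : K).
Proof.
move=> /powidealP two1; have /red_ker [_ /(_ two1)] : val_ge valuation 0 (2 : K).
  exact/powidealP/powideal_nat.
by rewrite red_nat => /eqP; rewrite (negbTE two_residue_neq0).
Qed.

Lemma two_neq0 : 2 != 0 :> K.
Proof. by have [] := notin_powideal notin_powideal2. Qed.

Lemma powideal2V : powideal 0 (2^-1 : K).
Proof. by have [_] := @powidealV 0 2 notin_powideal2; rewrite oppr0. Qed.

Lemma powideal_half n x : powideal n x -> powideal n (2^-1 * x).
Proof. exact: powidealZ powideal2V. Qed.

Lemma powideal_double n x : powideal n (2 * x) -> powideal n x.
Proof. by move/powideal_half; rewrite mulrA mulVf ?two_neq0 // mul1r. Qed.

End ResidueCharacteristicNot2.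

(** * The additive character, its reduction and Gauss sums *)

Section Character.
Variables (R : realType) (psi : K -> R[i]) (lam : int).
Hypothesis psi_char : unitary_character psi.
Hypothesis psi_cond : conductor psi lam.

Lemma psiD x y : psi (x + y) = psi x * psi y.
Proof. by case: psi_char. Qed.

Lemma psi_neq0 x : psi x != 0.
Proof. by case: psi_char => _ n1 _; rewrite -normr_eq0 n1 oner_neq0. Qed.

Lemma psi1 x : powideal lam x -> psi x = 1.
Proof. by case: psi_cond => + _; apply. Qed.

Lemma psi0 : psi 0 = 1.
Proof. exact/psi1/powideal0. Qed.

Lemma psiN x : psi (- x) = (psi x)^-1.
Proof.
by apply: (mulIf (psi_neq0 x)); rewrite -psiD addNr psi0 mulVf ?psi_neq0.
Qed.

Lemma psi_eq x y : powideal lam (x - y) -> psi x = psi y.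
Proof. by move=> xy; rewrite -[x](subrK y) psiD psi1 // mul1r. Qed.

(** Otherwise the multiples of [x] by [powideal m] would cover [powideal (lam - 1)], where [psi] is
    not trivial. *)
Lemma psi_trivial m x :
  (forall c, powideal m c -> psi (c * x) = 1) -> powideal (lam - m) x.
Proof.
move=> psi1x; apply: contrapT => nx; case: psi_cond => _; apply => y ly.
have [x0 _] := notin_powideal nx.
rewrite -[y](divfK x0); apply: psi1x; apply: powideal_div (_ : powideal (m + (lam - m - 1)) y) _.
  by rewrite (_ : m + _ = lam - 1) //; lia.
by rewrite subrK.
Qed.

Lemma psibarE t x : powideal 0 x -> reduction x = t ->
  psibar psi lam t = psi (unif ^ (lam - 1) * x).
Proof.
have [Ot tE] := lift_redP t => Ox xt; apply: psi_eq.
rewrite -mulrBr; apply/powideal_unif_mul.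
by rewrite opprB addrC subrK; apply/red_eq => //; rewrite tE.
Qed.

Lemma psibarD t u : psibar psi lam (t + u) = psibar psi lam t * psibar psi lam u.
Proof.
have [Ot tE] := lift_redP t; have [Ou uE] := lift_redP u.
rewrite (psibarE (x := lift_red t + lift_red u)) ?mulrDr ?psiD //.
  exact: powidealD.
by rewrite redD ?tE ?uE //; apply/powidealP.
Qed.

Lemma psibar0 : psibar psi lam 0 = 1.
Proof.
rewrite (psibarE (x := 0)) ?mulr0 ?psi0 ?red0 //; exact: powideal0.
Qed.

Lemma psibar_nontrivial : exists t, psibar psi lam t != 1.
Proof.
apply: contrapT => npsi; case: psi_cond => _; apply => x [y /intringE Oy <-].
rewrite -(psibarE Oy erefl); apply/eqP; apply: contrapT => /negP ny.
by apply: npsi; exists (reduction y).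
Qed.

(** The shift of [t] by [u / a] multiplies the sum by [psibar u], and some such value differs from
    1. *)
Lemma sum_psibar a : a != 0 -> \sum_t psibar psi lam (a * t) = 0.
Proof.
move=> a0; have [u un1] := psibar_nontrivial.
have E : \sum_t psibar psi lam (a * t) =
    psibar psi lam u * \sum_t psibar psi lam (a * t).
  rewrite mulr_sumr (reindex_inj (addIr (u / a))) /=; apply: eq_bigr => t _.
  by rewrite mulrDr mulrCA divff // mulr1 addrC psibarD.
apply/eqP; move/eqP: E; rewrite -subr_eq0 -{1}[\sum_t _]mul1r -mulrBl mulf_eq0.
by rewrite subr_eq0 eq_sym (negbTE un1).
Qed.

(* [G(a) G(-a) = q] for the quadratic Gauss sum: substitute [t = s + d] and sum
   over [s] first. *)
Lemma omega_neq0 (charF : 2%N \notin [pchar (residue K)]) a :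
  a != 0 -> omega psi lam a != 0.
Proof.
move=> a0; set q := #|residue K|.
have two0 := two_residue_neq0 charF.
have q0 : (q%:R : R[i]) != 0.
  by rewrite pnatr_eq0 -lt0n; apply/card_gt0P; exists 0.
rewrite /omega mulf_neq0 ?invr_eq0 ?sqrtC_eq0 //.
pose h t := 2^-1 * a * t ^+ 2.
suff : (\sum_t psibar psi lam (h t)) * (\sum_s psibar psi lam (- h s)) = q%:R.
  by move=> E; apply/eqP => G0; move: q0; rewrite -E /h G0 mul0r eqxx.
rewrite mulr_suml.
transitivity (\sum_d \sum_s psibar psi lam (h d + a * d * s)).
  rewrite exchange_big /= ; under eq_bigr do rewrite mulr_sumr.
  rewrite exchange_big /=; apply: eq_bigr => s _.
  rewrite (reindex_inj (addIr s)) /=; apply: eq_bigr => d _.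
  rewrite -psibarD; congr (psibar _ _ _); rewrite /h.
  by field.
rewrite (bigD1 0) //= [X in _ + X]big1 ?addr0 => [|d d0].
  rewrite (eq_bigr (fun=> 1)) => [|s _]; first by rewrite sumr_const -/q.
  by rewrite /h expr0n mulr0 mulr0 mul0r addr0 psibar0.
under eq_bigr do rewrite psibarD.
by rewrite -mulr_sumr sum_psibar ?mulr0 // mulf_neq0.
Qed.

End Character.

End LocalFieldTheory.

(** * Finite quotients *)

Section Transversals.
Variable V : zmodType.
Implicit Types (D L M N : set V) (u v w : V).

Definition subgroup M : Prop := M 0 /\ forall u v, M u -> M v -> M (u - v).

Lemma subgroup0 M : subgroup M -> M 0. Proof. by case. Qed.

Lemma subgroupB M u v : subgroup M -> M u -> M v -> M (u - v).
Proof. by case=> _; apply. Qed.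

Lemma subgroupN M u : subgroup M -> M u -> M (- u).
Proof. by move=> gM Mu; rewrite -sub0r; apply: subgroupB (subgroup0 gM) _. Qed.

Lemma subgroupD M u v : subgroup M -> M u -> M v -> M (u + v).
Proof.
by move=> gM Mu Mv; rewrite -[v]opprK; apply: subgroupB => //; exact: subgroupN.
Qed.

Lemma subgroupBC M u v : subgroup M -> M (u - v) -> M (v - u).
Proof. by move=> gM /(subgroupN gM); rewrite opprB. Qed.

Lemma subgroupDr M u v : subgroup M -> M u -> M (u + v) -> M v.
Proof.
by move=> gM Mu Muv; rewrite -[v](addKr u) addrC; apply: subgroupB.
Qed.

Lemma subgroup_trans M u v w :
  subgroup M -> M (u - v) -> M (v - w) -> M (u - w).
Proof. by move=> gM uv vw; rewrite -[u](subrK v) -addrA; exact: subgroupD. Qed.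

(** [D] is any set, not a subgroup: the sets to be counted include differences of two lattices. *)
Definition transversal (I : finType) D M (s : I -> V) : Prop :=
  [/\ forall i, D (s i),
      forall i j, M (s i - s j) -> i = j &
      forall w, D w -> exists i, M (w - s i)].

Definition has_index D M (n : nat) : Prop :=
  exists (I : finType) (s : I -> V), transversal D M s /\ #|I| = n.

Lemma transversal_leq (I J : finType) D M (s : I -> V) (t : J -> V) :
  subgroup M -> transversal D M s -> transversal D M t -> (#|I| <= #|J|)%N.
Proof.
move=> gM [Ds injs _] [_ _ surjt].
have [f fE] : {f : I -> J & forall i, M (s i - t (f i))}.
  by apply: (choice (P := fun i j => M (s i - t j))) => i; apply: surjt.
rewrite -(card_codom (f := f)) ?max_card // => i j ij; apply: injs.
apply: (subgroup_trans gM (fE i)); rewrite ij; exact: subgroupBC.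
Qed.

Lemma has_index_uniq D M m n :
  subgroup M -> has_index D M m -> has_index D M n -> m = n.
Proof.
move=> gM [I [s [sP <-]]] [J [t [tP <-]]]; apply/eqP; rewrite eqn_leq.
by rewrite (transversal_leq gM sP tP) (transversal_leq gM tP sP).
Qed.

Lemma has_indexM L M N a b :
  subgroup L -> subgroup M -> subgroup N -> N `<=` M -> M `<=` L ->
  has_index L M a -> has_index M N b -> has_index L N (a * b).
Proof.
move=> gL gM gN sNM sML [I [s [[Ls injs surjs] <-]]] [J [t [[Mt injt surjt] <-]]].
exists (I * J)%type, (fun ij => s ij.1 + t ij.2); split; last exact: card_prod.
split=> [[i j]|[i j] [i' j'] /= h|w Lw] /=.
- by apply: subgroupD => //; apply: sML.
- have e : s i + t j - (s i' + t j') = (t j - t j') + (s i - s i').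
    by rewrite opprD addrACA addrC.
  have ii : i = i'.
    apply: injs; apply: (@subgroupDr M (t j - t j')) => //; last first.
      by rewrite -e; apply: sNM.
    exact: subgroupB.
  by move: e h; rewrite ii subrr addr0 => -> /injt ->.
- have [i Mi] := surjs w Lw; have [j Nj] := surjt _ Mi; exists (i, j) => /=.
  by rewrite opprD addrA.
Qed.

Lemma has_index_sub D D' M a b :
  subgroup M -> D' `<=` D -> (forall u v, M (u - v) -> D' v -> D' u) ->
  has_index D M a -> has_index D' M b ->
  (b <= a)%N /\ has_index (D `\` D') M (a - b).
Proof.
move=> gM sD satD' [I [s [[Ds injs surjs] <-]]] bP.
pose P i := `[< D' (s i) >].
have b_eq : b = #|[pred i | P i]|.
  apply: (has_index_uniq gM bP); rewrite -card_sig.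
  exists {i | P i}, (s \o val); split=> //; split=> [[i Pi]|i j /=|w Dw] /=.
  - exact/asboolP.
  - by move=> /injs; apply: val_inj.
  - have [i Mi] := surjs w (sD _ Dw).
    have Pi : P i by apply/asboolP; apply: satD' Dw; exact: subgroupBC.
    by exists (exist _ i Pi).
have aE : #|I| = (b + #|[pred i | ~~ P i]|)%N by rewrite b_eq cardC.
split; first by rewrite aE leq_addr.
rewrite aE addKn -card_sig.
exists {i | ~~ P i}, (s \o val); split=> //; split=> [[i Pi]|i j /=|w [Dw nDw]] /=.
- by split=> //; apply/asboolPn.
- by move=> /injs; apply: val_inj.
- have [i Mi] := surjs w Dw.
  have Pi : ~~ P i by apply/asboolPn => Di; apply: nDw; apply: satD' Di.
  by exists (exist _ i Pi).
Qed.

(** The points [s i] may repeat a coset or lie outside [L]. An index is kept when it is the one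
    picked in its class and its point lies in [L]. *)
Lemma has_index_cover L M (I : finType) (s : I -> V) :
  subgroup L -> subgroup M -> M `<=` L ->
  (forall w, L w -> exists i, M (w - s i)) -> exists n, has_index L M n.
Proof.
move=> gL gM sML surjs.
pose e i := [pred j | `[< M (s i - s j) >]].
pose r i := [pick j in e i].
have eP i j : j \in e i -> r i = r j.
  move=> /asboolP ij; apply: eq_pick => k /=; apply/asboolP/asboolP => h.
    exact: subgroup_trans (subgroupBC gM ij) h.
  exact: subgroup_trans ij h.
pose P i := (r i == Some i) && `[< L (s i) >].
exists #|{: {i | P i}}|, {i | P i}, (s \o val); split=> //.
split=> [[i /andP[_ /asboolP]]//|[i Pi] [j Pj] /= h|w Lw].
  apply: val_inj => /=; case/andP: (Pi) => /eqP ri _; case/andP: (Pj) => /eqP rj _.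
  suff : Some i = Some j by case.
  by rewrite -ri -rj; apply: eP; apply/asboolP.
have [i Mi] := surjs w Lw.
case E : (r i) => [k|]; last first.
  move: E; rewrite /r; case: pickP => // /(_ i) /asboolP[].
  by rewrite subrr; exact: subgroup0.
have ek : k \in e i by move: E; rewrite /r; case: pickP => // k' ek' [<-].
have Mik : M (s i - s k) by apply/asboolP.
have Mk : M (w - s k) by exact: subgroup_trans Mi Mik.
have Pk : P k.
  rewrite /P -(eP _ _ ek) E eqxx; apply/asboolP.
  by rewrite -[s k]opprK; apply: (subgroupN gL); apply: (subgroupDr gL Lw); apply: sML.
by exists (exist _ k Pk).
Qed.

Definition half_transversal (J : finType) D M (t : J -> V) : Prop :=
  [/\ forall j, D (t j),
      forall i j, M (t i - t j) \/ M (t i + t j) -> i = j &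
      forall w, D w -> exists j, M (w - t j) \/ M (w + t j)].

Lemma half_transversal_exists D M n :
  subgroup M -> (forall u, M (u + u) -> M u) ->
  (forall u, D u -> D (- u)) -> (forall u, D u -> ~ M u) ->
  has_index D M n ->
  exists (J : finType) (t : J -> V), half_transversal D M t /\ (#|J| * 2)%N = n.
Proof.
move=> gM M2 DN DM [I [s [[Ds injs surjs] <-]]].
have [f fE] : {f : I -> I & forall i, M (- s i - s (f i))}.
  by apply: (choice (P := fun i j => M (- s i - s j))) => i; apply/surjs/DN.
have fE' i : M (s i + s (f i)).
  by rewrite -[_ + _]opprK opprD; exact: subgroupN.
have ff i : f (f i) = i.
  apply: injs; rewrite -[s _ - _]addr0 -(subrr (s (f i))).
  rewrite addrACA -opprD [_ + s (f i)]addrC.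
  exact: subgroupB.
have fneq i : f i != i.
  by apply/eqP => fi; apply: (DM _ (Ds i)); apply: M2; rewrite -{2}fi.
(* The enumeration order selects one index in each pair exchanged by [f]. *)
pose P i := (enum_rank i < enum_rank (f i))%N.
have PN i : ~~ P i = P (f i).
  rewrite /P ff -leqNgt leq_eqVlt; case: eqP => // /val_inj/enum_rank_inj/eqP.
  by rewrite (negbTE (fneq i)).
exists {i | P i}, (s \o val); split; last first.
  rewrite card_sig muln2 -addnn -[in RHS](cardC P); congr (_ + _)%N.
  rewrite -(fintype.card_image (can_inj ff) P); apply: eq_card => i.
  rewrite -[i in LHS]ff fintype.mem_image; last exact: can_inj ff.
  by rewrite [RHS]PN.
split=> [[i Pi]|[i Pi] [j Pj] /= h|w Dw]; first exact: Ds.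
  apply: val_inj => /=; case: h => [/injs//|h].
  have ij : i = f j.
    apply: injs; rewrite -[s i](addrK (s j)) -addrA -opprD.
    exact: subgroupB.
  by move: Pi Pj; rewrite /P ij ff => /ltnW; rewrite leqNgt => /negbTE->.
have [i Mi] := surjs w Dw.
have [Pi|nPi] := boolP (P i); first by exists (exist _ i Pi); left.
have Pfi : P (f i) by rewrite -PN.
exists (exist _ (f i) Pfi); right => /=.
by rewrite -[w](subrK (s i)) -addrA; exact: subgroupD.
Qed.

End Transversals.

(** * Lattices *)

Section LatticeTheory.
Variables (K : localField) (W : vectType K).
Implicit Types (L M N : set W) (c : K) (u v w : W).

HB.instance Definition _ := isPointed.Build (canonical_top W) (0 : W).

Definition omodule L : Prop :=
  [/\ L 0, forall u v, L u -> L v -> L (u + v) &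
      forall c u, powideal 0 c -> L u -> L (c *: u)].

Lemma omoduleZ L c u : omodule L -> powideal 0 c -> L u -> L (c *: u).
Proof. by case=> _ _; apply. Qed.

Lemma omodule_subgroup L : omodule L -> subgroup L.
Proof.
move=> [L0 LD LZ]; split=> // u v Lu Lv; apply: LD => //.
by rewrite -scaleN1r; apply: LZ => //; apply/powidealN/powideal1.
Qed.

Lemma lattice_omodule L : is_lattice L -> omodule L.
Proof. by case=> L0 LD LZ _ _; split=> // c u /intringE; exact: LZ. Qed.

Lemma dilationE c L w : c != 0 -> dilation c L w <-> L (c^-1 *: w).
Proof.
move=> c0; split=> [[v Lv <-]|Lw]; first by rewrite scalerA mulVf // scale1r.
by exists (c^-1 *: w) => //; rewrite scalerA divff // scale1r.
Qed.

Lemma dilation_omodule c L : c != 0 -> omodule L -> omodule (dilation c L).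
Proof.
move=> c0 [L0 LD LZ]; split=> [|u v|a u a0].
- by apply/dilationE; rewrite ?scaler0.
- by rewrite !dilationE // scalerDr; exact: LD.
- by rewrite !dilationE // scalerA mulrC -scalerA; exact: LZ.
Qed.

Lemma dilation_sub c L M : L `<=` M -> dilation c L `<=` dilation c M.
Proof. by move=> sLM _ [v /sLM Mv <-]; exists v. Qed.

Lemma dilationM c c' L : dilation c (dilation c' L) = dilation (c * c') L.
Proof.
apply/seteqP; split=> [_ [_ [v Lv <-] <-]|_ [v Lv <-]].
  by exists v => //; rewrite scalerA.
by exists (c' *: v); [exists v|rewrite scalerA].
Qed.

Lemma dilation1 L : dilation 1 L = L.
Proof.
apply/seteqP; split=> [_ [v Lv <-]|v Lv]; first by rewrite scale1r.
by exists v => //; rewrite scale1r.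
Qed.

Lemma has_index_dilation c L M n :
  c != 0 -> has_index L M n -> has_index (dilation c L) (dilation c M) n.
Proof.
move=> c0 [I [s [[Ls injs surjs] <-]]]; exists I, (fun i => c *: s i); split=> //.
split=> [i|i j|w]; first by exists (s i).
  rewrite dilationE // -scalerBr scalerA mulVf // scale1r; exact: injs.
rewrite dilationE // => /surjs[i Mi]; exists i; apply/dilationE => //.
by rewrite scalerBr scalerA mulVf // scale1r.
Qed.

Definition std_lattice : set W :=
  [set w | forall i, powideal 0 (coord (vbasis {:W}) i w)].

Lemma std_omodule : omodule std_lattice.
Proof.
split=> [i|u v Lu Lv i|c u c0 Lu i]; first by rewrite linear0; exact: powideal0.
  by rewrite linearD; apply: powidealD; [exact: Lu|exact: Lv].
by rewrite linearZ /=; apply: powidealZ => //; exact: Lu.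
Qed.

Lemma dilation_stdE (n : int) w : dilation (unif ^ n) std_lattice w <->
  forall i, powideal n (coord (vbasis {:W}) i w).
Proof.
rewrite dilationE ?unifz_neq0 // invr_expz.
have E i : powideal 0 (coord (vbasis {:W}) i (unif ^ (- n) *: w)) <->
    powideal n (coord (vbasis {:W}) i w).
  by rewrite linearZ /= powideal_unif_mul opprK add0r.
by split=> h i; apply/E; apply: h.
Qed.

Lemma std_index :
  has_index std_lattice (dilation unif std_lattice) (#|residue K| ^ \dim {:W}).
Proof.
have bW : basis_of {:W} (vbasis {:W}) by exact: vbasisP.
have fr : free (vbasis {:W}) by exact: basis_free bW.
pose s (f : {ffun 'I_(\dim {:W}) -> residue K}) : W :=
  \sum_i lift_red (f i) *: (vbasis {:W})`_i.
have sE f i : coord (vbasis {:W}) i (s f) = lift_red (f i).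
  exact: coord_sum_free.
exists {ffun 'I_(\dim {:W}) -> residue K}, s; split; last by rewrite card_ffun card_ord.
have unifE w : dilation unif std_lattice w <->
    forall i, powideal 1 (coord (vbasis {:W}) i w).
  exact: (dilation_stdE 1).
split=> [f i|f g /unifE fg|w Lw].
- by rewrite sE; have [] := lift_redP (f i).
- apply/ffunP => i; have := fg i; rewrite linearB /= !sE.
  have [Of fE] := lift_redP (f i); have [Og gE] := lift_redP (g i).
  by move=> h; rewrite -[LHS]fE -[RHS]gE; apply/red_eq.
- exists [ffun i => reduction (coord (vbasis {:W}) i w)]; apply/unifE => i.
  rewrite linearB /= sE ffunE.
  have [Of fE] := lift_redP (reduction (coord (vbasis {:W}) i w)).
  by apply/red_eq => //; exact: Lw.
Qed.

Lemma canonical_openE (U : set W) :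
  open (U : set (canonical_top W)) = canonical_open U.
Proof. by []. Qed.

Lemma open_omoduleP M : omodule M ->
  open (M : set (canonical_top W)) <->
  exists n : int, dilation (unif ^ n) std_lattice `<=` M.
Proof.
rewrite canonical_openE => -[M0 MD _]; split=> [oM|[n nM] u Mu].
  have [n nM] := oM 0 M0; exists n => w /dilation_stdE wn.
  by rewrite -[w]add0r; exact: nM.
by exists n => w wn; apply: MD => //; apply: nM; apply/dilation_stdE.
Qed.

(** The cosets of the open module [M] form an open cover of [L], from which compactness extracts a
    finite one. *)
Lemma lattice_has_index L M :
  is_lattice L -> omodule M -> open (M : set (canonical_top W)) -> M `<=` L ->
  exists n, has_index L M n.
Proof.
move=> lL mM oM sML; have mL := lattice_omodule lL.
case: lL => _ _ _ + _; rewrite compact_cover => cL.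
have gM := omodule_subgroup mM.
have [|w Lw|D sD covD] := cL W L (fun u => [set w | M (w - u)]).
- move=> u Lu; rewrite canonical_openE => w Mw.
  have /(open_omoduleP mM)[n nM] := oM.
  exists n => v vn /=; rewrite addrAC; apply: (subgroupD gM) => //.
  by apply: nM; apply/dilation_stdE.
- by exists w => //=; rewrite subrr; exact: subgroup0.
apply: (@has_index_cover _ L M D (fun i => val i)) => //.
  exact: omodule_subgroup.
by move=> w /covD[u /= Du Mu]; exists [` Du]%fset.
Qed.

Lemma dilation_unif_sub L : omodule L -> dilation unif L `<=` L.
Proof.
move=> mL _ [v Lv <-]; apply: (omoduleZ mL) => //.
exact: powideal_unif.
Qed.

(** For a multiple [N] of the standard lattice inside [L], the index of [unif N] in [L] is computed
    through [unif L] and through [N]. Since [[L : N] = [unif L : unif N]], this common factor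
    cancels and the count reduces to coordinates. *)
Lemma lattice_index_unif L : is_lattice L ->
  has_index L (dilation unif L) (#|residue K| ^ \dim {:W}).
Proof.
move=> lL; have mL := lattice_omodule lL.
have oL : open (L : set (canonical_top W)) by case: lL.
have /(open_omoduleP mL)[n nL] := oL.
set N := dilation (unif ^ n) std_lattice in nL.
have u0 := unif_neq0 K.
have mN : omodule N by apply: dilation_omodule (unifz_neq0 _ _) std_omodule.
have mLu := dilation_omodule u0 mL; have mNu := dilation_omodule u0 mN.
have oN : open (N : set (canonical_top W)) by apply/open_omoduleP => //; exists n.
have oLu : open (dilation unif L : set (canonical_top W)).
  apply/open_omoduleP => //; exists (1 + n).
  rewrite expfzDr // expr1z -dilationM; exact: dilation_sub.
have [a aP] := lattice_has_index lL mN oN nL.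
have [b bP] := lattice_has_index lL mLu oLu (dilation_unif_sub mL).
have aP' := has_index_dilation u0 aP.
have cP : has_index N (dilation unif N) (#|residue K| ^ \dim {:W}).
  rewrite /N dilationM mulrC -dilationM.
  by apply: has_index_dilation (unifz_neq0 _ _) std_index.
have LuNu := dilation_sub (c := unif) nL.
have g := omodule_subgroup.
have P1 := has_indexM (g _ mL) (g _ mLu) (g _ mNu) LuNu (dilation_unif_sub mL) bP aP'.
have P2 := has_indexM (g _ mL) (g _ mN) (g _ mNu) (dilation_unif_sub mN) nL aP cP.
have := has_index_uniq (g _ mNu) P1 P2; rewrite mulnC => /eqP.
rewrite eqn_pmul2l => [/eqP <-//|].
have [I [s [[_ _ surjs] <-]]] := aP; have [] := surjs 0; last first.
  by move=> i _; apply/card_gt0P; exists i.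
by case: mL.
Qed.

Lemma omodule_dilation_le L (k : nat) : omodule L -> L `<=` dilation (unif ^- k) L.
Proof.
move=> mL w Lw; apply/dilationE; first by rewrite invr_eq0 expf_neq0 ?unif_neq0.
rewrite invrK; apply: (omoduleZ mL) => //.
exact: powideal_unifn.
Qed.

Lemma lattice_index_unifX L (k : nat) : is_lattice L ->
  has_index (dilation (unif ^- k) L) L (#|residue K| ^ (\dim {:W} * k)).
Proof.
move=> lL; have mL := lattice_omodule lL; have g := omodule_subgroup.
elim: k => [|k IHk].
  rewrite muln0 expn0 expr0 invr1 dilation1; exists unit, (fun=> 0).
  split; last exact: card_unit.
  split=> [_|[] []//|w Lw]; first by case: mL.
  by exists tt; rewrite subr0.
have u0 (m : nat) : (unif : K) ^- m != 0 by rewrite invr_eq0 expf_neq0 ?unif_neq0.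
rewrite mulnS expnD; apply: has_indexM IHk; try exact: g.
- exact/g/dilation_omodule.
- exact/g/dilation_omodule.
- exact: omodule_dilation_le.
- rewrite exprS invfM mulrC -dilationM; apply: dilation_sub.
  exact: (omodule_dilation_le 1).
have -> : dilation (unif ^- k) L = dilation (unif ^- k.+1) (dilation unif L).
  by rewrite dilationM exprS invfM mulrAC mulVf ?unif_neq0 // mul1r.
exact/has_index_dilation/lattice_index_unif.
Qed.

Lemma lattice_absorbing L w : is_lattice L -> exists k : nat, L (unif ^+ k *: w).
Proof.
move=> lL; have mL := lattice_omodule lL.
have oL : open (L : set (canonical_top W)) by case: lL.
have /(open_omoduleP mL)[n nL] := oL.
have [m mP] : exists m : int, forall i, powideal m (coord (vbasis {:W}) i w).
  suff : forall s : seq 'I_(\dim {:W}), exists m : int,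
      forall i, i \in s -> powideal m (coord (vbasis {:W}) i w).
    by move=> /(_ (enum 'I_(\dim {:W})))[m mP]; exists m => i; apply: mP; rewrite mem_enum.
  elim=> [|i s [m mP]]; first by exists 0.
  have [k kP] := powideal_exists (coord (vbasis {:W}) i w).
  exists (Num.min m k) => j; rewrite inE => /orP[/eqP->|/mP jm].
    by apply: (powidealW kP); rewrite ge_min lexx orbT.
  by apply: (powidealW jm); rewrite ge_min lexx.
exists `|n - m|%N; apply: nL; apply/dilation_stdE => i; rewrite linearZ /=.
apply/(powideal_unif_mul `|n - m|%N); apply: (powidealW (mP i)); lia.
Qed.

End LatticeTheory.

(** * Isometries stabilizing a lattice *)

(** [linfun] accepts any function but agrees with it only if it is linear; this lets isometries be
    defined by a formula and their linearity be checked afterwards. *)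
Lemma linfun_linearE (F : fieldType) (U V : vectType F) (f : U -> V) :
  linear f -> linfun f =1 f.
Proof.
move=> flin u.
pose F0 : {linear U -> V} :=
  HB.pack_for {linear U -> V} f (GRing.isLinear.Build F U V _ f flin).
exact: (lfunE F0).
Qed.

Record alternating_form (F : fieldType) (V : vectType F) (b : V -> V -> F) :
    Prop := AlternatingForm {
  formDl : forall u v w, b (u + v) w = b u w + b v w;
  formZl : forall c u v, b (c *: u) v = c * b u v;
  formC : forall u v, b u v = - b v u;
  form_nondeg : forall u, (forall v, b u v = 0) -> u = 0
}.

Section AlternatingFormTheory.
Variables (F : fieldType) (V : vectType F) (b : V -> V -> F).
Hypothesis bP : alternating_form b.
Implicit Types (u v w : V) (c : F) (g : 'End(V)).

Lemma formDr u v w : b u (v + w) = b u v + b u w.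
Proof. by rewrite (formC bP) (formDl bP) opprD -!(formC bP). Qed.

Lemma formZr c u v : b u (c *: v) = c * b u v.
Proof. by rewrite (formC bP) (formZl bP) -mulrN -(formC bP). Qed.

Lemma formNl u v : b (- u) v = - b u v.
Proof. by rewrite -scaleN1r (formZl bP) mulN1r. Qed.

Lemma formNr u v : b u (- v) = - b u v.
Proof. by rewrite -scaleN1r formZr mulN1r. Qed.

Lemma form0l u : b 0 u = 0.
Proof. by rewrite -(scale0r 0) (formZl bP) mul0r. Qed.

Lemma form0r u : b u 0 = 0.
Proof. by rewrite (formC bP) form0l oppr0. Qed.

Lemma form_self u : 2 != 0 :> F -> b u u = 0.
Proof.
move=> two0; apply/eqP; rewrite -(mulrI_eq0 _ (mulfI two0)) mulr_natl mulr2n.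
by rewrite {1}(formC bP) addNr.
Qed.

Lemma isometry_lker g : isometry_group b g -> lker g == 0%VS.
Proof.
move=> gP; apply/eqP/vspaceP => u; rewrite memv_ker memv0.
apply/eqP/eqP => [gu|->]; last by rewrite linear0.
by apply: (form_nondeg bP) => v; rewrite -gP gu form0l.
Qed.

Lemma isometryK g : isometry_group b g -> cancel g (g^-1)%VF.
Proof. by move/isometry_lker => g0; exact: lker0_lfunK. Qed.

Lemma isometryVK g : isometry_group b g -> cancel (g^-1)%VF g.
Proof. by move/isometry_lker => g0; exact: lker0_lfunVK. Qed.

Lemma isometryV g : isometry_group b g -> isometry_group b (g^-1)%VF.
Proof. by move=> gP u v; rewrite -gP !(isometryVK gP). Qed.

Lemma isometry_adj g u v :
  isometry_group b g -> b ((g^-1)%VF u) v = b u (g v).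
Proof. by move=> gP; rewrite -gP (isometryVK gP). Qed.

Definition transvection c u : 'End(V) := linfun (fun v => v + (c * b u v) *: u).

Lemma transvectionE c u v : transvection c u v = v + (c * b u v) *: u.
Proof.
rewrite /transvection linfun_linearE // => a x y.
rewrite formDr formZr scalerDr scalerA addrACA -scalerDl.
by congr (_ + _ *: _); rewrite mulrDr mulrCA.
Qed.

Lemma transvection_isometry c u :
  2 != 0 :> F -> isometry_group b (transvection c u).
Proof.
move=> two0 v w; rewrite !transvectionE !(formDl bP, formDr, formZl bP, formZr).
by rewrite form_self // (formC bP v u); ring.
Qed.

Lemma transvection_inv c u : 2 != 0 :> F ->
  forall v, ((transvection c u)^-1)%VF v = v - (c * b u v) *: u.
Proof.
move=> two0 v; have tP := transvection_isometry c u two0.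
apply: (can_inj (isometryK tP)).
rewrite (isometryVK tP) transvectionE formDr formNr formZr form_self //.
by rewrite mulr0 subr0 subrK.
Qed.

(* Only [b w a] and [b w' a] have to be inverted. *)
Definition mover w w' a : 'End(V) :=
  linfun (fun v => v + (b v a / b w a) *: (w' - w) +
    ((b v (w' - w) - b v a / b w a * b w w') / b w' a) *: a).

Lemma moverE w w' a v : mover w w' a v = v + (b v a / b w a) *: (w' - w) +
  ((b v (w' - w) - b v a / b w a * b w w') / b w' a) *: a.
Proof.
rewrite /mover linfun_linearE // => d x y.
move: (w' - w) => u; rewrite !(formDl bP _ _ a, formDl bP _ _ u, formZl bP).
set wa := (b w a)^-1; set wa' := (b w' a)^-1.
rewrite !scalerDr !scalerA.
have -> : (d * b x a + b y a) * wa = d * (b x a * wa) + b y a * wa by ring.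
have -> : (d * b x u + b y u - (d * (b x a * wa) + b y a * wa) * b w w') * wa' =
  d * ((b x u - b x a * wa * b w w') * wa') +
  (b y u - b y a * wa * b w w') * wa' by ring.
by rewrite !scalerDl (addrACA (d *: x) y) [LHS]addrACA.
Qed.

(** The map sends [w] to [w'], multiplies [a] by [b w a / b w' a], and adds to a vector orthogonal
    to [a] the multiple of [a] that preserves its product with [w]. These requirements force the
    formula. *)
Lemma mover_isometry w w' a : 2 != 0 :> F -> b w a != 0 -> b w' a != 0 ->
  isometry_group b (mover w w' a).
Proof.
move=> two0 wa wa' v1 v2; rewrite !moverE.
rewrite !(formDl bP, formDr, formZl bP, formZr, formNl, formNr, form_self) //.
rewrite (formC bP w' w) (formC bP a w) (formC bP a w') (formC bP w v2).
rewrite (formC bP w' v2) (formC bP a v2).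
by field; rewrite wa wa'.
Qed.

Lemma mover_id w w' a : 2 != 0 :> F -> b w a != 0 -> mover w w' a w = w'.
Proof.
move=> two0 wa; rewrite moverE divff // scale1r mul1r formDr formNr.
by rewrite form_self // subr0 subrr mul0r scale0r addr0 addrC subrK.
Qed.

End AlternatingFormTheory.

(** The [a] in [L] whose pairing with [w] lies in [powideal n] form a proper subgroup, and likewise
    for [w']; two proper subgroups do not cover [L]. If neither given witness works for both
    vectors, their sum does. *)
Lemma common_nonvanishing (K : localField) (W : vectType K) (beta : W -> W -> K)
    (L : set W) (n : int) w w' :
  alternating_form beta -> (forall u v, L u -> L v -> L (u + v)) ->
  (exists2 a, L a & ~ powideal n (beta w a)) ->
  (exists2 a, L a & ~ powideal n (beta w' a)) ->
  exists2 a, L a & ~ powideal n (beta w a) /\ ~ powideal n (beta w' a).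
Proof.
move=> bP LD [a La wa] [a' La' wa'].
have [wa2|wa2] := pselect (powideal n (beta w' a)); last by exists a.
have [wa2'|wa2'] := pselect (powideal n (beta w a')); last by exists a'.
exists (a + a'); first exact: LD.
rewrite !(formDr bP); split=> h; first by apply: wa; rewrite addrC in h; exact: powideal_addl h.
by apply: wa'; exact: powideal_addl h.
Qed.

(** * A good lattice between a self-dual lattice and its dual *)

(** The algebraic facts about the two lattices on which the representation theory relies.
    Reflexivity of [B] is a field because it will come from nondegeneracy of the residual form
    rather than from a duality theorem for lattices. *)
Record lattice_chain (K : localField) (W : vectType K) (lam : int)
    (beta : W -> W -> K) (B A : set W) : Prop := LatticeChain {
  chain_char : 2%N \notin [pchar (residue K)];
  chain_form : alternating_form beta;
  chain_omodB : omodule B;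
  chain_omodA : omodule A;
  chain_BA : B `<=` A;
  chain_AB : A `<=` dual_lattice lam beta B;
  chain_unif : dilation unif (dual_lattice lam beta B) `<=` B;
  chain_dualA : A = dual_lattice lam beta A;
  chain_reflexive : forall v, dual_lattice lam beta B v ->
    (forall u, dual_lattice lam beta B u -> powideal lam (beta v u)) -> B v;
  chain_absorbing : forall w, exists k : nat, A (unif ^+ k *: w)
}.

Section LatticeChainTheory.
Variables (K : localField) (W : vectType K) (lam : int) (beta : W -> W -> K).
Variables (B A : set W).
Hypothesis HC : lattice_chain lam beta B A.
Local Notation Bs := (dual_lattice lam beta B).
Local Notation KB := (stabilizer beta B).
Implicit Types (u v w a : W) (g : 'End(W)) (c : K) (k n : nat).

Let bP := chain_form HC.
Let two0 : 2 != 0 :> K := two_neq0 (chain_char HC).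
Let mA := chain_omodA HC.
Let mB := chain_omodB HC.

Lemma subgroupA : subgroup A. Proof. exact: omodule_subgroup. Qed.
Lemma subgroupB' : subgroup B. Proof. exact: omodule_subgroup. Qed.

Lemma dual_omodule (L : set W) : omodule (dual_lattice lam beta L).
Proof.
split=> [a _|u v Lu Lv a La|c u c0 Lu a La].
- by rewrite (form0l bP); exact: powideal0.
- by rewrite (formDl bP); apply: powidealD; [exact: Lu|exact: Lv].
- by rewrite (formZl bP); apply: powidealZ => //; exact: Lu.
Qed.

Lemma formA u v : A u -> A v -> powideal lam (beta u v).
Proof. by move=> Au; rewrite (chain_dualA HC) in Au; exact: Au. Qed.

Lemma dualAP v : (forall a, A a -> powideal lam (beta v a)) -> A v.
Proof. by move=> h; rewrite (chain_dualA HC). Qed.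

Lemma notinA v : ~ A v -> exists2 a, A a & ~ powideal lam (beta v a).
Proof.
move=> nAv; apply: contrapT => h; apply: nAv; apply: dualAP => a Aa.
by apply: contrapT => na; apply: h; exists a.
Qed.

Lemma formBBs u v : B u -> Bs v -> powideal lam (beta u v).
Proof.
by move=> Bu Bsv; rewrite (formC bP); apply: powidealN; exact: Bsv.
Qed.

Lemma sBBs : B `<=` Bs.
Proof. by move=> v /(chain_BA HC) /(chain_AB HC). Qed.

Lemma unif_Bs v : Bs v -> B (unif *: v).
Proof. by move=> Bsv; apply: (chain_unif HC); exists v. Qed.

Lemma powideal1_Bs c v : powideal 1 c -> Bs v -> B (c *: v).
Proof.
move=> [d /intringE d0 <-] Bsv; rewrite expr1z mulrC -scalerA.
by apply: (omoduleZ mB) => //; exact: unif_Bs.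
Qed.

Lemma formBs u v : Bs u -> Bs v -> powideal (lam - 1) (beta u v).
Proof.
move=> Bsu /unif_Bs Bv; have := Bsu _ Bv.
rewrite (formZr bP) -[unif]expr1z => /powideal_unif_mul; exact.
Qed.

(** Equality [g B = B] follows from two inclusions: the adjoint of [g] is its inverse, so the
    inverse of [g] maps [B] into the dual of [Bs], which is [B] by reflexivity. *)
Lemma stabilizer_intro g : isometry_group beta g ->
  (forall v, B v -> B (g v)) -> (forall v, Bs v -> Bs (g v)) -> KB g.
Proof.
move=> gP gB gBs; split=> //; apply/seteqP; split=> [_ [v Bv <-]|v Bv].
  exact: gB.
exists ((g^-1)%VF v); last exact: (isometryVK bP gP).
apply: (chain_reflexive HC) => [b Bb|b Bsb]; rewrite (isometry_adj bP) //.
  by apply: formBBs Bv _; apply: sBBs; exact: gB.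
by apply: formBBs Bv _; exact: gBs.
Qed.

Section Stabilizer.
Variable g : 'End(W).
Hypothesis gK : KB g.

Let gP : isometry_group beta g. Proof. by case: gK. Qed.

Lemma stabilizer_B v : B (g v) <-> B v.
Proof.
case: gK => _ /= gB; have E : [set g v | v in B] (g v) <-> B v.
  by split=> [[u Bu /(can_inj (isometryK bP gP)) <-//]|Bv]; exists v.
by rewrite gB in E.
Qed.

Lemma stabilizerV_B v : B ((g^-1)%VF v) <-> B v.
Proof.
rewrite -{2}(isometryVK bP gP v); apply: iff_sym; exact: stabilizer_B.
Qed.

Lemma stabilizer_Bs v : Bs (g v) <-> Bs v.
Proof.
split=> h b Bb.
  by rewrite -gP; apply: h; apply/stabilizer_B.
by rewrite -(isometryVK bP gP b) gP; apply: h; apply/stabilizerV_B.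
Qed.

Lemma stabilizerV_Bs v : Bs ((g^-1)%VF v) <-> Bs v.
Proof.
rewrite -{2}(isometryVK bP gP v); apply: iff_sym; exact: stabilizer_Bs.
Qed.

Lemma isometryV_A : (forall v, A v -> A (g v)) -> forall v, A v -> A ((g^-1)%VF v).
Proof.
move=> gA v Av; apply: dualAP => a Aa; rewrite (isometry_adj bP) //.
by apply: formA => //; exact: gA.
Qed.

End Stabilizer.

Lemma mover_stabilizer w w' a : Bs w -> Bs w' -> Bs a ->
  ~ powideal lam (beta w a) -> ~ powideal lam (beta w' a) ->
  KB (mover beta w w' a).
Proof.
move=> Bsw Bsw' Bsa wa wa'.
have [wa0 _] := notin_powideal wa; have [wa0' _] := notin_powideal wa'.
have mBs := dual_omodule B; have gBs := omodule_subgroup mBs.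
have Bsu : Bs (w' - w) by exact: (subgroupB gBs).
rewrite -[lam](subrK 1) in wa wa'.
(* Used with [m = 0] for [v] in [Bs], and with [m = 1] for [v] in [B]: there the coefficients are
   divisible by [unif], which brings the vectors [w' - w] and [a] of [Bs] into [B]. *)
have xy (m : int) v : 0 <= m -> powideal (m + (lam - 1)) (beta v a) ->
    powideal (m + (lam - 1)) (beta v (w' - w)) ->
    powideal m (beta v a / beta w a) /\ powideal m
      ((beta v (w' - w) - beta v a / beta w a * beta w w') / beta w' a).
  move=> m0 va vu; have x := powideal_div va wa; split=> //.
  apply: (powideal_div _ wa'); apply: powidealB => //.
  by apply: powidealM => //; exact: formBs.
apply: stabilizer_intro; first exact: mover_isometry.
  move=> v Bv; rewrite moverE //.
  have l1 : 1 + (lam - 1) = lam :> int by lia.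
  apply: (subgroupD subgroupB'); [apply: (subgroupD subgroupB') => //|].
    apply: powideal1_Bs => //; apply: (proj1 (xy 1 v _ _ _)) => //; rewrite l1;
    exact: formBBs.
  by apply: powideal1_Bs => //; apply: (proj2 (xy 1 v _ _ _)) => //; rewrite l1;
    exact: formBBs.
move=> v Bsv; rewrite moverE //.
apply: (subgroupD gBs); [apply: (subgroupD gBs) => //|];
  apply: (omoduleZ mBs) => //.
  by apply: (proj1 (xy 0 v _ _ _)) => //; rewrite add0r; exact: formBs.
by apply: (proj2 (xy 0 v _ _ _)) => //; rewrite add0r; exact: formBs.
Qed.

Lemma transitive_Bs w w' : Bs w -> ~ B w -> Bs w' -> ~ B w' ->
  exists2 g, KB g & g w = w'.
Proof.
have notinB v : Bs v -> ~ B v -> exists2 a, Bs a & ~ powideal lam (beta v a).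
  move=> Bsv nBv; apply: contrapT => h; apply: nBv.
  apply: (chain_reflexive HC) => // u Bsu; apply: contrapT => nu.
  by apply: h; exists u.
move=> Bsw nBw Bsw' nBw'; have [_ BsD _] := dual_omodule B.
have [a Bsa [wa wa']] :=
  common_nonvanishing bP BsD (notinB _ Bsw nBw) (notinB _ Bsw' nBw').
exists (mover beta w w' a); first exact: mover_stabilizer.
by apply: mover_id => //; have [] := notin_powideal wa.
Qed.

(** Taking [a] in [A] makes the mover preserve [A]: for [v] in [A] the coefficient of [w' - w] is
    divisible by [unif], so that term falls into [B], and the other term is an integral multiple of
    [a]. *)
Lemma transitive_A w w' : Bs w -> ~ A w -> Bs w' -> ~ A w' ->
  exists2 g, KB g & (forall a, A a -> A (g a)) /\ g w = w'.
Proof.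
move=> Bsw nAw Bsw' nAw'; have [_ AD _] := mA.
have [a Aa [wa wa']] := common_nonvanishing bP AD (notinA nAw) (notinA nAw').
have [wa0 _] := notin_powideal wa; have [wa0' _] := notin_powideal wa'.
have Bsa := chain_AB HC Aa.
exists (mover beta w w' a); first exact: mover_stabilizer.
split; last exact: mover_id.
move=> v Av; rewrite moverE //; rewrite -[lam](subrK 1) in wa wa'.
have Bsu : Bs (w' - w) by exact: (subgroupB (omodule_subgroup (dual_omodule B))).
have x : powideal 1 (beta v a / beta w a).
  by apply: (powideal_div _ wa); rewrite addrC subrK; exact: formA.
apply: (subgroupD subgroupA); [apply: (subgroupD subgroupA) => //|].
  by apply: (chain_BA HC); exact: powideal1_Bs.
apply: (omoduleZ mA) => //; apply: (powideal_div _ wa'); rewrite add0r.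
apply: powidealB; first by apply: formBs => //; exact: (chain_AB HC).
by apply: powidealZ; [exact: powidealW x _|exact: formBs].
Qed.

(** The smallest valuation of the form on [B] is now [lam] instead of [lam - 1], so the coefficients
    are only integral, even on [B]. This suffices because [w' - w] and [a] already lie in [B]. *)
Lemma transitive_B w w' : B w -> ~ Bs (unif^-1 *: w) -> B w' ->
  ~ Bs (unif^-1 *: w') -> exists2 g, KB g & g w = w'.
Proof.
have notinBs v : B v -> ~ Bs (unif^-1 *: v) ->
    exists2 a, B a & ~ powideal (lam + 1) (beta v a).
  move=> Bv nBv; apply: contrapT => h; apply: nBv => b Bb.
  rewrite (formZl bP) -exprN1; apply/powideal_unif_mul; rewrite opprK.
  by apply: contrapT => nu; apply: h; exists b.
move=> Bw nBw Bw' nBw'; have [_ BD _] := mB.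
have [a Ba [wa wa']] :=
  common_nonvanishing bP BD (notinBs _ Bw nBw) (notinBs _ Bw' nBw').
have [wa0 _] := notin_powideal wa; have [wa0' _] := notin_powideal wa'.
exists (mover beta w w' a); last exact: mover_id.
have Bu : B (w' - w) by exact: (subgroupB subgroupB').
have xy v : powideal lam (beta v a) -> powideal lam (beta v (w' - w)) ->
    powideal 0 (beta v a / beta w a) /\ powideal 0
      ((beta v (w' - w) - beta v a / beta w a * beta w w') / beta w' a).
  move=> va vu; have x : powideal 0 (beta v a / beta w a).
    by apply: (powideal_div _ wa); rewrite add0r.
  split=> //; apply: (powideal_div _ wa'); rewrite add0r.
  apply: powidealB => //; apply: powidealZ => //.
  by apply: formBBs => //; exact: sBBs.
have gBs := omodule_subgroup (dual_omodule B).
apply: stabilizer_intro; first exact: mover_isometry.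
  move=> v Bv; rewrite moverE //.
  have [x y] := xy v (formBBs Bv (sBBs Ba)) (formBBs Bv (sBBs Bu)).
  apply: (subgroupD subgroupB'); [apply: (subgroupD subgroupB') => //|];
    exact: (omoduleZ mB).
move=> v Bsv; rewrite moverE //; have [x y] := xy v (Bsv _ Ba) (Bsv _ Bu).
by apply: (subgroupD gBs); [apply: (subgroupD gBs) => //|];
  apply: sBBs; exact: (omoduleZ mB).
Qed.

Lemma levelP k w :
  A (unif ^+ k *: w) <-> forall a, A a -> powideal (lam - k%:Z) (beta w a).
Proof.
split=> [Aw a Aa|h].
  by have := formA Aw Aa; rewrite (formZl bP) exprnP => /powideal_unif_mul.
by apply: dualAP => a Aa; rewrite (formZl bP) exprnP; apply/powideal_unif_mul; exact: h.
Qed.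

Lemma level_succ k w : A (unif ^+ k *: w) -> A (unif ^+ k.+1 *: w).
Proof.
by rewrite exprS -scalerA; apply: (omoduleZ mA); exact: powideal_unif.
Qed.

Lemma level_leq k n w : (k <= n)%N -> A (unif ^+ k *: w) -> A (unif ^+ n *: w).
Proof.
move=> /subnK <-; elim: (n - k)%N => [//|i IHi] /IHi; rewrite addSn.
exact: level_succ.
Qed.

Lemma double_A u : A (u + u) -> A u.
Proof.
rewrite -mulr2n -scaler_nat => /(omoduleZ mA (powideal2V (chain_char HC))).
by rewrite scalerA mulVf // scale1r.
Qed.

(** Where [beta u q] has valuation at most [lam - k], the bound on the product forces [beta u p]
    into [powideal lam]. The remaining [u] are differences of [u0 + u] and [u0], to which this
    applies. *)
Lemma product_vanishing k (p q : W) u0 :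
  (forall u, A u -> powideal (2 * lam - k%:Z) (beta u p * beta u q)) ->
  A u0 -> ~ powideal (lam - k%:Z + 1) (beta u0 q) -> A p.
Proof.
move=> pq Au0 qu0.
have key u : A u -> ~ powideal (lam - k%:Z + 1) (beta u q) ->
    powideal lam (beta u p).
  move=> Au qu; have [qu0' _] := notin_powideal qu.
  rewrite -[beta u p](mulfK qu0'); apply: (powideal_div _ qu).
  by rewrite (_ : lam + _ = 2 * lam - k%:Z); [exact: pq|lia].
apply: dualAP => u Au; rewrite (formC bP); apply: powidealN.
have [uq|uq] := pselect (powideal (lam - k%:Z + 1) (beta u q)); last exact: key.
apply: (powideal_addl (key _ Au0 qu0)); rewrite -(formDl bP); apply: key.
  exact: (subgroupD subgroupA).
by rewrite (formDl bP) [X in powideal _ X]addrC => h; apply: qu0; exact: (powideal_addl uq h).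
Qed.

Section Separation.
Variables (R : realType) (psi : K -> R[i]).
Hypotheses (psi_char : unitary_character psi) (psi_cond : conductor psi lam).

(* Otherwise [b u (v - w) * b u (v + w)] lies in [unif ^ (2 lam - k)] for all
   [u] in [A], while one of the factors is sometimes of minimal valuation. *)
Lemma separating_transvection k v w :
  A (unif ^+ k.+1 *: v) -> A (unif ^+ k.+1 *: w) -> ~ A (unif ^+ k *: w) ->
  ~ A (v - w) -> ~ A (v + w) ->
  exists c u, [/\ A u, powideal (k.+1%:Z - lam) c &
    psi (2^-1 * (c * beta u v ^+ 2)) != psi (2^-1 * (c * beta u w ^+ 2))].
Proof.
move=> Av Aw nAw vBw vDw; apply: contrapT => nsep.
have pq u : A u ->
    powideal (2 * lam - k.+1%:Z) (beta u (v - w) * beta u (v + w)).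
  move=> Au; have -> : 2 * lam - k.+1%:Z = lam - (k.+1%:Z - lam) by lia.
  set Z := _ * _; have -> : Z = 2 * (2^-1 * Z) by rewrite mulrA divff // mul1r.
  apply: powidealZ (powideal_nat _ 2) _.
  apply: (psi_trivial psi_cond) => c cP.
  have -> : c * (2^-1 * Z) =
      2^-1 * (c * beta u v ^+ 2) - 2^-1 * (c * beta u w ^+ 2).
    by rewrite /Z !(formDr bP) (formNr bP); ring.
  rewrite (psiD psi_char) (psiN psi_char psi_cond); apply/eqP.
  rewrite -(inj_eq (mulIf (psi_neq0 psi_char (2^-1 * (c * beta u w ^+ 2))))).
  rewrite divfK ?psi_neq0 // mul1r; apply: contrapT => /negP ne.
  by apply: nsep; exists c, u.
have [u0 Au0 wu0] : exists2 u0, A u0 & ~ powideal (lam - k.+1%:Z + 1) (beta u0 w).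
  apply: contrapT => h; apply: nAw; apply/levelP => a Aa.
  rewrite (formC bP); apply: powidealN; apply: contrapT => na; apply: h.
  by exists a => //; rewrite (_ : lam - _ + _ = lam - k%:Z) //; lia.
have [qu|qu] := pselect (powideal (lam - k.+1%:Z + 1) (beta u0 (v + w))).
  apply: vDw; apply: (@product_vanishing k.+1 _ (v - w) u0) => //.
    by move=> u /pq; rewrite [X in powideal _ X]mulrC.
  move=> pu; apply: wu0; apply: (powideal_double (chain_char HC)).
  have -> : 2 * beta u0 w = beta u0 (v + w) - beta u0 (v - w).
    by rewrite !(formDr bP) (formNr bP); ring.
  exact: powidealB.
by apply: vBw; apply: (@product_vanishing k.+1 _ (v + w) u0).
Qed.

End Separation.

End LatticeChainTheory.

(** * The layers of the filtration generated by [B] and its dual *)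

Section Layers.
Variables (K : localField) (W : vectType K) (lam : int) (beta : W -> W -> K).
Variables (B A : set W).
Hypothesis HC : lattice_chain lam beta B A.
Local Notation Bs := (dual_lattice lam beta B).
Local Notation KB := (stabilizer beta B).
Implicit Types (u v w a : W) (g : 'End(W)) (c : K) (k n : nat).

Let bP := chain_form HC.
Let mA := chain_omodA HC.
Let mB := chain_omodB HC.
Let gA := subgroupA HC.

(** The dilates of [B] and of its dual alternate in the chain [Bs], [unif^-1 B], [unif^-1 Bs], and
    so on. A single index treats both families of subspaces at once: even layers give [Esub], odd
    ones [Esub1]. *)
Definition filt k : set W :=
  if odd k then dilation (unif ^- k./2.+1) B else dilation (unif ^- k./2) Bs.

Definition layer k : set W := if k is k'.+1 then filt k `\` filt k' else filt 0.

Lemma filtE k w :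
  filt k w <->
  if odd k then B (unif ^+ k./2.+1 *: w) else Bs (unif ^+ k./2 *: w).
Proof.
have u0 n : (unif : K) ^- n != 0 by rewrite invr_eq0 expf_neq0 ?unif_neq0.
by rewrite /filt; case: ifP => _; rewrite dilationE // invrK.
Qed.

Lemma filt_omodule k : omodule (filt k).
Proof.
have u0 n : (unif : K) ^- n != 0 by rewrite invr_eq0 expf_neq0 ?unif_neq0.
rewrite /filt; case: ifP => _; apply: dilation_omodule => //.
exact: (dual_omodule HC).
Qed.

Let gf k : subgroup (filt k) := omodule_subgroup (filt_omodule k).

Lemma filt0 : filt 0 = Bs.
Proof. by rewrite /filt /= expr0 invr1 dilation1. Qed.

Lemma filt_succ k : filt k `<=` filt k.+1.
Proof.
move=> w; rewrite !filtE /= uphalf_half; case: (odd k) => /=.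
  by rewrite add1n; exact: (sBBs HC).
by rewrite add0n exprS -scalerA; exact: (unif_Bs HC).
Qed.

Lemma filt_leq k n : (k <= n)%N -> filt k `<=` filt n.
Proof.
move=> /subnK <-; elim: (n - k)%N => [//|i IHi] w /IHi.
by rewrite addSn; exact: filt_succ.
Qed.

Lemma filtA k : A `<=` filt k.
Proof.
move=> w Aw; apply: (filt_leq (leq0n k)); rewrite filt0.
exact: (chain_AB HC).
Qed.

(** The exponent [k./2.+1] would do; the cruder [k.+1] avoids halves later. *)
Lemma filt_level k w : filt k w -> A (unif ^+ k.+1 *: w).
Proof.
rewrite filtE => fw; apply: (level_leq HC (k := k./2.+1)).
  by rewrite ltnS -divn2 leq_div.
case: (odd k) fw => [/(chain_BA HC)//|]; rewrite exprS -scalerA.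
by move=> /(unif_Bs HC) /(chain_BA HC).
Qed.

Lemma filt_exists w : exists k, filt k w.
Proof.
have [k Ak] := chain_absorbing HC w; exists k.*2.
by rewrite filtE odd_double doubleK; exact: (chain_AB HC).
Qed.

Lemma layer_filt k w : layer k w -> filt k w.
Proof. by case: k => [//|k] []. Qed.

Lemma layer_exists w : exists k, layer k w.
Proof.
have /asboolP ex : exists k, `[< filt k w >].
  by have [k fk] := filt_exists w; exists k; apply/asboolP.
have ex' : exists k, `[< filt k w >] by exact: asboolP ex.
exists (ex_minn ex'); case: ex_minnP => -[|k] /asboolP fk min //.
by split=> // fk'; have := min k (asboolT fk'); rewrite ltnn.
Qed.

Lemma layer_leq j k w : layer j w -> filt k w -> (j <= k)%N.
Proof.
case: j => [//|j] [_ nj] fk; rewrite leqNgt; apply/negP; rewrite ltnS => kj.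
exact/nj/(filt_leq kj).
Qed.

Lemma layer_uniq j k w : layer j w -> layer k w -> j = k.
Proof.
move=> jw kw; apply/eqP; rewrite eqn_leq.
by rewrite (layer_leq jw (layer_filt kw)) (layer_leq kw (layer_filt jw)).
Qed.

Lemma layer_notin k w : layer k.+1 w -> ~ Bs w.
Proof. by rewrite -filt0 => /layer_leq h /h. Qed.

Lemma filt_translate k u v : A (u - v) -> filt k v -> filt k u.
Proof. by move=> /(filtA k) /(subgroupD (gf k)) h /h; rewrite subrK. Qed.

Lemma layer_translate k u v : A (u - v) -> layer k v -> layer k u.
Proof.
move=> uv; case: k => [|k] /=; first exact: filt_translate.
case=> fv nv; split; first exact: filt_translate fv.
by move=> fu; apply: nv; apply: filt_translate fu; exact: subgroupBC.
Qed.

Lemma filtN k u : filt k u -> filt k (- u).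
Proof. exact: (subgroupN (gf k)). Qed.

Lemma layerN k u : layer k u -> layer k (- u).
Proof.
case: k => [|k] /=; first exact: filtN.
by case=> fu nu; split; [exact: filtN|move=> /filtN; rewrite opprK].
Qed.

Lemma stabilizer_filt g k v : KB g -> filt k (g v) <-> filt k v.
Proof.
move=> gK; rewrite !filtE; case: (odd k); rewrite -linearZ.
  exact: (stabilizer_B HC).
exact: (stabilizer_Bs HC).
Qed.

Lemma stabilizer_layer g k v : KB g -> layer k (g v) <-> layer k v.
Proof.
move=> gK; case: k => [|k] /=; first exact: stabilizer_filt.
have e j := stabilizer_filt j v gK.
by split=> -[fv nv]; split; try exact/e; move=> h; apply: nv; apply/e.
Qed.

Lemma stabilizerV_layer g k v : KB g -> layer k ((g^-1)%VF v) <-> layer k v.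
Proof.
move=> gK; have gP : isometry_group beta g by case: gK.
rewrite -{2}(isometryVK bP gP v); apply: iff_sym; exact: stabilizer_layer.
Qed.

(** Isometries commute with dilations, so a layer rescales to [Bs] minus [B] or to [B] minus
    [unif Bs], according to the parity of its index. *)
Lemma transitive_layer k w w' : layer k.+1 w -> layer k.+1 w' ->
  exists2 g, KB g & g w = w'.
Proof.
move=> [+ +] [+ +]; rewrite !filtE /= uphalf_half.
have un0 n : (unif : K) ^+ n != 0 by rewrite expf_neq0 ?unif_neq0.
have unV n : (unif : K) ^+ n = unif^-1 * unif ^+ n.+1.
  by rewrite exprS mulKf ?unif_neq0.
case: (odd k) => /=; rewrite ?add0n ?add1n => fw nw fw' nw'.
  have [g gK gw] := transitive_Bs HC fw nw fw' nw'; exists g => //.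
  by move: gw; rewrite linearZ => /(scalerI (un0 _)).
rewrite (unV k./2) -scalerA in nw; rewrite (unV k./2) -scalerA in nw'.
have [g gK gw] := transitive_B HC fw nw fw' nw'; exists g => //.
by move: gw; rewrite linearZ => /(scalerI (un0 _)).
Qed.

Section Index.
Variables (r l : nat).
Hypotheses (lA : is_lattice A) (dimW : \dim {:W} = (2 * r)%N).
Local Notation q := #|residue K|.
Hypotheses (iBA : has_index Bs A (q ^ l)) (iAB : has_index A B (q ^ l)).

Lemma residue_gt1 : (1 < q)%N.
Proof. exact: card_finNzRing_gt1. Qed.

Lemma index_filt_even n : has_index (filt n.*2) A (q ^ (2 * r * n + l)).
Proof.
have u0 : (unif : K) ^- n != 0 by rewrite invr_eq0 expf_neq0 ?unif_neq0.
rewrite /filt odd_double doubleK addnC expnD -dimW.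
have gd (L : set W) : omodule L -> subgroup (dilation (unif ^- n) L).
  by move=> mL; exact: (omodule_subgroup (dilation_omodule u0 mL)).
apply: (has_indexM (M := dilation (unif ^- n) A)).
- exact/gd/(dual_omodule HC).
- exact: gd.
- exact: gA.
- exact: omodule_dilation_le.
- exact/dilation_sub/(chain_AB HC).
- exact: has_index_dilation.
- exact: lattice_index_unifX.
Qed.

Lemma index_filt_odd n : exists2 x,
  has_index (filt n.*2.+1) A x & (q ^ l * x)%N = (q ^ (2 * r * n.+1))%N.
Proof.
have u0 : (unif : K) ^- n.+1 != 0 by rewrite invr_eq0 expf_neq0 ?unif_neq0.
have [x xP] : exists x, has_index (filt n.*2.+1) A x.
  have [I [s [[_ _ surjs] _]]] := index_filt_even n.+1.
  apply: (has_index_cover (I := I) (s := s)) => //; first exact: filtA.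
  by move=> w fw; apply: surjs; rewrite doubleS; exact: filt_succ.
exists x => //.
have E : filt n.*2.+1 = dilation (unif ^- n.+1) B.
  by rewrite /filt /= odd_double uphalf_double.
have gd (L : set W) : omodule L -> subgroup (dilation (unif ^- n.+1) L).
  by move=> mL; exact: (omodule_subgroup (dilation_omodule u0 mL)).
rewrite -dimW; apply: (has_index_uniq gA _ (lattice_index_unifX n.+1 lA)).
rewrite E in xP; apply: has_indexM xP.
- exact: gd.
- exact: gd.
- exact: gA.
- by rewrite -E; exact: filtA.
- exact/dilation_sub/(chain_BA HC).
- exact: has_index_dilation.
Qed.

End Index.

End Layers.

(** * Coset representatives *)

Section CosetRepresentatives.
Variables (K : localField) (W : vectType K).
Implicit Types (L M : set W) (u v w : W).

Lemma coset_repP M w : subgroup M -> M (coset_rep M w - w).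
Proof.
move=> gM; rewrite /coset_rep; case: xgetP => [u _ //|nex].
by case: (nex w); rewrite /= subrr; exact: subgroup0.
Qed.

Lemma coset_rep_eq M u v : subgroup M -> M (u - v) -> coset_rep M u = coset_rep M v.
Proof.
move=> gM uv; rewrite /coset_rep; congr (xget _ _); apply/seteqP; split=> w /= h.
  exact: subgroup_trans h uv.
exact: subgroup_trans h (subgroupBC gM uv).
Qed.

Lemma coset_rep_id M w : subgroup M -> coset_rep M (coset_rep M w) = coset_rep M w.
Proof. by move=> gM; apply: coset_rep_eq => //; exact: coset_repP. Qed.

Lemma coset_reps_id L M w : subgroup M -> coset_reps L M w -> coset_rep M w = w.
Proof. by move=> gM [v _ <-]; exact: coset_rep_id. Qed.

Lemma coset_reps_finite L M n : subgroup M -> has_index L M n ->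
  finite_set (coset_reps L M).
Proof.
move=> gM [I [s [[_ _ surjs] _]]].
apply: (sub_finite_set (B := [set coset_rep M (s i) | i in [set: I]])).
  by move=> _ [w /surjs[i Mi] <-]; exists i => //; apply/esym/coset_rep_eq.
exact/finite_image/finite_finset.
Qed.

End CosetRepresentatives.

(** * The lattice model *)

Section LatticeModelTheory.
Variables (R : realType) (K : localField) (psi : K -> R[i]) (lam : int).
Variables (W : vectType K) (beta : W -> W -> K) (B A : set W).
Hypotheses (psi_char : unitary_character psi) (psi_cond : conductor psi lam).
Hypothesis HC : lattice_chain lam beta B A.
Local Notation KB := (stabilizer beta B).
Implicit Types (u v w a : W) (g : 'End(W)) (c : K) (k n : nat) (s : bool).
Implicit Types (f h : W -> R[i]).

Let bP := chain_form HC.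
Let two0 : 2 != 0 :> K := two_neq0 (chain_char HC).
Let gA := subgroupA HC.
Let half x : powideal lam x -> psi (2^-1 * x) = 1.
Proof. by move=> lx; apply: (psi1 psi_cond); exact: powideal_half (chain_char HC) _ _ lx. Qed.

Definition quasi_periodic f : Prop :=
  forall a w, A a -> f (a + w) = psi (2^-1 * beta w a) * f w.

Definition has_parity s f : Prop := forall w, f (- w) = (-1) ^+ s * f w.

Lemma quasi_periodic_val f v w :
  quasi_periodic f -> A (v - w) -> f v = psi (2^-1 * beta w (v - w)) * f w.
Proof. by move=> qf vw; rewrite -qf // subrK. Qed.

Lemma quasi_periodic_eq0 f v w :
  quasi_periodic f -> A (v - w) -> f v = 0 -> f w = 0.
Proof.
move=> qf vw /eqP; rewrite (quasi_periodic_val qf vw) mulf_eq0.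
by rewrite (negbTE (psi_neq0 psi_char _)) => /eqP.
Qed.

Lemma quasi_periodicD (z : R[i]) f h : quasi_periodic f -> quasi_periodic h ->
  quasi_periodic (fun w => z * f w + h w).
Proof. by move=> qf qh a w Aa; rewrite qf // qh // mulrDr mulrCA. Qed.

Lemma has_parityD s (z : R[i]) f h : has_parity s f -> has_parity s h ->
  has_parity s (fun w => z * f w + h w).
Proof. by move=> pf ph w; rewrite pf ph mulrDr mulrCA. Qed.

(** On [A] a quasi-periodic function is determined by its value at 0. This is why the orbit [A]
    contributes to even functions only. *)
Lemma odd_vanishes f w : quasi_periodic f -> has_parity true f -> A w -> f w = 0.
Proof.
move=> qf pf Aw; have f0 : f 0 = 0.
  by have /eqP := pf 0; rewrite oppr0 expr1 mulN1r -addr_eq0 -mulr2n mulrn_eq0 => /eqP.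
by rewrite (quasi_periodic_val (w := 0) qf) ?subr0 // f0 mulr0.
Qed.

(** The only quasi-periodic function supported on [w + A] with value 1 at [w]. *)
Definition delta w : W -> R[i] := fun v =>
  if `[< A (v - w) >] then psi (2^-1 * beta w (v - w)) else 0.

(* For [w] in [A] both deltas are the indicator of [A], and only one is kept. *)
Definition orbit_fun s w : W -> R[i] := fun v =>
  delta w v + (if `[< A w >] then 0 else (-1) ^+ s * delta (- w) v).

Lemma delta_quasi_periodic w : quasi_periodic (delta w).
Proof.
move=> a v Aa; rewrite /delta -[a + v - w]addrA.
have E : A (a + (v - w)) <-> A (v - w).
  by split=> h; [exact: (subgroupDr gA Aa h)|exact: (subgroupD gA)].
have -> : `[< A (a + (v - w)) >] = `[< A (v - w) >] by apply/asboolP/asboolP => /E.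
case: asboolP => [vw|_]; last by rewrite mulr0.
rewrite -(psiD psi_char) -mulrDr; apply: (psi_eq psi_char psi_cond).
rewrite -mulrBr; apply: (powideal_half (chain_char HC)).
rewrite (formDr bP w a).
have -> : beta w a + beta w (v - w) - (beta v a + beta w (v - w)) =
    - beta (v - w) a by rewrite (formDl bP) (formNl bP); ring.
by apply: powidealN; exact: (formA HC).
Qed.

Lemma deltaN w v : delta (- w) v = delta w (- v).
Proof.
rewrite /delta opprK.
have -> : - v - w = - (v + w) by rewrite opprD.
have -> : `[< A (- (v + w)) >] = `[< A (v + w) >].
  by apply/asboolP/asboolP => /(subgroupN gA); rewrite ?opprK.
by rewrite (formNl bP) (formNr bP).
Qed.

Lemma delta_A w v : A w -> delta w v = if `[< A v >] then 1 else 0.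
Proof.
move=> Aw; rewrite /delta.
have -> : `[< A (v - w) >] = `[< A v >].
  apply/asboolP/asboolP => [h|Av]; last exact: (subgroupB gA).
  by rewrite -[v](subrK w); exact: (subgroupD gA).
case: asboolP => // Av; apply: half; apply: (formA HC) => //.
exact: (subgroupB gA).
Qed.

Lemma orbit_fun_quasi_periodic s w : quasi_periodic (orbit_fun s w).
Proof.
move=> a v Aa; rewrite /orbit_fun delta_quasi_periodic //.
case: asboolP => _; first by rewrite !addr0.
by rewrite delta_quasi_periodic // mulrDr mulrCA.
Qed.

Lemma orbit_fun_parity s w : (s -> ~ A w) -> has_parity s (orbit_fun s w).
Proof.
move=> sw v; rewrite /orbit_fun; case: asboolP => [Aw|nAw].
  case: s sw => [/(_ isT)//|_]; rewrite expr0 mul1r !addr0 !delta_A //.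
  congr (if _ then _ else _).
  by apply/asboolP/asboolP => /(subgroupN gA); rewrite ?opprK.
rewrite !deltaN opprK mulrDr mulrA -exprD addnn -muln2 mulnC exprM sqrrN expr1n.
by rewrite expr1n mul1r addrC.
Qed.

Lemma orbit_fun_id s w : orbit_fun s w w = 1.
Proof.
rewrite /orbit_fun /delta subrr opprK asboolT; last exact: subgroup0.
rewrite (form0r bP) mulr0 (psi0 psi_cond); case: asboolP => [|nAw]; first by rewrite addr0.
by rewrite asboolF ?mulr0 ?addr0 // => /(double_A HC).
Qed.

Lemma orbit_fun_supp s w v : orbit_fun s w v <> 0 -> A (v - w) \/ A (v + w).
Proof.
rewrite /orbit_fun /delta opprK; case: asboolP => [|_]; first by left.
by rewrite add0r; case: asboolP => // _; case: asboolP; [right|rewrite mulr0].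
Qed.

Lemma orbit_fun_val s f w v : quasi_periodic f -> has_parity s f ->
  A (v - w) \/ A (v + w) -> f v = f w * orbit_fun s w v.
Proof.
move=> qf pf vw0; rewrite /orbit_fun /delta.
case: asboolP => [vw|nvw].
  rewrite [LHS](quasi_periodic_val qf vw) mulrC; congr (_ * _).
  case: asboolP => [|nAw]; first by rewrite addr0.
  (* If [v] were also in [-w + A], then [w + w], hence [w], would be in [A]. *)
  rewrite opprK asboolF ?mulr0 ?addr0 // => vw'; apply: nAw; apply: (double_A HC).
  by have := subgroupB gA vw' vw; rewrite opprB addrC addrA subrK.
rewrite add0r opprK; case: vw0 => // vw.
have nAw : ~ A w.
  move=> Aw; apply: nvw; have := subgroupB gA vw (subgroupD gA Aw Aw).
  by rewrite opprD addrA addrK.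
rewrite (asboolF nAw) (asboolT vw) mulrCA.
have vwN : A (- v - w) by rewrite -opprD; exact: (subgroupN gA).
rewrite -[v in LHS]opprK pf; congr (_ * _).
rewrite (quasi_periodic_val qf vwN) mulrC; congr (_ * psi (_ * _)).
by rewrite -opprD (formNl bP) (formNr bP).
Qed.

Lemma orbit_fun_eq0 s w v : ~ (A (v - w) \/ A (v + w)) -> orbit_fun s w v = 0.
Proof. by move=> nvw; apply: contrapT => /orbit_fun_supp. Qed.

Lemma orbit_fun_unique s f w : quasi_periodic f -> has_parity s f ->
  (forall v, f v <> 0 -> A (v - w) \/ A (v + w)) ->
  f = (fun v => f w * orbit_fun s w v).
Proof.
move=> qf pf supp; apply/funext => v.
have [vw|nvw] := pselect (A (v - w) \/ A (v + w)); first exact: orbit_fun_val.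
by rewrite orbit_fun_eq0 // mulr0; apply: contrapT => /supp.
Qed.

Lemma orbit_expansion (J : finType) (D : set W) (t : J -> W) s f :
  half_transversal D A t -> quasi_periodic f -> has_parity s f ->
  (forall v, f v <> 0 -> D v) ->
  f = (fun v => \sum_j f (t j) * orbit_fun s (t j) v).
Proof.
move=> [_ injt surjt] qf pf supp; apply/funext => v.
have [Dv|nDv] := pselect (D v); last first.
  have fv : f v = 0 by apply: contrapT => /supp.
  rewrite fv big1 // => j _.
  have [vj|nvj] := pselect (A (v - t j) \/ A (v + t j)).
    by rewrite -orbit_fun_val.
  by rewrite orbit_fun_eq0 // mulr0.
have [j vj] := surjt v Dv.
rewrite (bigD1 j) //= -orbit_fun_val // big1 ?addr0 // => j' jj'.
rewrite orbit_fun_eq0 ?mulr0 // => vj'; case/eqP: jj'; apply: injt.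
case: vj vj' => vj [] vj'.
- by left; exact: subgroup_trans (subgroupBC gA vj') vj.
- right; have := subgroupB gA vj' vj.
  by rewrite opprB addrC addrA subrK addrC.
- right; have := subgroupB gA vj vj'.
  by rewrite opprB addrC addrA subrK.
- by left; have := subgroupB gA vj' vj; rewrite opprD addrACA subrr add0r.
Qed.

Lemma hnorm2_finite f (D : set W) n : has_index D A n ->
  (forall w, f w <> 0 -> D w) -> (hnorm2 A f < +oo)%E.
Proof.
move=> [I [s [[_ _ surjs] _]]] supp; rewrite /hnorm2.
rewrite (esumID D); last by move=> i _; rewrite lee_fin sqr_ge0.
rewrite [X in (_ + X)%E]esum1 ?adde0; last first.
  move=> w [_ nD]; have -> : f w = 0 by apply: contrapT => /supp.
  by rewrite normr0 expr0n.
have fin : finite_set (coset_reps setT A `&` D).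
  apply: (sub_finite_set (B := [set coset_rep A (s i) | i in [set: I]])).
    move=> w [rw /surjs[i Ai]]; exists i => //.
    rewrite -[RHS](coset_reps_id gA rw); exact/esym/coset_rep_eq.
  exact/finite_image/finite_finset.
rewrite esum_fset //; last by move=> i _; rewrite lee_fin sqr_ge0.
by rewrite fsbig_finite // sumEFin ltry.
Qed.

(** * The averaging operator of an element of the stabilizer *)

Section Operator.
Variable g : 'End(W).
Hypothesis gK : KB g.

Let gP : isometry_group beta g. Proof. by case: gK. Qed.
Let A' : set W := A `&` [set g a | a in A].

Let A'P a : A' a <-> A a /\ A ((g^-1)%VF a).
Proof.
split=> -[Aa].
  by case=> b Ab bE; split=> //; rewrite -bE (isometryK bP gP).
by split=> //; exists ((g^-1)%VF a) => //; exact: (isometryVK bP gP).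
Qed.

Let gA' : subgroup A'.
Proof.
split; first by apply/A'P; rewrite linear0; split; exact: subgroup0.
by move=> u v /A'P[Au Agu] /A'P[Av Agv]; apply/A'P; rewrite linearB;
  split; exact: (subgroupB gA).
Qed.

Let cs := coset_reps A A'.

Hypothesis iAB : exists n, has_index A B n.

(** The intersection of [A] and [g A] contains [B = g B], which has finite index in [A]. *)
Let cs_finite : finite_set cs.
Proof.
have [n [I [s [[_ _ surjs] _]]]] := iAB.
have [|w Aw|m mP] := has_index_cover (I := I) (s := s) gA gA'.
- by move=> w /A'P[].
- have [i Bi] := surjs w Aw; exists i; apply/A'P.
  by split; apply: (chain_BA HC) => //; apply/(stabilizerV_B HC gK).
exact: coset_reps_finite gA' mP.
Qed.

Let csA a : cs a -> A a.
Proof.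
move=> [w Aw <-]; rewrite -[coset_rep _ _](subrK w).
by apply: (subgroupD gA) => //; have [] := coset_repP w gA'.
Qed.

Definition Mop_term f w a : R[i] := psi (2^-1 * beta a w) * f ((g^-1)%VF (a + w)).

Let MopE f w : Mop psi beta A g f w =
  #|` fset_set cs|%:R^-1 * \sum_(a <- fset_set cs) Mop_term f w a.
Proof. by rewrite /Mop fsbig_finite. Qed.

Let card_cs : (#|` fset_set cs|%:R : R[i]) != 0.
Proof.
rewrite pnatr_eq0 cardfs_eq0; apply/negP => /eqP cs0.
have : coset_rep A' 0 \in fset_set cs.
  rewrite in_fset_set // inE; exists 0 => //; exact: subgroup0.
by rewrite cs0 inE.
Qed.

(** The factor produced by quasi-periodicity compensates the change of the character, up to [psi] of
    half of [beta a b], which is 1. The average thus does not depend on the chosen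
    representatives. *)
Lemma Mop_term_invariant f w a b : quasi_periodic f -> A a -> A b ->
  A ((g^-1)%VF (b - a)) -> Mop_term f w b = Mop_term f w a.
Proof.
move=> qf Aa Ab Ag; rewrite /Mop_term.
have -> : (g^-1)%VF (b + w) = (g^-1)%VF (b - a) + (g^-1)%VF (a + w).
  by rewrite -linearD addrA subrK.
rewrite qf // mulrA; congr (_ * _); rewrite -(psiD psi_char) -mulrDr.
rewrite (isometryV bP gP); apply: (psi_eq psi_char psi_cond); rewrite -mulrBr.
apply: (powideal_half (chain_char HC)).
rewrite !(formDl bP, formDr bP, formNr bP) (form_self bP) // (formC bP w b).
rewrite (formC bP w a).
have -> : beta b w + (beta a b - 0 + (- beta b w - - beta a w)) - beta a w =
  beta a b by ring.
exact: (formA HC).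
Qed.

Lemma Mop_const f w z : (forall a, A a -> Mop_term f w a = z) ->
  Mop psi beta A g f w = z.
Proof.
move=> h; rewrite MopE (eq_big_seq (fun=> z)) => [|a]; last first.
  by rewrite in_fset_set // inE => /csA /h.
by rewrite big_const_seq count_predT iter_addr_0 -[z *+ _]mulr_natl mulKf.
Qed.

Lemma Mop_preserving f w : quasi_periodic f -> (forall a, A a -> A (g a)) ->
  Mop psi beta A g f w = f ((g^-1)%VF w).
Proof.
move=> qf gAA; apply: Mop_const => a Aa.
rewrite (@Mop_term_invariant f w 0 a) //; last 2 first.
- exact: subgroup0.
- by rewrite subr0; exact: (isometryV_A HC gK).
by rewrite /Mop_term (form0l bP) mulr0 (psi0 psi_cond) mul1r add0r.
Qed.

(** Equal nonzero terms add up to a positive integer times one of them, and the coefficients have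
    characteristic 0. *)
Lemma Mop_neq0 f w a : A a -> Mop_term f w a <> 0 ->
  quasi_periodic f ->
  (forall b, A b -> Mop_term f w b <> 0 -> Mop_term f w b = Mop_term f w a) ->
  Mop psi beta A g f w <> 0.
Proof.
move=> Aa za qf h; rewrite MopE; apply/eqP; rewrite mulf_neq0 ?invr_eq0 //.
set z := Mop_term f w a in za h.
have hE b : A b -> Mop_term f w b = (Mop_term f w b != 0)%:R * z.
  move=> Ab; case: eqP => [->|nb] /=; first by rewrite mul0r.
  by rewrite mul1r; exact: h.
rewrite (eq_big_seq (fun b => (Mop_term f w b != 0)%:R * z)) => [|b]; last first.
  by rewrite in_fset_set // inE => /csA /hE.
rewrite -mulr_suml; apply: mulf_neq0; last exact/eqP.
rewrite -natr_sum pnatr_eq0 -lt0n.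
set b := coset_rep A' a; have Mb : A' (b - a) by exact: coset_repP.
have csb : b \in fset_set cs by rewrite in_fset_set // inE; exists a.
rewrite (big_rem b) //=.
have -> : Mop_term f w b = z.
  have /A'P[_ ?] := Mb; apply: Mop_term_invariant => //.
  by apply: csA; exists a.
by rewrite (introN eqP za).
Qed.

(** A translation or the negation permutes the cosets of [A'] in [A] without preserving the chosen
    representatives, so the actual change of index is [coset_rep A' \o e]; invariance of [F] then
    removes [coset_rep]. *)
Let reindex_cs (e : W -> W) (e' : W -> W) (F : W -> R[i]) :
  (forall a, A a -> A (e a)) -> (forall a, A a -> A (e' a)) ->
  cancel e e' -> cancel e' e ->
  (forall a b, A' (a - b) -> A' (e a - e b)) ->
  (forall a b, A' (a - b) -> A' (e' a - e' b)) ->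
  (forall a b, A a -> A b -> A' (b - a) -> F b = F a) ->
  \sum_(a <- fset_set cs) F a = \sum_(a <- fset_set cs) F (e a).
Proof.
move=> eA e'A ee' e'e eM e'M Finv; rewrite -!fsbig_finite //.
rewrite (reindex_fsbig (fun a => coset_rep A' (e a)) cs); last first.
  split=> [a csa|a b|a csa].
  - by exists (e a) => //; apply/eA/csA.
  - rewrite !inE => csa csb /= ab.
    rewrite -(coset_reps_id gA' csa) -(coset_reps_id gA' csb).
    apply: coset_rep_eq => //; rewrite -[a]ee' -[b]ee'; apply: e'M.
    apply: (subgroup_trans gA' (subgroupBC gA' (coset_repP (e a) gA'))).
    by rewrite ab; exact: coset_repP.
  - exists (coset_rep A' (e' a)); first by exists (e' a) => //; exact/e'A/csA.
    rewrite -[RHS](coset_reps_id gA' csa); apply: coset_rep_eq => //.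
    by rewrite -[X in _ - X]e'e; apply: eM; exact: coset_repP.
apply: eq_fsbigr => a; rewrite inE => csa; apply: Finv.
- exact/eA/csA.
- by apply: csA; exists (e a) => //; exact/eA/csA.
- exact: coset_repP.
Qed.

Lemma Mop_quasi_periodic f : quasi_periodic f ->
  quasi_periodic (Mop psi beta A g f).
Proof.
move=> qf a0 w Aa0; rewrite !MopE mulrCA; congr (_ * _).
rewrite mulr_sumr (@reindex_cs (+%R a0) (+%R (- a0)) (fun a => psi (2^-1 * beta w a0) * Mop_term f w a)).
- apply: eq_big_seq => a; rewrite in_fset_set // inE => /csA Aa.
  rewrite /Mop_term mulrA -(psiD psi_char) -mulrDr addrA [a + a0]addrC; congr (_ * _).
  apply: (psi_eq psi_char psi_cond); rewrite -mulrBr; apply: (powideal_half (chain_char HC)).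
  rewrite (formDr bP) (formDl bP) (formC bP w a0).
  have -> : beta a a0 + beta a w - (- beta a0 w + (beta a0 w + beta a w)) =
    beta a a0 by ring.
  exact: (formA HC).
- by move=> a; exact: (subgroupD gA).
- by move=> a; apply: (subgroupD gA); exact: (subgroupN gA).
- exact: addKr.
- exact: addNKr.
- by move=> a b; rewrite opprD addrACA subrr add0r.
- by move=> a b; rewrite opprD addrACA subrr add0r.
- move=> a b Aa Ab /A'P[_ Agab]; congr (_ * _); exact: Mop_term_invariant.
Qed.

Lemma Mop_parity s f : quasi_periodic f -> has_parity s f ->
  has_parity s (Mop psi beta A g f).
Proof.
move=> qf pf w; rewrite !MopE mulrCA; congr (_ * _).
rewrite mulr_sumr.
rewrite (@reindex_cs -%R -%R (fun a => (-1) ^+ s * Mop_term f w a)).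
- apply: eq_bigr => a _; rewrite /Mop_term (formNr bP) (formNl bP) mulrCA -pf.
  by rewrite -linearN opprD opprK.
- by move=> a; exact: (subgroupN gA).
- by move=> a; exact: (subgroupN gA).
- exact: opprK.
- exact: opprK.
- by move=> a b; rewrite -opprD; exact: subgroupN.
- by move=> a b; rewrite -opprD; exact: subgroupN.
- move=> a b Aa Ab /A'P[_ Agab]; congr (_ * _); exact: Mop_term_invariant.
Qed.

Definition restrict (D : set W) f : W -> R[i] :=
  fun w => if `[< D w >] then f w else 0.

(** Layers are unions of [A]-cosets and are stable under the stabilizer, so all terms of the average
    at [w] evaluate [f] in the layer of [w]. *)
Lemma Mop_restrict k f :
  Mop psi beta A g (restrict (layer lam beta B k) f) =
  restrict (layer lam beta B k) (Mop psi beta A g f).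
Proof.
apply/funext => w; rewrite /restrict !MopE.
have E a : a \in fset_set cs ->
    `[< layer lam beta B k ((g^-1)%VF (a + w)) >] = `[< layer lam beta B k w >].
  rewrite in_fset_set // inE => /csA Aa; apply/asboolP/asboolP.
    move=> /(stabilizerV_layer HC k (a + w) gK); apply: (layer_translate HC).
    by rewrite opprD addrCA subrr addr0; exact: (subgroupN gA).
  move=> lw; apply/(stabilizerV_layer HC k (a + w) gK).
  by apply: (layer_translate HC) lw; rewrite addrK.
rewrite (eq_big_seq (fun a => psi (2^-1 * beta a w) *
   if `[< layer lam beta B k w >] then f ((g^-1)%VF (a + w)) else 0)); last first.
  by move=> a /E; rewrite /Mop_term => ->.
by case: asboolP => // _; rewrite big1 ?mulr0 // => a _; rewrite mulr0.
Qed.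

End Operator.

End LatticeModelTheory.

(** * Subspaces stable under the stabilizer of [B] *)

Section StableSubspaces.
Variables (R : realType) (K : localField) (psi : K -> R[i]) (lam : int).
Variables (W : vectType K) (beta : W -> W -> K) (B A : set W).
Hypotheses (psi_char : unitary_character psi) (psi_cond : conductor psi lam).
Hypothesis HC : lattice_chain lam beta B A.
Hypothesis lA : is_lattice A.
Hypothesis iAB : exists n, has_index A B n.
Local Notation Bs := (dual_lattice lam beta B).
Local Notation KB := (stabilizer beta B).
Local Notation Mop := (Mop psi beta A).
Local Notation qper := (quasi_periodic psi beta A).
Local Notation layer := (layer lam beta B).
Local Notation orbit_fun := (orbit_fun psi beta A).
Implicit Types (u v w a : W) (g : 'End(W)) (c : K) (k n : nat) (s : bool).
Implicit Types (f h : W -> R[i]) (E : set (W -> R[i])).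

Let bP := chain_form HC.
Let two0 : 2 != 0 :> K := two_neq0 (chain_char HC).
Let mA := chain_omodA HC.
Let gA := subgroupA HC.

Definition transvection_char c u v : R[i] := psi (2^-1 * (c * beta u v ^+ 2)).

Section Transvection.
Variables (k : nat) (c : K) (u : W).
Hypotheses (Au : A u) (cP : powideal (k.+1%:Z - lam) c).
Let t := transvection beta c u.

Lemma transvection_A a : A a -> A (t a).
Proof.
move=> Aa; rewrite /t (transvectionE bP); apply: (subgroupD gA) => //.
apply: (omoduleZ mA) => //.
apply: (powidealW (powidealM cP (formA HC Au Aa))); lia.
Qed.

(** The coefficient [c * beta u v] is in [powideal k.+1] for [v] in [B], and in [powideal k] for [v]
    in [Bs]. The exponent of [c] starts at [1 - lam] so that the first case is always divisible by
    [unif]. *)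
Lemma transvection_stabilizer : KB t.
Proof.
have Bsu := chain_AB HC Au.
apply: (stabilizer_intro HC).
- exact: transvection_isometry.
- move=> v Bv; rewrite /t (transvectionE bP).
  apply: (subgroupD (subgroupB' HC)) => //; apply: (powideal1_Bs HC) => //.
  apply: (powidealW (powidealM cP (Bsu _ Bv))); lia.
- move=> v Bsv; rewrite /t (transvectionE bP).
  have mBs := dual_omodule HC B.
  apply: (subgroupD (omodule_subgroup mBs)) => //; apply: (omoduleZ mBs) => //.
  apply: (powidealW (powidealM cP (formBs HC Bsu Bsv))); lia.
Qed.

(** At this level [c * beta u v] is integral: the inverse transvection moves [v] by an element of
    [A], and quasi-periodicity turns this into a scalar. *)
Lemma Mop_transvection f v : qper f -> A (unif ^+ k.+1 *: v) ->
  Mop t f v = transvection_char c u v * f v.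
Proof.
move=> qf Av.
rewrite (Mop_preserving psi_char psi_cond HC transvection_stabilizer) //; last first.
  exact: transvection_A.
have cu : A (- ((c * beta u v) *: u)).
  apply: (subgroupN gA); apply: (omoduleZ mA) => //.
  rewrite (formC bP); have := proj1 (levelP HC _ _) Av _ Au.
  move=> /powidealN /(powidealM cP) h; apply: (powidealW h); lia.
rewrite /t (transvection_inv bP) // addrC qf //; congr (psi (_ * _) * _).
by rewrite (formNr bP) (formZr bP) (formC bP v u); ring.
Qed.

Lemma Mop_transvection0 f v : qper f ->
  (forall x, f x <> 0 -> A (unif ^+ k.+1 *: x)) ->
  ~ A (unif ^+ k.+1 *: v) -> Mop t f v = 0.
Proof.
move=> qf supp nAv.
rewrite (Mop_preserving psi_char psi_cond HC transvection_stabilizer) //; last first.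
  exact: transvection_A.
apply: contrapT => /supp Av; apply: nAv; move: Av => /transvection_A.
by rewrite -linearZ (isometryVK bP) //; exact: transvection_isometry.
Qed.

End Transvection.

(** At the smallest level containing both vectors, one of them is not in the preceding level and
    takes the part of [w] in [separating_transvection]. Level 0 is excluded since [v - w] is not in
    [A]. *)
Lemma separating_char v w : ~ A (v - w) -> ~ A (v + w) ->
  exists k c u, [/\ A u, powideal (k.+1%:Z - lam) c,
    A (unif ^+ k.+1 *: v), A (unif ^+ k.+1 *: w) &
    transvection_char c u v != transvection_char c u w].
Proof.
move=> vBw vDw.
pose P k := `[< A (unif ^+ k *: v) /\ A (unif ^+ k *: w) >].
have exP : exists k, P k.
  have [i vi] := chain_absorbing HC v; have [j wj] := chain_absorbing HC w.
  exists (maxn i j); apply/asboolP; split.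
    by apply: (level_leq HC _ vi); rewrite leq_maxl.
  by apply: (level_leq HC _ wj); rewrite leq_maxr.
case: (ex_minnP exP) => -[|k] /asboolP[Av Aw] min.
  by case: vBw; rewrite !expr0 !scale1r in Av Aw; exact: (subgroupB gA).
have [nAw|nAw] := pselect (A (unif ^+ k *: w)); last first.
  have [c [u [Au cP ne]]] := separating_transvection HC psi_char psi_cond Av Aw nAw vBw vDw.
  by exists k, c, u.
have nAv : ~ A (unif ^+ k *: v).
  by move=> Av'; have := min k (asboolT (conj Av' nAw)); rewrite ltnn.
have wBv : ~ A (w - v) by move=> /(subgroupBC gA).
have wDv : ~ A (w + v) by rewrite addrC.
have [c [u [Au cP ne]]] := separating_transvection HC psi_char psi_cond Aw Av nAv wBv wDv.
by exists k, c, u; split=> //; rewrite eq_sym.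
Qed.

Lemma opp_stabilizer : KB (- \1)%VF.
Proof.
apply: (stabilizer_intro HC) => [u v|v|v]; rewrite !lfunE /= !lfunE /=.
- by rewrite (formNl bP) (formNr bP) opprK.
- exact: (subgroupN (subgroupB' HC)).
- exact: (subgroupN (omodule_subgroup (dual_omodule HC B))).
Qed.

Lemma Mop_opp f : qper f -> Mop (- \1)%VF f = (fun w => f (- w)).
Proof.
move=> qf; apply/funext => w.
have oP : isometry_group beta (- \1)%VF by case: opp_stabilizer.
rewrite (Mop_preserving psi_char psi_cond HC opp_stabilizer) //.
  congr f; apply: (can_inj (isometryK bP oP)).
  by rewrite (isometryVK bP oP) !lfunE /= !lfunE /= opprK.
by move=> a Aa; rewrite !lfunE /= lfunE /=; exact: (subgroupN gA).
Qed.

Section Stable.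
Variable E : set (W -> R[i]).
Hypothesis linE : linear_subspace E.
Hypothesis stabE : forall g f, KB g -> E f -> E (Mop g f).

Lemma subspaceZ (z : R[i]) f : E f -> E (fun w => z * f w).
Proof.
move=> Ef; have [E0 ED] := linE; have := ED z f _ Ef E0.
by congr E; apply/funext => w; rewrite addr0.
Qed.

Lemma subspace_sum (J : finType) (z : J -> R[i]) (b : J -> W -> R[i]) :
  (forall j, E (b j)) -> E (fun w => \sum_j z j * b j w).
Proof.
move=> Eb; have [E0 ED] := linE.
elim: (index_enum J) => [|j s IHs].
  by move: E0; congr E; apply/funext => w; rewrite big_nil.
have := ED (z j) _ _ (Eb j) IHs.
by congr E; apply/funext => w; rewrite big_cons.
Qed.

(** For each [v], the operator [M(t) - chi(v)] of a transvection separating [v] from [w] annihilates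
    the value at [v] and multiplies the value at [w] by a nonzero number; earlier zeros persist
    because the operator is diagonal. *)
Lemma kill_classes k s f w (vs : seq W) : E f -> qper f -> has_parity s f ->
  (forall x, f x <> 0 -> A (unif ^+ k.+1 *: x)) -> f w <> 0 ->
  (forall v, v \in vs -> [/\ A (unif ^+ k.+1 *: v), ~ A (v - w), ~ A (v + w) &
    ~ A (unif ^+ k *: v) \/ ~ A (unif ^+ k *: w)]) ->
  exists f', [/\ E f', qper f', has_parity s f', f' w <> 0 &
    forall x, f' x <> 0 -> A (unif ^+ k.+1 *: x) /\ x \notin vs].
Proof.
move=> Ef qf pf supp fw; elim: vs => [_|v vs IHvs vsP].
  by exists f; split=> // x /supp.
have {IHvs} [|f' [Ef' qf' pf' fw' supp']] := IHvs.
  by move=> x xvs; apply: vsP; rewrite inE xvs orbT.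
have [Av vBw vDw prim] := vsP v (mem_head _ _).
have Aw := supp _ fw.
have [c [u [Au cP ne]]] : exists c u, [/\ A u, powideal (k.+1%:Z - lam) c &
    transvection_char c u v != transvection_char c u w].
  case: prim => [nAv|nAw].
    have wBv : ~ A (w - v) by move=> /(subgroupBC gA).
    have wDv : ~ A (w + v) by rewrite addrC.
    have [c [u [Au cP ne]]] :=
      separating_transvection HC psi_char psi_cond Aw Av nAv wBv wDv.
    by exists c, u; split=> //; rewrite eq_sym.
  exact: (separating_transvection HC psi_char psi_cond Av Aw nAw vBw vDw).
have tK := transvection_stabilizer Au cP.
have [E0 ED] := linE.
exists (fun x => - transvection_char c u v * f' x + Mop (transvection beta c u) f' x).
split.
- by apply: ED => //; exact: stabE.
- apply: quasi_periodicD => //.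
  exact: (Mop_quasi_periodic psi_char psi_cond HC tK).
- apply: has_parityD => //.
  exact: (Mop_parity psi_char psi_cond HC tK).
- rewrite (Mop_transvection Au cP) // -mulrDl addrC; apply/eqP.
  by rewrite mulf_neq0 ?(introN eqP fw') // subr_eq0 eq_sym.
move=> x; have [Ax|nAx] := pselect (A (unif ^+ k.+1 *: x)); last first.
  rewrite (Mop_transvection0 Au cP) // => [|y /supp'[]//].
  rewrite addr0 => h; case: nAx; apply: (proj1 (supp' x _)) => fx.
  by apply: h; rewrite fx mulr0.
rewrite (Mop_transvection Au cP) // -mulrDl => h; split=> //.
have [|_ xvs] := supp' x; first by move=> fx; apply: h; rewrite fx mulr0.
rewrite inE negb_or xvs andbT; apply/eqP => xv.
by apply: h; rewrite xv addNr mul0r.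
Qed.

(** Induction on the level: finitely many classes modulo [A] occur at a given level. A transvection
    of that level is only known to separate two classes when one of them is not of lower level,
    hence the last clause of [C]. *)
Lemma isolate k s f w : E f -> qper f -> has_parity s f ->
  (forall x, f x <> 0 -> A (unif ^+ k *: x)) -> f w <> 0 -> E (orbit_fun s w).
Proof.
have single f' : E f' -> qper f' -> has_parity s f' -> f' w <> 0 ->
    (forall v, f' v <> 0 -> A (v - w) \/ A (v + w)) -> E (orbit_fun s w).
  move=> Ef' qf' pf' fw' supp'; have := subspaceZ (f' w)^-1 Ef'; congr E.
  apply/funext => v; have := congr1 (fun h => h v) (orbit_fun_unique HC qf' pf' supp').
  by move=> /= ->; rewrite mulKf //; exact/eqP.
elim: k f => [|k IHk] f Ef qf pf supp fw.
  apply: (single f) => // v fv; left.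
  have := supp _ fw; have := supp _ fv; rewrite !expr0 !scale1r.
  exact: (subgroupB gA).
have u0 : (unif : K) ^- k.+1 != 0 by rewrite invr_eq0 expf_neq0 ?unif_neq0.
have [I [t [[At _ surjt] _]]] := lattice_index_unifX k.+1 lA.
pose C v := [/\ ~ A (v - w), ~ A (v + w) &
  ~ A (unif ^+ k *: v) \/ ~ A (unif ^+ k *: w)].
have [|f' [Ef' qf' pf' fw' supp']] :=
    kill_classes (vs := [seq t i | i <- enum I & `[< C (t i) >]]) Ef qf pf supp fw.
  move=> v /mapP[j]; rewrite mem_filter => /andP[/asboolP[c1 c2 c3] _] ->; split=> //.
  by have := At j; rewrite dilationE // invrK.
have clas x : f' x <> 0 -> exists2 y, A (x - y) & ~ C y.
  move=> fx; have [Ax _] := supp' _ fx.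
  have [|i Ai] := surjt x; first by rewrite dilationE // invrK.
  exists (t i) => // Ci; have ft : f' (t i) <> 0.
    by move=> /(quasi_periodic_eq0 psi_char qf' (subgroupBC gA Ai)).
  have [_ /negP] := supp' _ ft; apply.
  by apply: map_f; rewrite mem_filter mem_enum andbT; apply/asboolP.
(* If [w] is new at level [k.+1], all classes but its own have been removed. Otherwise the classes
   new at level [k.+1] have been removed, and the induction hypothesis treats the rest. *)
have [Aw|nAw] := pselect (A (unif ^+ k *: w)); last first.
  apply: (single f') => // x /clas[y xy nC].
  have [yw|nyw] := pselect (A (y - w)); first by left; exact: subgroup_trans xy yw.
  right; apply: contrapT => nxw; apply: nC; split=> //; last by right.
  move=> yw; apply: nxw; have := subgroupD gA xy yw.
  by rewrite addrA subrK.
apply: (IHk f') => // x /clas[y xy nC].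
have lev z z' : A (z - z') -> A (unif ^+ k *: z') -> A (unif ^+ k *: z).
  move=> zz' Az'; rewrite -[z](subrK z') scalerDr; apply: (subgroupD gA) => //.
  by apply: (omoduleZ mA) => //; exact: powideal_unifn.
apply: (lev _ y) => //; apply: contrapT => nAy; apply: nC; split; last by left.
  by move=> /lev /(_ Aw).
move=> yw; apply: nAy; apply: (lev _ (- w)); first by rewrite opprK.
by rewrite scalerN; exact: (subgroupN gA).
Qed.

Lemma isolate_layer k s f w : E f -> qper f -> has_parity s f ->
  (forall x, f x <> 0 -> layer k x) -> f w <> 0 -> E (orbit_fun s w).
Proof.
move=> Ef qf pf supp; apply: (isolate (k := k.+1)) Ef qf pf _ => x /supp /layer_filt.
exact: (filt_level HC).
Qed.

Lemma orbit_fun_layer k s w x : layer k w -> orbit_fun s w x <> 0 -> layer k x.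
Proof.
move=> lw /orbit_fun_supp[xw|xw]; first exact: (layer_translate HC xw lw).
by apply: (layer_translate HC (v := - w)); [rewrite opprK|exact: (layerN HC)].
Qed.

Lemma Mop_layer g f k : KB g -> (forall x, f x <> 0 -> layer k x) ->
  forall x, Mop g f x <> 0 -> layer k x.
Proof.
move=> gK supp x; have -> : f = restrict (layer k) f.
  apply/funext => y; rewrite /restrict; case: asboolP => // ny.
  by apply: contrapT => /supp.
by rewrite (Mop_restrict psi HC gK) // /restrict; case: asboolP.
Qed.

Lemma spread_orbit_fun g k s w w' : KB g -> layer k w -> (s -> ~ A w) ->
  E (orbit_fun s w) -> Mop g (orbit_fun s w) w' <> 0 -> E (orbit_fun s w').
Proof.
move=> gK lw sw Ew; have qw := orbit_fun_quasi_periodic psi_char psi_cond HC s w.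
have pw := orbit_fun_parity psi_cond HC sw.
apply: (isolate_layer (k := k)); first exact: stabE.
- exact: (Mop_quasi_periodic psi_char psi_cond HC gK).
- exact: (Mop_parity psi_char psi_cond HC gK).
- by apply: Mop_layer => // x; exact: orbit_fun_layer.
Qed.

Lemma orbit_fun_A0 s w : A w -> orbit_fun s w 0 <> 0.
Proof.
move=> Aw w0; have qw := orbit_fun_quasi_periodic psi_char psi_cond HC s w.
have Aw0 : A (0 - w) by rewrite sub0r; exact: (subgroupN gA).
have /eqP := quasi_periodic_eq0 psi_char qw Aw0 w0.
by rewrite (orbit_fun_id psi_cond HC) oner_eq0.
Qed.

Lemma orbit_fun_0A s w : A w -> orbit_fun s 0 w <> 0.
Proof.
move=> Aw w0; have q0 := orbit_fun_quasi_periodic psi_char psi_cond HC s 0.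
have Aw0 : A (w - 0) by rewrite subr0.
have /eqP := quasi_periodic_eq0 psi_char q0 Aw0 w0.
by rewrite (orbit_fun_id psi_cond HC) oner_eq0.
Qed.

(** For [w] outside [A], an isometry carries [w] to some [a] of [A] outside [B]. The image function
    is then nonzero at 0, because the terms of index [a] and [-a] agree by evenness; for an odd
    function they would be opposite. *)
Lemma orbit_fun_even_to0 w : Bs w -> E (orbit_fun false w) -> E (orbit_fun false 0).
Proof.
move=> Bsw Ew; have l0 : layer 0 w by rewrite /layer filt0.
have qw := orbit_fun_quasi_periodic psi_char psi_cond HC false w.
have pw : has_parity false (orbit_fun false w) by apply: (orbit_fun_parity psi_cond HC).
have [Aw|nAw] := pselect (A w).
  apply: (isolate_layer (k := 0) Ew qw pw); first by move=> x; exact: orbit_fun_layer.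
  exact: orbit_fun_A0.
have [a Aa wa] := notinA HC nAw.
have nBa : ~ B a by move=> Ba; apply: wa; exact: Bsw.
have nBw : ~ B w by move=> /(chain_BA HC).
have [g gK gw] := transitive_Bs HC Bsw nBw (chain_AB HC Aa) nBa.
have gP : isometry_group beta g by case: gK.
have ga : (g^-1)%VF a = w by rewrite -gw (isometryK bP gP).
apply: (spread_orbit_fun gK l0) => //.
have fa : Mop_term psi beta g (orbit_fun false w) 0 a = 1.
  rewrite /Mop_term (form0r bP) mulr0 (psi0 psi_cond) mul1r addr0 ga.
  exact: (orbit_fun_id psi_cond HC).
apply: (Mop_neq0 psi_char psi_cond HC gK iAB Aa) => //.
  by rewrite fa; exact/eqP/oner_neq0.
move=> b Ab nb; have : orbit_fun false w ((g^-1)%VF b) <> 0.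
  by move=> h; apply: nb; rewrite /Mop_term addr0 h mulr0.
move=> /orbit_fun_supp[h|h].
  by apply: (Mop_term_invariant psi_char psi_cond HC gK) => //; rewrite linearB /= ga.
transitivity (Mop_term psi beta g (orbit_fun false w) 0 (- a)).
  apply: (Mop_term_invariant psi_char psi_cond HC gK) => //; first exact: (subgroupN gA).
  by rewrite opprK linearD /= ga.
rewrite fa /Mop_term (form0r bP) mulr0 (psi0 psi_cond) mul1r addr0 linearN /= ga pw.
by rewrite expr0 mul1r (orbit_fun_id psi_cond HC).
Qed.

(** The isometry now carries some [a] of [A] to [w]; the nonzero terms at [w] are those equivalent
    to the term of index 0. *)
Lemma orbit_fun_even_from0 w : Bs w -> E (orbit_fun false 0) -> E (orbit_fun false w).
Proof.
move=> Bsw E0; have l0 : layer 0 0.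
  by rewrite /layer filt0; case: (dual_omodule HC B).
have q0 := orbit_fun_quasi_periodic psi_char psi_cond HC false 0.
have p0 : has_parity false (orbit_fun false 0) by apply: (orbit_fun_parity psi_cond HC).
have [Aw|nAw] := pselect (A w).
  apply: (isolate_layer (k := 0) E0 q0 p0); first by move=> x; exact: orbit_fun_layer.
  exact: orbit_fun_0A.
have [a Aa wa] := notinA HC nAw.
have nBa : ~ B a by move=> Ba; apply: wa; exact: Bsw.
have nBw : ~ B w by move=> /(chain_BA HC).
have [g gK gw] := transitive_Bs HC (chain_AB HC Aa) nBa Bsw nBw.
have gP : isometry_group beta g by case: gK.
have ga : (g^-1)%VF w = a by rewrite -gw (isometryK bP gP).
apply: (spread_orbit_fun gK l0) => //.
apply: (Mop_neq0 psi_char psi_cond HC gK iAB (subgroup0 gA)) => //.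
  rewrite /Mop_term (form0l bP) mulr0 (psi0 psi_cond) mul1r add0r ga.
  exact: orbit_fun_0A.
move=> b Ab nb; have : orbit_fun false 0 ((g^-1)%VF (b + w)) <> 0.
  by move=> h; apply: nb; rewrite /Mop_term h mulr0.
rewrite linearD /= ga => h; have {h} h : A ((g^-1)%VF b + a).
  by case: (orbit_fun_supp h); rewrite ?subr0 ?addr0.
apply: (Mop_term_invariant psi_char psi_cond HC gK) => //; first exact: subgroup0.
by rewrite subr0; rewrite -[_ b](addrK a); exact: (subgroupB gA).
Qed.

Lemma orbit_fun_transitive k s w w' : layer k w -> layer k w' ->
  (s -> ~ A w) -> (s -> ~ A w') -> E (orbit_fun s w) -> E (orbit_fun s w').
Proof.
move=> lw lw' sw sw' Ew.
have qw := orbit_fun_quasi_periodic psi_char psi_cond HC s w.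
case: k lw lw' => [|k] lw lw'.
  (* In [Bs] a general mover could lead to cancellation. Odd functions use a mover preserving [A],
     so that no average remains; even ones pass through the orbit of 0. *)
  move: (lw) (lw'); rewrite /layer filt0 => Bsw Bsw'; case: s sw sw' Ew qw => sw sw' Ew qw.
    have [g gK [gAA gw]] := transitive_A HC Bsw (sw isT) Bsw' (sw' isT).
    have gP : isometry_group beta g by case: gK.
    apply: (spread_orbit_fun gK lw) => //.
    rewrite (Mop_preserving psi_char psi_cond HC gK) // -gw (isometryK bP gP).
    by rewrite (orbit_fun_id psi_cond HC); exact/eqP/oner_neq0.
  apply: orbit_fun_even_from0 => //; exact: orbit_fun_even_to0 Ew.
have [g gK gw] := transitive_layer HC lw lw'.
have gP : isometry_group beta g by case: gK.
have gw' : (g^-1)%VF w' = w by rewrite -gw (isometryK bP gP).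
apply: (spread_orbit_fun gK lw) => //.
apply: (Mop_neq0 psi_char psi_cond HC gK iAB (subgroup0 gA)) => //.
  rewrite /Mop_term (form0l bP) mulr0 (psi0 psi_cond) mul1r add0r gw'.
  by rewrite (orbit_fun_id psi_cond HC); exact/eqP/oner_neq0.
move=> b Ab nb; have : orbit_fun s w ((g^-1)%VF (b + w')) <> 0.
  by move=> h; apply: nb; rewrite /Mop_term h mulr0.
rewrite linearD /= gw' => /orbit_fun_supp[h|h].
  rewrite addrK in h.
  apply: (Mop_term_invariant psi_char psi_cond HC gK) => //; first exact: subgroup0.
  by rewrite subr0.
(* A nonzero term coming from [-w + A] would put [w + w], hence [w], in [Bs]. *)
case: (layer_notin HC lw).
have mBs := dual_omodule HC B; have gBs := omodule_subgroup mBs.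
have Bsb : Bs ((g^-1)%VF b) by apply/(stabilizerV_Bs HC gK); exact: (chain_AB HC).
have : Bs (w + w).
  by apply: (subgroupDr gBs Bsb); rewrite addrA; exact: (chain_AB HC).
rewrite -mulr2n -scaler_nat => /(omoduleZ mBs (powideal2V (chain_char HC))).
by rewrite scalerA mulVf // scale1r.
Qed.

End Stable.

End StableSubspaces.

(** * Dimensions *)

Section Dimensions.
Variables (R : realType) (K : localField) (psi : K -> R[i]) (lam : int).
Variables (W : vectType K) (beta : W -> W -> K) (B A : set W).
Hypotheses (psi_char : unitary_character psi) (psi_cond : conductor psi lam).
Hypothesis HC : lattice_chain lam beta B A.
Local Notation Bs := (dual_lattice lam beta B).
Local Notation qper := (quasi_periodic psi beta A).
Local Notation layer := (layer lam beta B).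
Local Notation orbit_fun := (orbit_fun psi beta A).
Implicit Types (u v w a : W) (k n : nat) (s : bool) (f h : W -> R[i]).

Let gA := subgroupA HC.

Definition layer_space k s : set (W -> R[i]) :=
  parity_part s (supported_in psi beta A (layer k)).

Lemma EsubE n : Esub psi beta A lam B n = supported_in psi beta A (layer n.*2).
Proof.
case: n => [|n]; first by rewrite /layer filt0.
congr supported_in; rewrite /layer doubleS /filt /= odd_double /= uphalf_double doubleK.
have u0 : (unif : K) ^- n.+1 != 0 by rewrite invr_eq0 expf_neq0 ?unif_neq0.
have e L w := dilationE L w u0.
apply/seteqP; split=> w; first by move=> /e[h1 h2]; split; [exact/e|move=> /e].
by case=> /e h1 h2; apply/e; split=> // h; apply: h2; apply/e.
Qed.

Lemma Esub1E n : Esub1 psi beta A lam B n = supported_in psi beta A (layer n.*2.+1).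
Proof.
by rewrite /Esub1 /layer /filt /= odd_double /= uphalf_double doubleK.
Qed.

Lemma layer_space_elim k s f : layer_space k s f ->
  [/\ qper f, has_parity s f & forall w, f w <> 0 -> layer k w].
Proof. by case=> -[[qf _] supp] pf; split=> // w /supp. Qed.

Lemma layer_space_intro k s f n : has_index (layer k) A n ->
  qper f -> has_parity s f -> (forall w, f w <> 0 -> layer k w) ->
  layer_space k s f.
Proof.
by move=> nP qf pf supp; do 2!split=> //; split=> //; exact: (hnorm2_finite HC nP supp).
Qed.

Definition parity_layer k s : set W := if s then layer k `\` A else layer k.

Lemma parity_layer_supp k s f w :
  layer_space k s f -> f w <> 0 -> parity_layer k s w.
Proof.
move=> /layer_space_elim[qf pf supp] fw; have lw := supp _ fw.
case: s pf => // pf; split=> // Aw; apply: fw; exact: (odd_vanishes qf pf Aw).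
Qed.

Lemma parity_layerP k s w : parity_layer k s w -> layer k w /\ (s -> ~ A w).
Proof. by case: s => // -[]. Qed.

(** In layer 0 the coset [A] is its own opposite: it counts as a whole orbit for even functions and
    is discarded for odd ones. The two boolean summands record this without subtraction. *)
Lemma parity_layer_orbits k s n : has_index (layer k) A n ->
  exists (J : finType) (t : J -> W), half_transversal (parity_layer k s) A t /\
    (#|J| * 2 + ((k == 0%N) && s) = n + ((k == 0%N) && ~~ s))%N.
Proof.
move=> nP; have sA : A `<=` Bs := chain_AB HC.
have layerA (j : nat) : layer j.+1 `\` A = layer j.+1.
  apply/seteqP; split=> w; first by case.
  by move=> lw; split=> // /sA; exact: (layer_notin HC lw).
have half j m : has_index (layer j `\` A) A m -> exists (J : finType) (t : J -> W),
    half_transversal (layer j `\` A) A t /\ (#|J| * 2)%N = m.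
  move=> mP; apply: (half_transversal_exists gA) => //.
  - exact: (double_A HC).
  - move=> u [lu nAu]; split; first exact: (layerN HC).
    by move=> /(subgroupN gA); rewrite opprK.
  - by move=> u [].
case: k nP => [|k] nP /=; last first.
  have [|J [t [tP cJ]]] := half k.+1 n; first by rewrite layerA.
  exists J, t; split; last by rewrite cJ.
  by rewrite /parity_layer; rewrite layerA in tP *; rewrite if_same.
have A1 : has_index A A 1.
  exists unit, (fun=> 0); split; last exact: card_unit.
  split=> [_|[] []//|w Aw]; first exact: subgroup0.
  by exists tt; rewrite subr0.
have sAl : A `<=` layer 0 by rewrite /layer filt0.
have satA u v : A (u - v) -> A v -> A u.
  by move=> uv Av; rewrite -[u](subrK v); exact: (subgroupD gA).
have [n1 nP'] := has_index_sub gA sAl satA nP A1.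
have [J [t [tP cJ]]] := half 0 _ nP'; case: s => /=.
  by exists J, t; split=> //; rewrite cJ addn0 subnK.
case: tP => Dt injt surjt.
(* [None] stands for the orbit [A], represented by 0. *)
exists (option J), (fun o => if o is Some j then t j else 0); split; last first.
  by rewrite card_option mulSn cJ /=; lia.
split=> [[j|]|[j|] [j'|] //|w lw].
- by case: (Dt j).
- by apply: sAl; exact: subgroup0.
- by move=> /injt ->.
- by rewrite subr0 addr0 => -[] Aj; case: (Dt j).
- rewrite sub0r add0r => -[] Aj; case: (Dt j') => _ []//.
  by rewrite -[t j']opprK; exact: (subgroupN gA).
- have [Aw|nAw] := pselect (A w); first by exists None; left; rewrite subr0.
  by have [j jP] := surjt w (conj lw nAw); exists (Some j).
Qed.

Lemma layer_has_dim k s n : has_index (layer k) A n ->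
  exists2 d : nat, has_dim (layer_space k s) d%:R &
    (d * 2 + ((k == 0%N) && s) = n + ((k == 0%N) && ~~ s))%N.
Proof.
move=> nP; have [J [t [tP cJ]]] := parity_layer_orbits s nP.
exists #|J| => //; exists #|J|; split=> //.
have [Dt injt _] := tP.
exists (fun i => orbit_fun s (t (enum_val i))); split=> [i|f Ef].
  have [lt nAt] := parity_layerP (Dt (enum_val i)).
  apply: layer_space_intro nP _ _ _.
  - exact: (orbit_fun_quasi_periodic psi_char psi_cond HC).
  - exact: (orbit_fun_parity psi_cond HC).
  - by move=> w; exact: (orbit_fun_layer HC).
have [qf pf supp] := layer_space_elim Ef.
exists (\row_i f (t (enum_val i))); split.
  rewrite {1}(orbit_expansion HC tP qf pf) => [|w]; last exact: parity_layer_supp.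
  apply/funext => w; rewrite (reindex (fun i : 'I_#|J| => enum_val i)) /=; last first.
    exact: onW_bij (enum_val_bij J).
  by apply: eq_bigr => i _; rewrite mxE.
move=> c cE; apply/rowP => i; rewrite mxE cE (bigD1 i) //=.
rewrite (orbit_fun_id psi_cond HC) mulr1 big1 ?addr0 // => j ji.
rewrite orbit_fun_eq0 ?mulr0 // => h; case/eqP: ji; apply: enum_val_inj.
by apply/esym/injt.
Qed.

Lemma has_dim_nonzero (E : set (W -> R[i])) (x : rat) :
  has_dim E x -> nonzero_space E <-> x != 0.
Proof.
move=> [d [-> [b [Eb bP]]]]; rewrite pnatr_eq0; case: d b Eb bP => [|d] b Eb bP.
  split=> // -[f /bP[c [fE _]] f0]; case: f0; rewrite fE.
  by apply/funext => w; rewrite big_ord0.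
split=> // _; exists (b ord0) => // b0.
have [c [_ cu]] := bP _ (Eb ord0).
(* If the first basis function were zero, it would have two coordinate rows, the first unit row and
   the zero row. *)
have /rowP/(_ ord0) : delta_mx 0 ord0 = 0 :> 'rV[R[i]]_d.+1.
  transitivity c; [apply/esym|]; apply: cu; apply/funext => w.
    rewrite (bigD1 ord0) //= mxE !eqxx mul1r big1 ?addr0 // => i i0.
    by rewrite mxE (negbTE i0) andbF mul0r.
  by rewrite b0 big1 // => i _; rewrite mxE mul0r.
by rewrite !mxE !eqxx => /eqP; rewrite oner_eq0.
Qed.

Lemma layer_index_exists (lA : is_lattice A) (r l : nat)
    (dimW : \dim {:W} = (2 * r)%N)
    (iBA : has_index Bs A (#|residue K| ^ l)) (iAB : has_index A B (#|residue K| ^ l)) k :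
  exists n, has_index (layer k) A n.
Proof.
have filt_index j : exists n, has_index (filt lam beta B j) A n.
  rewrite -(odd_double_half j); case: (odd j) => /=.
    by have [x xP _] := index_filt_odd HC lA dimW iBA iAB j./2; exists x.
  by have := index_filt_even HC lA dimW iBA j./2; eexists; eassumption.
case: k => [|k]; first exact: filt_index.
have [m mP] := filt_index k; have [n nP] := filt_index k.+1.
have [_] := has_index_sub gA (filt_succ HC (k := k))
  (fun u v => @filt_translate _ _ _ _ _ _ HC k u v) nP mP.
by exists (n - m)%N.
Qed.

End Dimensions.

(** * Orthogonal decomposition of the lattice model *)

Section HilbertSum.
Variables (R : realType) (K : localField) (psi : K -> R[i]) (lam : int).
Variables (W : vectType K) (beta : W -> W -> K) (B A : set W).
Hypotheses (psi_char : unitary_character psi) (psi_cond : conductor psi lam).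
Hypothesis HC : lattice_chain lam beta B A.
Hypothesis layer_index : forall k, exists n, has_index (layer lam beta B k) A n.
Local Notation qper := (quasi_periodic psi beta A).
Local Notation layer := (layer lam beta B).
Local Notation layer_space := (layer_space psi lam beta B A).
Local Notation hilbert_space := (hilbert_space psi beta A).
Implicit Types (u v w a : W) (k n : nat) (s : bool) (f h : W -> R[i]).

Let bP := chain_form HC.
Let gA := subgroupA HC.

Definition modulus (z : R[i]) : R := complex.Re `|z|.

Lemma modulusE z : (modulus z)%:C%C = `|z|.
Proof. by rewrite /modulus RRe_real // normr_real. Qed.

Lemma modulus_ge0 z : 0 <= modulus z.
Proof. by rewrite -lecR modulusE; exact: normr_ge0. Qed.

Lemma modulus_eq0 z : modulus z = 0 -> z = 0.
Proof. by move=> z0; apply/eqP; rewrite -normr_eq0 -modulusE z0. Qed.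

Lemma modulusD z z' : modulus (z + z') <= modulus z + modulus z'.
Proof. by rewrite -lecR rmorphD /= !modulusE; exact: ler_normD. Qed.

Lemma modulus_sign s z : modulus ((-1) ^+ s * z) = modulus z.
Proof. by rewrite /modulus normrM normrX normrN1 expr1n mul1r. Qed.

Lemma quasi_periodic_modulus f v w : qper f -> A (v - w) -> modulus (f v) = modulus (f w).
Proof.
move=> qf vw; rewrite (quasi_periodic_val qf vw) /modulus normrM.
by case: psi_char => _ -> _; rewrite mul1r.
Qed.

(** The modulus is constant on cosets of [A], so it is one of the terms of the norm. Norm limits are
    therefore pointwise limits, and pointwise conditions define closed subspaces. *)
Lemma modulus_le_hnorm2 f w : qper f -> ((modulus (f w) ^+ 2)%:E <= hnorm2 A f)%E.
Proof.
move=> qf; have Aw := coset_repP w gA; rewrite -(quasi_periodic_modulus qf Aw).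
apply: esum_ge; exists [set coset_rep A w]; last by rewrite fsbig_set1.
by split; [exact: finite_set1|move=> _ ->; exists w].
Qed.

Lemma hnorm2_modulus f h w (d : R) : qper f -> qper h -> 0 < d ->
  (hnorm2 A (fun w => (f w - h w)%R) < (d ^+ 2)%:E)%E -> modulus (f w - h w) < d.
Proof.
move=> qf qh d0 lt_d; have qfh : qper (fun w => f w - h w).
  have -> : (fun w => f w - h w) = (fun w => -1 * h w + f w).
    by apply/funext => v; rewrite mulN1r addrC.
  exact: quasi_periodicD.
have := le_lt_trans (modulus_le_hnorm2 w qfh) lt_d; rewrite lte_fin.
by rewrite ltr_pXn2r // nnegrE ?modulus_ge0 // ltW.
Qed.

Lemma small_eq0 (z : R[i]) : (forall d : R, 0 < d -> modulus z < d) -> z = 0.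
Proof.
move=> z0; apply: modulus_eq0; apply/eqP; rewrite eq_le modulus_ge0 andbT leNgt.
by apply/negP => /z0; rewrite ltxx.
Qed.

Lemma hclosed_approx (E : set (W -> R[i])) f (d : R) : E `<=` hilbert_space ->
  hilbert_space f -> 0 < d ->
  (forall e : R, 0 < e ->
     exists2 h, E h & (hnorm2 A (fun w => (f w - h w)%R) < e%:E)%E) ->
  exists2 h, E h & forall w, modulus (f w - h w) < d.
Proof.
move=> sE [qf _] d0 /(_ (d ^+ 2)) []; first exact: exprn_gt0.
move=> h Eh lt_d; exists h => // v; apply: hnorm2_modulus => //.
by case: (sE _ Eh).
Qed.

Lemma layer_space_linear k s : linear_subspace (layer_space k s).
Proof.
have [n nP] := layer_index k; split.
  apply: (layer_space_intro HC nP) => // [a w _|w]; by rewrite mulr0.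
move=> z f h /layer_space_elim[qf pf suppf] /layer_space_elim[qh ph supph].
apply: (layer_space_intro HC nP).
- exact: quasi_periodicD.
- exact: has_parityD.
- move=> w; have [fw|fw] := pselect (f w = 0); last by move=> _; exact: suppf.
  by rewrite fw mulr0 add0r; exact: supph.
Qed.

Lemma layer_space_sub k s : layer_space k s `<=` hilbert_space.
Proof. by move=> f [[]]. Qed.

Lemma layer_space_closed k s : closed_subspace psi beta A (layer_space k s).
Proof.
split; [exact: layer_space_linear|exact: layer_space_sub|].
move=> f Hf approx; have [n nP] := layer_index k; have [qf _] := Hf.
apply: (layer_space_intro HC nP) => // w.
  apply/eqP; rewrite -subr_eq0; apply/eqP; apply: small_eq0 => d d0.
  have d2 : 0 < d / 2 by rewrite divr_gt0.
  have [h Eh hP] := hclosed_approx (@layer_space_sub k s) Hf d2 approx.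
  have [_ ph _] := layer_space_elim Eh.
  have -> : f (- w) - (-1) ^+ s * f w =
      (f (- w) - h (- w)) + (-1) ^+ s * (- 1 * (f w - h w)).
    by rewrite ph; ring.
  apply: (le_lt_trans (modulusD _ _)); rewrite modulus_sign -[- 1]expr1.
  by rewrite (modulus_sign true) [d](splitr d); apply: ltrD.
move=> fw; apply: contrapT => nlw; apply: fw; apply: small_eq0 => d d0.
have [h Eh hP] := hclosed_approx (@layer_space_sub k s) Hf d0 approx.
have [_ _ supp] := layer_space_elim Eh.
have := hP w; have -> : h w = 0 by apply: contrapT => /supp.
by rewrite subr0.
Qed.

Lemma hdot_eq0 f h : (forall w, f w * (h w)^*%C = 0) -> hdot A f h = 0.
Proof.
move=> fh0; have r0 (D : set W) (G : W -> R) : (forall w, G w = 0) -> rsum D G = 0.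
  move=> G0; rewrite /rsum !esum1 ?subrr // => w _; rewrite G0 ?oppr0 maxxx //.
by rewrite /hdot !r0 // => w; rewrite fh0.
Qed.

(** Negation of cosets exchanges the sums of the positive and negative parts. They are equal as
    extended reals, so no summability is required. *)
Lemma rsum_odd (G : W -> R) : (forall w, G (- w) = - G w) ->
  (forall v w, A (v - w) -> G v = G w) -> rsum (coset_reps setT A) G = 0.
Proof.
move=> GN GA; rewrite /rsum.
rewrite (@reindex_esum _ _ _ (coset_reps setT A) (coset_reps setT A)
  (fun w => coset_rep A (- w)) (fun w => (Num.max (G w) 0)%:E)); last first.
  split=> [_ [w _ <-]|v w|w rw]; first by exists (- coset_rep A w).
    rewrite !inE => rv rw vw.
    rewrite -(coset_reps_id gA rv) -(coset_reps_id gA rw); apply: coset_rep_eq => //.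
    have := subgroup_trans gA (subgroupBC gA (coset_repP (- v) gA)).
    move=> /(_ (- w)); rewrite vw => /(_ (coset_repP _ gA)).
    by rewrite -opprD => /(subgroupN gA); rewrite opprK.
  exists (coset_rep A (- w)); first by exists (- w).
  rewrite -[RHS](coset_reps_id gA rw); apply: coset_rep_eq => //.
  rewrite -opprD; apply: (subgroupN gA).
  by have := coset_repP (- w) gA; rewrite opprK.
rewrite (eq_esum (b := fun w => (Num.max (- G w) 0)%:E)) ?subrr // => w _.
by rewrite (GA _ (- w)) ?GN //; exact: coset_repP.
Qed.

(** Different layers give disjoint supports. In one layer, the product of [f] and the conjugate of
    [h] is [A]-periodic, the unitary factors cancelling, and odd when the parities differ. *)
Lemma layer_space_orthogonal j k s s' f h : (j, s) <> (k, s') ->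
  layer_space j s f -> layer_space k s' h -> hdot A f h = 0.
Proof.
move=> ne /layer_space_elim[qf pf suppf] /layer_space_elim[qh ph supph].
have [jk|jk] := eqVneq j k; last first.
  apply: hdot_eq0 => w; have [->|fw] := pselect (f w = 0); first by rewrite mul0r.
  have [->|hw] := pselect (h w = 0); first by rewrite conjc0 mulr0.
  by case/eqP: jk; exact: (layer_uniq HC (suppf _ fw) (supph _ hw)).
have ss : s (+) s' by rewrite jk in ne; case: s s' ne {pf ph} => [] [] ne //; case: ne.
pose F w := f w * (h w)^*%C.
have FN w : F (- w) = - F w.
  rewrite /F pf ph rmorphM rmorphXn rmorphN rmorph1 mulrACA -exprD.
  by rewrite -signr_odd oddD !oddb ss mulN1r.
have FA v w : A (v - w) -> F v = F w.
  move=> vw; rewrite /F (quasi_periodic_val qf vw) (quasi_periodic_val qh vw).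
  rewrite rmorphM mulrACA -sqr_normc; case: psi_char => _ -> _.
  by rewrite expr1n mul1r.
have -> : hdot A f h = Complex (rsum (coset_reps setT A) (fun w => complex.Re (F w)))
    (rsum (coset_reps setT A) (fun w => complex.Im (F w))) by [].
rewrite !rsum_odd // => [w|v w /FA ->//|w|v w /FA ->//]; rewrite FN; by case: (F w).
Qed.

Definition parity_proj s f : W -> R[i] := fun w => 2^-1 * (f w + (-1) ^+ s * f (- w)).

Lemma parity_proj_parity s f : has_parity s (parity_proj s f).
Proof.
by move=> w; rewrite /parity_proj opprK; case: s; rewrite ?expr0 ?expr1; ring.
Qed.

Lemma parity_proj_quasi_periodic s f : qper f -> qper (parity_proj s f).
Proof.
move=> qf a w Aa; rewrite /parity_proj opprD qf // qf; last exact: (subgroupN gA).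
by rewrite (formNl bP) (formNr bP) opprK; ring.
Qed.

Lemma parity_projD f w : parity_proj false f w + parity_proj true f w = f w.
Proof. by rewrite /parity_proj expr0 expr1; field. Qed.

Lemma restrict_layer_space k s f : qper f ->
  layer_space k s (restrict (layer k) (parity_proj s f)).
Proof.
move=> qf; have [n nP] := layer_index k; apply: (layer_space_intro HC nP).
- move=> a w Aa; rewrite /restrict.
  have -> : `[< layer k (a + w) >] = `[< layer k w >].
    apply/asboolP/asboolP; apply: (layer_translate HC).
      by rewrite opprD addrCA subrr addr0; exact: (subgroupN gA).
    by rewrite addrK.
  case: asboolP => _; last by rewrite mulr0.
  exact: parity_proj_quasi_periodic.
- move=> w; rewrite /restrict.
  have -> : `[< layer k (- w) >] = `[< layer k w >].
    by apply/asboolP/asboolP => /(layerN HC); rewrite ?opprK.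
  case: asboolP => _; last by rewrite mulr0.
  exact: parity_proj_parity.
- by move=> w; rewrite /restrict; case: asboolP.
Qed.

Definition piece_of k s : piece := if odd k then Piece1 k./2 s else Piece k./2 s.

Definition piece_layer (i : piece) : nat :=
  match i with Piece n _ => n.*2 | Piece1 n _ => n.*2.+1 end.

Definition piece_sign (i : piece) : bool :=
  match i with Piece _ s => s | Piece1 _ s => s end.

Lemma piece_ofK k s : piece_layer (piece_of k s) = k /\ piece_sign (piece_of k s) = s.
Proof.
by have := odd_double_half k; rewrite /piece_of; case: (odd k).
Qed.

Lemma piece_eq i j : piece_layer i = piece_layer j -> piece_sign i = piece_sign j -> i = j.
Proof.
case: i j => [n s|n s] [m t|m t] /= e ->.
- by rewrite -(doubleK n) e doubleK.
- by have := congr1 odd e; rewrite /= !odd_double.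
- by have := congr1 odd e; rewrite /= !odd_double.
- by case: e => e; rewrite -(doubleK n) e doubleK.
Qed.

Lemma EpieceE i :
  Epiece psi beta A lam B i = layer_space (piece_layer i) (piece_sign i).
Proof. by case: i => n s; rewrite /= ?EsubE ?Esub1E. Qed.

Lemma sum_pieces f w M :
  \sum_(i <- [seq piece_of k false | k <- iota 0 M] ++
            [seq piece_of k true | k <- iota 0 M])
     restrict (layer (piece_layer i)) (parity_proj (piece_sign i) f) w =
  if `[< exists2 k, (k < M)%N & layer k w >] then f w else 0.
Proof.
rewrite big_cat /= !big_map -big_split /=.
have E k : restrict (layer (piece_layer (piece_of k false)))
    (parity_proj (piece_sign (piece_of k false)) f) w +
  restrict (layer (piece_layer (piece_of k true)))
    (parity_proj (piece_sign (piece_of k true)) f) w =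
  if `[< layer k w >] then f w else 0.
  have [-> ->] := piece_ofK k false; have [-> ->] := piece_ofK k true.
  by rewrite /restrict; case: asboolP => _; rewrite ?addr0 ?parity_projD.
rewrite (eq_bigr _ (fun k _ => E k)).
case: asboolP => [[k kM lk]|nex].
  rewrite (bigD1_seq k) ?iota_uniq ?mem_iota //= asboolT // big1 ?addr0 // => j jk.
  by rewrite asboolF // => lj; case/eqP: jk; exact: (layer_uniq HC lj lk).
rewrite big1_seq // => k /andP[_]; rewrite mem_iota add0n => kM.
by rewrite asboolF // => lk; apply: nex; exists k.
Qed.

Lemma hilbert_sum_pieces : hilbert_sum psi beta A (Epiece psi beta A lam B).
Proof.
split=> [i|i j ij f h|f Hf e e0].
- by rewrite EpieceE; exact: layer_space_closed.
- rewrite !EpieceE; apply: layer_space_orthogonal => -[e1 e2].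
  by apply: ij; exact: piece_eq.
have [qf fin] := Hf.
have finn : hnorm2 A f \is a fin_num.
  by rewrite ge0_fin_numE // esum_ge0 // => w _; rewrite lee_fin sqr_ge0.
(* Finitely many cosets [X] carry the norm up to [e]. They lie in some [filt M], so the part of [f]
   outside [filt M] has norm below [e], and the part inside is a finite sum over the pieces. *)
have [_ [X [finX sX] <-] ltX] := ub_ereal_sup_adherent e0 finn.
have [M MP] : exists M, forall w, X w -> filt lam beta B M w.
  have /finite_seqP[F ->] := finX; elim: F => [|w F [M MP]]; first by exists 0%N.
  have [j jP] := filt_exists HC w; exists (maxn j M) => v /=.
  rewrite inE => /orP[/eqP->|vF]; first by apply: (filt_leq HC _ jP); rewrite leq_maxl.
  by apply: (filt_leq HC _ (MP v vF)); rewrite leq_maxr.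
exists ([seq piece_of k false | k <- iota 0 M.+1] ++
        [seq piece_of k true | k <- iota 0 M.+1]).
exists (fun i => restrict (layer (piece_layer i)) (parity_proj (piece_sign i) f)).
split=> [i|]; first by rewrite EpieceE; exact: restrict_layer_space.
under eq_fun do rewrite sum_pieces.
pose a w : \bar R := ((modulus (f w)) ^+ 2)%:E.
have a0 w : (0 <= a w)%E by rewrite lee_fin sqr_ge0.
set D := filt lam beta B M.
have filtP w : `[< exists2 k, (k < M.+1)%N & layer k w >] = `[< D w >].
  apply/asboolP/asboolP => [[k kM lk]|Dw].
    by apply: (filt_leq HC _ (layer_filt lk)); rewrite -ltnS.
  by have [k lk] := layer_exists HC w; exists k => //; exact: (layer_leq HC lk Dw).
have normE : hnorm2 A f =
    (\esum_(w in coset_reps setT A `&` D) a w +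
     \esum_(w in coset_reps setT A `&` ~` D) a w)%E.
  by rewrite /hnorm2 [LHS](esumID D) // => w _; exact: a0.
rewrite /hnorm2 (esumID D); last by move=> w _; rewrite lee_fin sqr_ge0.
rewrite esum1 ?add0e => [|w [_ Dw]]; last first.
  by rewrite filtP asboolT // subrr normr0 expr0n.
rewrite (eq_esum (b := a)) => [|w [_ nDw]]; last by rewrite filtP asboolF // subr0.
set Y := (\esum_(w in _ `&` ~` D) a w)%E.
set Z := (\sum_(w \in X) _)%E in ltX.
have ZY : (Z + Y <= hnorm2 A f)%E.
  rewrite normE leeD2r //; apply: esum_ge; exists X => //; split=> // w Xw.
  by split; [exact: sX|exact: MP].
have Z0 : (0 <= Z)%E by apply: fsume_ge0 => w _; exact: a0.
have Y0 : (0 <= Y)%E by apply: esum_ge0 => w _; exact: a0.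
have Zfin : Z \is a fin_num.
  by rewrite ge0_fin_numE //; apply: le_lt_trans fin; apply: le_trans ZY; exact: leeDl.
have Yfin : Y \is a fin_num.
  by rewrite ge0_fin_numE //; apply: le_lt_trans fin; apply: le_trans ZY; exact: leeDr.
move: ltX; rewrite -/(hnorm2 A f) lteBlDr // => ltX.
by have := le_lt_trans ZY ltX; rewrite lteD2lE.
Qed.

End HilbertSum.

(** * Irreducibility and multiplicity one *)

Section Representation.
Variables (R : realType) (K : localField) (psi : K -> R[i]) (lam : int).
Variables (W : vectType K) (beta : W -> W -> K) (B A : set W).
Hypotheses (psi_char : unitary_character psi) (psi_cond : conductor psi lam).
Hypothesis HC : lattice_chain lam beta B A.
Hypothesis lA : is_lattice A.
Hypothesis iAB : exists n, has_index A B n.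
Hypothesis layer_index : forall k, exists n, has_index (layer lam beta B k) A n.
Local Notation KB := (stabilizer beta B).
Local Notation Mop := (Mop psi beta A).
Local Notation qper := (quasi_periodic psi beta A).
Local Notation layer := (layer lam beta B).
Local Notation orbit_fun := (orbit_fun psi beta A).
Local Notation layer_space := (layer_space psi lam beta B A).
Local Notation hilbert_space := (hilbert_space psi beta A).
Local Notation closed_subspace := (closed_subspace psi beta A).
Local Notation transv_char := (transvection_char psi beta).
Implicit Types (u v w a : W) (g : 'End(W)) (c : K) (k n : nat) (s : bool).
Implicit Types (f h : W -> R[i]) (E F : set (W -> R[i])).

Variables (S : 'End(W) -> (W -> R[i]) -> (W -> R[i])) (mS : 'End(W) -> R[i]).
Hypothesis SE : forall g f, KB g -> S g f = (fun w => mS g * Mop g f w).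
Hypothesis mS_neq0 : forall g, KB g -> mS g != 0.

Let gA := subgroupA HC.
Let mA := chain_omodA HC.

(** The scalar [mS g] is invertible, so invariance under [S] can be tested on the operators
    [Mop]. *)
Lemma invariant_Mop E g f : linear_subspace E -> invariant_under KB S E ->
  KB g -> E f -> E (Mop g f).
Proof.
move=> linE invE gK Ef; have := subspaceZ linE (mS g)^-1 (invE g f gK Ef).
by congr E; apply/funext => w; rewrite SE // mulKf ?mS_neq0.
Qed.

Lemma layer_space_invariant k s : invariant_under KB S (layer_space k s).
Proof.
move=> g f gK Ef; have [n nP] := layer_index k.
have [qf pf supp] := layer_space_elim Ef.
rewrite SE //; apply: (subspaceZ (layer_space_linear psi HC layer_index k s) (mS g)).
apply: (layer_space_intro HC nP).
- exact: (Mop_quasi_periodic psi_char psi_cond HC gK).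
- exact: (Mop_parity psi_char psi_cond HC gK).
- exact: (Mop_layer HC iAB gK).
Qed.

Lemma orbit_fun_in k s w : layer k w -> (s -> ~ A w) -> layer_space k s (orbit_fun s w).
Proof.
move=> lw sw; have [n nP] := layer_index k; apply: (layer_space_intro HC nP).
- exact: (orbit_fun_quasi_periodic psi_char psi_cond HC).
- exact: (orbit_fun_parity psi_cond HC).
- by move=> x; exact: (orbit_fun_layer HC).
Qed.

Lemma nonzero_point f : f <> (fun=> 0) -> exists w, f w <> 0.
Proof.
move=> f0; apply: contrapT => nex; apply: f0; apply/funext => w.
by apply: contrapT => fw; apply: nex; exists w.
Qed.

Lemma generated_by_orbit_fun E k s w : linear_subspace E ->
  (forall g f, KB g -> E f -> E (Mop g f)) ->
  layer k w -> (s -> ~ A w) -> E (orbit_fun s w) -> layer_space k s `<=` E.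
Proof.
move=> linE stabE lw sw Ew h Eh; have [n nP] := layer_index k.
have [J [t [tP _]]] := parity_layer_orbits HC s nP.
have [qh ph _] := layer_space_elim Eh.
rewrite (orbit_expansion HC tP qh ph) => [|v]; last exact: (parity_layer_supp Eh).
apply: (subspace_sum linE) => j; have [Dt _ _] := tP.
have [lt st] := parity_layerP (Dt j).
exact: (orbit_fun_transitive psi_char psi_cond HC lA iAB linE stabE lw lt sw st Ew).
Qed.

Lemma layer_space_irreducible k s : nonzero_space (layer_space k s) ->
  irreducible_rep psi beta A KB S (layer_space k s).
Proof.
move=> nz; split=> // F [linF sF clF] sFE invF.
have [[f Ff /nonzero_point[w fw]]|] := pselect (nonzero_space F); last by left.
right; apply/seteqP; split=> //.
have Ef := sFE _ Ff; have [qf pf supp] := layer_space_elim Ef.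
have [lw sw] := parity_layerP (parity_layer_supp Ef fw).
have stabF g h : KB g -> F h -> F (Mop g h) by exact: invariant_Mop.
apply: (generated_by_orbit_fun linF stabF lw sw).
exact: (isolate_layer psi_char psi_cond HC lA iAB linF stabF Ff qf pf supp fw).
Qed.

(** The character takes the same value on the whole orbit, being even in [w]; the image thus stays
    on one orbit and is determined by its value at [w]. *)
Lemma Mop_orbit_fun k c u s w : A u -> powideal (k.+1%:Z - lam) c ->
  A (unif ^+ k.+1 *: w) -> (s -> ~ A w) ->
  Mop (transvection beta c u) (orbit_fun s w) =
  (fun x => transv_char c u w * orbit_fun s w x).
Proof.
move=> Au cP Aw sw; have tK := transvection_stabilizer HC Au cP.
have qw := orbit_fun_quasi_periodic psi_char psi_cond HC s w.
have pw := orbit_fun_parity psi_cond HC sw.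
have lev x : orbit_fun s w x <> 0 -> A (unif ^+ k.+1 *: x).
  have un y : A y -> A (unif ^+ k.+1 *: y).
    by apply: (omoduleZ mA); exact: powideal_unifn.
  move=> /orbit_fun_supp[] /un; rewrite ?scalerBr ?scalerDr => h.
    by have := subgroupD gA h Aw; rewrite subrK.
  by have := subgroupB gA h Aw; rewrite addrK.
have qM := Mop_quasi_periodic psi_char psi_cond HC tK iAB qw.
have pM := Mop_parity psi_char psi_cond HC tK iAB qw pw.
rewrite [LHS](orbit_fun_unique HC (w := w) qM pM) => [|x Mx].
  by rewrite (Mop_transvection psi_char psi_cond HC iAB Au cP qw Aw)
    (orbit_fun_id psi_cond HC) mulr1.
apply: (orbit_fun_supp (psi := psi) (beta := beta) (s := s)); move: Mx; have [Ax|nAx] := pselect (A (unif ^+ k.+1 *: x)).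
  rewrite (Mop_transvection psi_char psi_cond HC iAB Au cP qw Ax) => h e.
  by apply: h; rewrite e mulr0.
by rewrite (Mop_transvection0 psi_char psi_cond HC iAB Au cP qw lev nAx).
Qed.

Lemma eigenvector_supp h w : qper h ->
  (forall k c u, A u -> powideal (k.+1%:Z - lam) c -> A (unif ^+ k.+1 *: w) ->
     Mop (transvection beta c u) h = (fun x => transv_char c u w * h x)) ->
  forall v, h v <> 0 -> A (v - w) \/ A (v + w).
Proof.
move=> qh eig v hv; apply: contrapT => nvw.
have [|vw|k [c [u [Au cP Av Aw ne]]]] := separating_char psi_char psi_cond HC (v := v) (w := w).
- by move=> vw; apply: nvw; left.
- by apply: nvw; right.
have := congr1 (fun f => f v) (eig k c u Au cP Aw).
rewrite (Mop_transvection psi_char psi_cond HC iAB Au cP qh Av) => /(mulIf (introN eqP hv)).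
by move/eqP; rewrite (negbTE ne).
Qed.

(** An intertwiner sends [orbit_fun s w] to an eigenvector with the same characters, hence supported
    on the same orbit. The supports identify the layers, and the action of [-1] identifies the
    parities. *)
Lemma layer_space_inequivalent k k' s s' : nonzero_space (layer_space k s) ->
  equivalent_reps KB S (layer_space k s) (layer_space k' s') -> (k, s) = (k', s').
Proof.
move=> [f Ef /nonzero_point[w fw]] [T [[Tfun Tinj _] Tlin Teq]].
have [qf pf supp] := layer_space_elim Ef.
have [lw sw] := parity_layerP (parity_layer_supp Ef fw).
have Ee := orbit_fun_in lw sw; set e := orbit_fun s w in Ee.
have pe : has_parity s e by exact: (orbit_fun_parity psi_cond HC).
have qe : qper e by exact: (orbit_fun_quasi_periodic psi_char psi_cond HC).
have [E0 _] := layer_space_linear psi HC layer_index k s.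
have T0 : T (fun=> 0) = (fun=> 0).
  have := Tlin 1 _ _ E0 E0.
  under [X in T X]eq_fun do rewrite mulr0 addr0.
  move=> TE; apply/funext => x; have := congr1 (fun h => h x) TE.
  by rewrite /= mul1r => /eqP; rewrite -subr_eq0 opprD addrA subrr sub0r oppr_eq0 => /eqP.
have TZ z : T (fun x => z * e x) = (fun x => z * T e x).
  have := Tlin z _ _ Ee E0; rewrite T0.
  under [X in T X]eq_fun do rewrite addr0.
  by move=> ->; apply/funext => x; rewrite addr0.
have Th : layer_space k' s' (T e) by exact: Tfun.
have [qh ph supph] := layer_space_elim Th.
have TM g z : KB g -> Mop g e = (fun x => z * e x) -> Mop g (T e) = (fun x => z * T e x).
  move=> gK ge; have := Teq g e gK Ee; rewrite !SE // ge.
  under [X in T X]eq_fun do rewrite mulrA.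
  rewrite TZ => h; apply/funext => x; have := congr1 (fun h => h x) h.
  by rewrite /= -mulrA => /(mulfI (mS_neq0 gK)).
have [v hv] : exists v, T e v <> 0.
  apply: nonzero_point => Te0.
  have e0 : e = (fun=> 0) by apply: Tinj; rewrite ?inE // Te0.
  have := orbit_fun_id psi_cond HC s w; rewrite -/e e0 => /eqP.
  by rewrite eq_sym oner_eq0.
have vw : A (v - w) \/ A (v + w).
  apply: (eigenvector_supp qh) hv => j c u Au cP Aw.
  apply: TM; first exact: (transvection_stabilizer HC Au cP).
  exact: (Mop_orbit_fun Au cP Aw sw).
have lv : layer k v.
  case: vw => vw; first exact: (layer_translate HC vw lw).
  by apply: (layer_translate HC (v := - w)); [rewrite opprK|exact: (layerN HC)].
congr (_, _); first exact: (layer_uniq HC lv (supph _ hv)).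
have := TM _ ((-1) ^+ s) (opp_stabilizer HC).
rewrite !(Mop_opp psi_char psi_cond HC iAB) // => TM1.
have := congr1 (fun h => h v) (TM1 (funext pe)).
rewrite /= ph => /(mulIf (introN eqP hv)).
by move=> /(@signr_inj R[i]).
Qed.

Lemma vanishing_closed E k : closed_subspace E ->
  closed_subspace [set h | E h /\ forall x, layer k x -> h x = 0].
Proof.
move=> [[E0 ED] sE clE]; split.
- split=> [|z f h [Ef f0] [Eh h0]]; first by split.
  by split=> [|x lx]; [exact: ED|rewrite f0 // h0 // mulr0 addr0].
- by move=> f [/sE].
move=> f Hf approx; split.
  by apply: clE => // e /approx[h [Eh _] lt_e]; exists h.
move=> x lx; apply: small_eq0 => d d0.
have [h [_ h0] hP] : exists2 h, E h /\ (forall x, layer k x -> h x = 0) &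
    forall w, modulus (f w - h w) < d.
  by apply: (hclosed_approx psi_char HC _ Hf d0 approx) => h [/sE].
by have := hP x; rewrite h0 // subr0.
Qed.

(** It is not known beforehand that [E] contains the restrictions of its members to a layer. A
    vector is first found after restriction, then lifted back using injectivity. *)
Lemma irreducible_is_layer_space E : closed_subspace E -> invariant_under KB S E ->
  irreducible_rep psi beta A KB S E -> exists k s, E = layer_space k s.
Proof.
move=> clE invE [[f Ef /nonzero_point[w fw]] irrE].
have [linE sE _] := clE; have [E0 ED] := linE.
have stabE g h : KB g -> E h -> E (Mop g h) by exact: invariant_Mop.
have [qf _] := sE _ Ef.
have [k lw] := layer_exists HC w; exists k.
have [s f1w] : exists s, parity_proj s f w <> 0.
  apply: contrapT => nex; apply: fw; rewrite -parity_projD.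
  have p0 s : parity_proj s f w = 0 by apply: contrapT => h; apply: nex; exists s.
  by rewrite !p0 addr0.
have Ef1 : E (parity_proj s f).
  have EN : E (fun x => f (- x)).
    by rewrite -(Mop_opp psi_char psi_cond HC iAB qf); apply: stabE => //; exact: (opp_stabilizer HC).
  have := subspaceZ linE 2^-1 (ED ((-1) ^+ s) _ _ EN Ef).
  by congr E; apply/funext => x; rewrite addrC.
exists s.
(* Restriction to the layer of [w] is injective on [E]: its kernel is closed, invariant, and
   different from [E] because [f w] is not zero. *)
have ker0 h : E h -> (forall x, layer k x -> h x = 0) -> h = (fun=> 0).
  move=> Eh h0; apply: contrapT => hn0.
  have [|||nF|FE] := irrE [set h | E h /\ forall x, layer k x -> h x = 0].
  - exact: vanishing_closed.
  - by move=> ? [].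
  - move=> g h' gK [Eh' h'0]; split; first exact: invE.
    move=> x lx; rewrite SE //.
    have := congr1 (fun h => h x) (Mop_restrict psi HC gK iAB k h').
    rewrite /= {2}/restrict asboolT // => <-.
    have -> : restrict (layer k) h' = (fun=> 0).
      by apply/funext => y; rewrite /restrict; case: asboolP => // /h'0.
    rewrite (Mop_const HC gK iAB (z := 0)) ?mulr0 // => a _.
    by rewrite /Mop_term mulr0.
  - by apply: nF; exists h.
  - by move: Ef; rewrite -FE => -[_ /(_ w lw)].
(* Closedness of the image is not asked for: isolating an orbit involves finite combinations
   only. *)
pose G : set (W -> R[i]) := [set restrict (layer k) h | h in E].
have linG : linear_subspace G.
  split=> [|z _ _ [h Eh <-] [h' Eh' <-]].
    exists (fun=> 0) => //; by apply/funext => x; rewrite /restrict if_same.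
  exists (fun x => z * h x + h' x); first exact: ED.
  by apply/funext => x; rewrite /restrict; case: asboolP => // _; rewrite mulr0 addr0.
have stabG g h : KB g -> G h -> G (Mop g h).
  move=> gK [h' Eh' <-]; exists (Mop g h'); first exact: stabE.
  by rewrite (Mop_restrict psi HC gK).
have r1 := restrict_layer_space HC layer_index k s qf.
have r1w : restrict (layer k) (parity_proj s f) w <> 0 by rewrite /restrict asboolT.
have [qr pr suppr] := layer_space_elim r1.
have [_ sw] := parity_layerP (parity_layer_supp r1 r1w).
have [h Eh hE] : G (orbit_fun s w).
  apply: (isolate_layer psi_char psi_cond HC lA iAB linG stabG _ qr pr suppr r1w).
  by exists (parity_proj s f).
have [qh _] := sE _ Eh.
(* The eigenvector equations hold on the layer, hence everywhere by injectivity. The lift [h] is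
   then supported on the orbit of [w], so it coincides with [orbit_fun s w]. *)
have supph : forall v, h v <> 0 -> A (v - w) \/ A (v + w).
  apply: (eigenvector_supp qh) => j c u Au cP Aw.
  have tK := transvection_stabilizer HC Au cP.
  apply/funext => x; apply/eqP; rewrite -subr_eq0; apply/eqP.
  have := ker0 (fun x => - transv_char c u w * h x + Mop (transvection beta c u) h x).
  move=> k0; have {k0} := congr1 (fun h => h x) (k0 _ _).
  rewrite /= mulNr addrC; apply; first by apply: ED => //; exact: stabE.
  move=> y ly; have := congr1 (fun h => h y) (Mop_restrict psi HC tK iAB k h).
  rewrite /= {2}/restrict asboolT // => <-.
  rewrite hE (Mop_orbit_fun Au cP Aw sw).
  by have := congr1 (fun h => h y) hE; rewrite /= /restrict asboolT // => ->; rewrite mulNr addNr.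
have Ew : E (orbit_fun s w).
  move: Eh; congr E; rewrite -hE; apply/funext => x; rewrite /restrict.
  case: asboolP => // nlx; apply: contrapT => /supph[xw|xw]; apply: nlx.
    exact: (layer_translate HC xw lw).
  by apply: (layer_translate HC (v := - w)); [rewrite opprK|exact: (layerN HC)].
have sub := generated_by_orbit_fun linE stabE lw sw Ew.
have [|||[]//|//] := irrE (layer_space k s).
- exact: (layer_space_closed psi_char HC layer_index).
- exact: sub.
- exact: layer_space_invariant.
exists (orbit_fun s w); first exact: orbit_fun_in.
move=> e0; have := orbit_fun_id psi_cond HC s w; rewrite e0 => /eqP.
by rewrite eq_sym oner_eq0.
Qed.

Lemma multiplicity_free_weil : multiplicity_free psi beta A KB S.
Proof.
move=> E F clE invE irrE clF invF irrF EF.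
have [k [s Ek]] := irreducible_is_layer_space clE invE irrE.
have [k' [s' Fk]] := irreducible_is_layer_space clF invF irrF.
case: irrE => nz _; rewrite Ek Fk in nz EF *.
by case: (layer_space_inequivalent nz EF) => -> ->.
Qed.

End Representation.

(** * The residual symplectic space *)

Section Residual.
Variables (K : localField) (W : vectType K) (lam : int) (beta : W -> W -> K).
Variable B : set W.
Hypothesis bP : alternating_form beta.
Local Notation Bs := (dual_lattice lam beta B).
Hypothesis sBsB : dilation unif Bs `<=` B.
Variable Q : quotientSpace Bs B.
Local Notation b := (qform lam beta (Q := Q)).
Implicit Types (u v : W) (y z : Q).

Let mBs : omodule Bs.
Proof.
split=> [a _|u v Lu Lv a La|c u c0 Lu a La].
- by rewrite (form0l bP); exact: powideal0.
- by rewrite (formDl bP); apply: powidealD; [exact: Lu|exact: Lv].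
- by rewrite (formZl bP); apply: powidealZ => //; exact: Lu.
Qed.

Let gBs := omodule_subgroup mBs.

Lemma qliftP y : Bs (qlift y) /\ qproj Q (qlift y) = y.
Proof.
rewrite /qlift; case: xgetP => [u _ []//|nex].
by have [u Bsu uy] := qproj_surj y; case: (nex u).
Qed.

Lemma qprojB u v : Bs u -> Bs v -> qproj Q (u - v) = qproj Q u - qproj Q v.
Proof.
move=> Bsu Bsv; rewrite qprojD //; last exact: (subgroupN gBs).
rewrite -[- v]scaleN1r qprojZ //; last exact/intringE/powidealN/powideal1.
by rewrite redN ?red1 ?scaleN1r //; exact: powideal1.
Qed.

Lemma qproj_eq u v : Bs u -> Bs v -> qproj Q u = qproj Q v <-> B (u - v).
Proof.
move=> Bsu Bsv; rewrite -(qproj_ker Q (subgroupB gBs Bsu Bsv)) qprojB //.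
by split=> [->|/eqP]; rewrite ?subrr // subr_eq0 => /eqP.
Qed.

Lemma qform_integral u v : Bs u -> Bs v -> powideal 0 (unif ^ (1 - lam) * beta u v).
Proof.
move=> Bsu Bsv; apply/powideal_unif_mul; rewrite sub0r opprB.
have Bv : B (unif *: v) by apply: sBsB; exists v.
by have := Bsu _ Bv; rewrite (formZr bP) -[unif]expr1z => /powideal_unif_mul.
Qed.

(** Changing lifts alters [beta u v] by pairings of [Bs] with [B], which lie in [powideal lam] and
    vanish after scaling and reduction. *)
Lemma qformE u v : Bs u -> Bs v ->
  b (qproj Q u) (qproj Q v) = reduction (unif ^ (1 - lam) * beta u v).
Proof.
move=> Bsu Bsv; rewrite /qform.
have [Bsu' uu'] := qliftP (qproj Q u); have [Bsv' vv'] := qliftP (qproj Q v).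
set u' := qlift _ in Bsu' uu' *; set v' := qlift _ in Bsv' vv' *.
have /(qproj_eq Bsu' Bsu) Bu := uu'; have /(qproj_eq Bsv' Bsv) Bv := vv'.
apply/red_eq; try exact: qform_integral.
rewrite -mulrBr; apply/powideal_unif_mul; rewrite opprB addrC subrK.
have -> : beta u' v' - beta u v = beta u' (v' - v) - beta v (u' - u).
  by rewrite !(formDr bP, formNr bP) (formC bP v u') (formC bP v u); ring.
by apply: powidealB; [exact: Bsu' Bv|exact: Bsv Bu].
Qed.

Lemma qformDl y1 y2 z : b (y1 + y2) z = b y1 z + b y2 z.
Proof.
have [u1 Bs1 <-] := qproj_surj y1; have [u2 Bs2 <-] := qproj_surj y2.
have [v Bsv <-] := qproj_surj z.
rewrite -qprojD // !qformE //; last exact: (subgroupD gBs).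
by rewrite (formDl bP) mulrDr redD //; apply/powidealP; exact: qform_integral.
Qed.

Lemma qformZl t y z : b (t *: y) z = t * b y z.
Proof.
have [u Bsu <-] := qproj_surj y; have [v Bsv <-] := qproj_surj z.
have [Oc ct] := lift_redP t; rewrite -{1}ct -qprojZ //; last exact/intringE.
rewrite !qformE //; last exact: (omoduleZ mBs).
rewrite (formZl bP) mulrCA redM ?ct //; apply/powidealP => //.
exact: qform_integral.
Qed.

Lemma qformC y z : b y z = - b z y.
Proof.
have [u Bsu <-] := qproj_surj y; have [v Bsv <-] := qproj_surj z.
rewrite !qformE // -redN; last exact: qform_integral.
by rewrite -mulrN -(formC bP).
Qed.

Lemma qform_suml (I : finType) (c : I -> residue K) (y : I -> Q) z :
  b (\sum_i c i *: y i) z = \sum_i c i * b (y i) z.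
Proof.
elim/big_rec2: _ => [|i x t _ <-]; last by rewrite qformDl qformZl.
by have := qformZl 0 0 z; rewrite scale0r mul0r.
Qed.

Section SymplecticBasis.
Variables (l : nat) (eps phi : l.-tuple Q).
Hypothesis epsphi : symplectic_basis b eps phi.

Let free_eps : free eps /\ free phi.
Proof.
by case: epsphi => /basis_free; rewrite cat_free => /and3P[].
Qed.

Let capv0 : (<<eps>> :&: <<phi>> = 0)%VS.
Proof.
by case: epsphi => /basis_free; rewrite cat_free => /and3P[_ _] /directv_addP.
Qed.

Lemma symplectic_decomp y : exists c d : 'I_l -> residue K,
  y = \sum_i c i *: tnth eps i + \sum_i d i *: tnth phi i.
Proof.
case: epsphi => bas _ _ _.
have : y \in (<<eps>> + <<phi>>)%VS by rewrite -span_cat (span_basis bas) memvf.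
case/memv_addP => y1 /coord_span y1E [y2 /coord_span y2E ->].
exists (fun i => coord eps i y1), (fun i => coord phi i y2).
rewrite {1}y1E {1}y2E; congr (_ + _); apply: eq_bigr => i _;
  by rewrite (tnth_nth 0).
Qed.

(** Such a [v] has a class orthogonal to the whole residual space; pairing with [phi] and [eps]
    shows that all its coordinates in the symplectic basis vanish. *)
Lemma dual_reflexive v :
  Bs v -> (forall u, Bs u -> powideal lam (beta v u)) -> B v.
Proof.
move=> Bsv vB; apply/(qproj_ker Q Bsv).
have y0 z : b (qproj Q v) z = 0.
  have [u Bsu <-] := qproj_surj z; rewrite qformE // -(red0 K).
  apply/red_eq; [exact: qform_integral|exact: powideal0|].
  by rewrite subr0; apply/powideal_unif_mul; rewrite opprB addrC subrK; exact: vB.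
have [c [d E]] := symplectic_decomp (qproj Q v); case: epsphi => _ ee pp ep.
have c0 j : c j = 0.
  have := y0 (tnth phi j); rewrite E qformDl !qform_suml.
  rewrite [X in _ + X]big1 ?addr0 => [|i _]; last by rewrite pp mulr0.
  by rewrite (bigD1 j) //= ep eqxx mulr1 big1 ?addr0 // => i ij;
    rewrite ep (negbTE ij) mulr0.
have d0 j : d j = 0.
  have := y0 (tnth eps j); rewrite E qformDl !qform_suml.
  rewrite [X in X + _]big1 ?add0r => [|i _]; last by rewrite ee mulr0.
  rewrite (bigD1 j) //= qformC ep eqxx big1 ?addr0 => [|i ij].
    by rewrite mulrN1 => /eqP; rewrite oppr_eq0 => /eqP.
  by rewrite qformC ep eq_sym (negbTE ij) oppr0 mulr0.
rewrite E !big1 ?addr0 // => i _; [rewrite d0|rewrite c0]; exact: scale0r.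
Qed.

Variables (A : set W) (x : {vspace Q}).
Hypotheses (gA : subgroup A) (sBA : B `<=` A) (sABs : A `<=` Bs).
Hypothesis xE : [set y | y \in x] = [set qproj Q a | a in A].
Hypothesis eps_x : basis_of x eps.
Local Notation q := #|residue K|.

Let xP y : y \in x <-> exists2 a, A a & qproj Q a = y.
Proof. by have /(congr1 (fun S => S y)) /= := xE => ->. Qed.

Let span_eps : <<eps>>%VS = x. Proof. exact: span_basis. Qed.

Lemma index_AB : has_index A B (q ^ l).
Proof.
pose T := {ffun 'I_l -> residue K}.
have [s sP] : {s : T -> W & forall f : T,
    A (s f) /\ qproj Q (s f) = \sum_i f i *: eps`_i}.
  apply: (choice (P := fun (f : T) a => A a /\ qproj Q a = \sum_i f i *: eps`_i)) => f.
  have /xP[a Aa aE] : \sum_i f i *: eps`_i \in x.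
    by apply: memv_suml => i _; apply: memvZ; rewrite -span_eps memv_span // mem_nth ?size_tuple.
  by exists a.
exists T, s; split; last by rewrite card_ffun card_ord.
split=> [f|f g fg|w Aw]; first by case: (sP f).
- have [Af fE] := sP f; have [Ag gE] := sP g; apply/ffunP => i.
  have /(qproj_eq (sABs Af) (sABs Ag)) := fg; rewrite fE gE => E.
  have := congr1 (coord eps i) E; rewrite !coord_sum_free //; exact: (proj1 free_eps).
- have yx : qproj Q w \in <<eps>>%VS by rewrite span_eps; apply/xP; exists w.
  exists [ffun i => coord eps i (qproj Q w)]; set f := finfun _.
  have [Af fE] := sP f; apply/(qproj_eq (sABs Aw) (sABs Af)).
  by rewrite fE {1}(coord_span yx); apply: eq_bigr => i _; rewrite ffunE.
Qed.

(** The span of [phi] is a complement of [x], the image of [A], so lifts of combinations of [phi]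
    represent the cosets of [A] in [Bs]. *)
Lemma index_BsA : has_index Bs A (q ^ l).
Proof.
pose T := {ffun 'I_l -> residue K}.
pose y (f : T) : Q := \sum_i f i *: phi`_i.
have yphi f : y f \in <<phi>>%VS.
  by apply: memv_suml => i _; apply: memvZ; rewrite memv_span // mem_nth ?size_tuple.
have AP u : Bs u -> A u <-> qproj Q u \in x.
  move=> Bsu; split=> [Au|/xP[a Aa au]]; first by apply/xP; exists u.
  rewrite -[u](subrK a); apply: (subgroupD gA) => //; apply: sBA.
  by apply/(qproj_eq Bsu (sABs Aa)).
exists T, (fun f => qlift (y f)); split; last by rewrite card_ffun card_ord.
split=> [f|f g fg|w Bsw]; first by case: (qliftP (y f)).
- have [Bf fE] := qliftP (y f); have [Bg gE] := qliftP (y g).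
  move: fg => /(AP _ (subgroupB gBs Bf Bg)); rewrite qprojB // fE gE => fgx.
  have : y f - y g \in (<<eps>> :&: <<phi>>)%VS.
    by rewrite memv_cap span_eps fgx memvB.
  rewrite capv0 memv0 subr_eq0 => /eqP E; apply/ffunP => i.
  have := congr1 (coord phi i) E; rewrite !coord_sum_free //; exact: (proj2 free_eps).
- have [c [d E]] := symplectic_decomp (qproj Q w).
  exists [ffun i => d i]; set f := finfun _; have [Bf fE] := qliftP (y f).
  apply/(AP _ (subgroupB gBs Bsw Bf)); rewrite qprojB // fE E.
  have -> : y f = \sum_i d i *: tnth phi i.
    by apply: eq_bigr => i _; rewrite ffunE (tnth_nth 0).
  rewrite addrK; apply: memv_suml => i _; apply: memvZ.
  by rewrite -span_eps memv_span // mem_tnth.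
Qed.

End SymplecticBasis.

(** [qmorph] is a [linfun] of a map built on chosen lifts. Stability of [Bs] and [B] makes that map
    independent of the lifts, hence linear. *)
Lemma qmorphE (g : 'End(W)) u : (forall v, B v -> B (g v)) -> (forall v, Bs v -> Bs (g v)) ->
  Bs u -> qmorph Q g (qproj Q u) = qproj Q (g u).
Proof.
move=> gB gBs' Bsu.
have E y v : Bs v -> qproj Q v = y -> qproj Q (g (qlift y)) = qproj Q (g v).
  move=> Bsv vy; have [By yE] := qliftP y; apply/qproj_eq; [exact: gBs'|exact: gBs'|].
  by rewrite -linearB; apply: gB; apply/qproj_eq => //; rewrite yE.
rewrite /qmorph linfun_linearE; first exact: E.
move=> t y z; have [By yE] := qliftP y; have [Bz zE] := qliftP z.
have [Oc ct] := lift_redP t.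
rewrite (E _ (lift_red t *: qlift y + qlift z)).
- rewrite linearD linearZ qprojD ?qprojZ ?ct //.
  + exact/intringE.
  + exact: gBs'.
  + by apply: (omoduleZ mBs) => //; exact: gBs'.
  + exact: gBs'.
- by apply: (subgroupD gBs) => //; exact: (omoduleZ mBs).
- rewrite qprojD ?qprojZ ?ct ?yE ?zE //; [exact/intringE|exact: (omoduleZ mBs)].
Qed.

Lemma qmorph_isometry (g : 'End(W)) : isometry_group beta g -> (forall v, B v -> B (g v)) ->
  (forall v, Bs v -> Bs (g v)) -> isometry_group b (qmorph Q g).
Proof.
move=> gP gB gBs' y z.
have [u Bsu <-] := qproj_surj y; have [v Bsv <-] := qproj_surj z.
by rewrite !qmorphE // !qformE ?gP //; exact: gBs'.
Qed.

End Residual.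

Lemma skew_alternating (F : fieldType) (V : vectType F) (b : {skew_symmetric V}) :
  nondegenerate b -> alternating_form b.
Proof.
move=> nd; have bC u v : b u v = - b v u.
  by rewrite hermitian_subproof expr1 mulN1r.
split=> // [u v w|c u v|u u0].
- exact: linearDl.
- exact: linearZl_LR.
- apply/eqP; rewrite -memv0 -(eqP nd); apply/mem_orthovP => v _.
  by rewrite ?u0 // bC u0 oppr0.
Qed.

(** * Cardinalities of the layers *)

Section LayerIndices.
Variables (K : localField) (W : vectType K) (lam : int) (beta : W -> W -> K).
Variables (B A : set W) (r l : nat).
Hypothesis HC : lattice_chain lam beta B A.
Hypotheses (lA : is_lattice A) (dimW : \dim {:W} = (2 * r)%N).
Local Notation q := #|residue K|.
Hypothesis iBA : has_index (dual_lattice lam beta B) A (q ^ l).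
Hypothesis iAB : has_index A B (q ^ l).
Local Notation layer := (layer lam beta B).
Let gA := subgroupA HC.
Let Q : rat := q%:R.

Let Q0 : Q != 0.
Proof. by rewrite pnatr_eq0 -lt0n; exact/ltnW/residue_gt1. Qed.

Let Ql0 : Q ^+ l != 0. Proof. exact: expf_neq0. Qed.

Let Q2l : Q ^+ (2 * l) = Q ^+ l ^+ 2. Proof. by rewrite mulnC exprM. Qed.

Lemma index_layer k a b : has_index (filt lam beta B k.+1) A a ->
  has_index (filt lam beta B k) A b -> (b <= a)%N /\ has_index (layer k.+1) A (a - b).
Proof.
by apply: has_index_sub => // [|u v]; [exact: (filt_succ HC)|exact: (filt_translate HC)].
Qed.

Lemma index_layer_even n : exists2 m, has_index (layer n.+1.*2) A m &
  m%:R = Q ^ ((2 * r * n.+1)%:Z - l%:Z) * (Q ^+ (2 * l) - 1).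
Proof.
have [x xP xE] := index_filt_odd HC lA dimW iBA iAB n.
have eP := index_filt_even HC lA dimW iBA n.+1.
have [le_x iP] := index_layer eP xP; exists (q ^ (2 * r * n.+1 + l) - x)%N => //.
have xQ : x%:R = Q ^+ (2 * r * n.+1) / Q ^+ l.
  by rewrite -natrX -xE natrM natrX mulrC mulKf // expf_neq0.
rewrite natrB // xQ natrX -/Q exprD expfzDr // -exprnN -exprnP Q2l.
by move: (Q ^+ l) (Q ^+ _) Ql0 => y z y0; field.
Qed.

Lemma index_layer_odd n : exists2 m, has_index (layer n.*2.+1) A m &
  m%:R = Q ^+ (2 * r * n + l) * (Q ^ (2 * (r%:Z - l%:Z)) - 1) /\ (l <= r)%N.
Proof.
have [x xP xE] := index_filt_odd HC lA dimW iBA iAB n.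
have eP := index_filt_even HC lA dimW iBA n.
have [le_x iP] := index_layer xP eP; exists (x - q ^ (2 * r * n + l))%N => //.
split.
  have xQ : x%:R = Q ^+ (2 * r * n) * Q ^+ (2 * r) / Q ^+ l.
    by rewrite -exprD -mulnSr -natrX -xE natrM natrX mulrC mulKf // expf_neq0.
  have -> : 2 * (r%:Z - l%:Z) = (2 * r)%N%:Z + - (2 * l)%N%:Z by lia.
  rewrite natrB // xQ natrX -/Q exprD expfzDr // -exprnN -exprnP Q2l.
  by move: (Q ^+ l) (Q ^+ (2 * r * n)) (Q ^+ (2 * r)) Ql0 => y z t y0; field.
(* Comparing the indices of two consecutive terms of the filtration gives [2 * l <= 2 * r]. *)
have : (q ^ l * q ^ (2 * r * n + l) <= q ^ (2 * r * n.+1))%N by rewrite -xE leq_mul2l le_x orbT.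
rewrite -expnD leq_exp2l ?residue_gt1 //; lia.
Qed.

Lemma index_layer0 : has_index (layer 0) A (q ^ l).
Proof. by rewrite /layer filt0. Qed.

End LayerIndices.

Theorem mainTheorem7 (R : realType) (K : localField)
  (charK : [pchar K] =i pred0) (charF : 2%N \notin [pchar (residue K)])
  (psi : K -> R[i]) (lam : int)
  (psi_char : unitary_character psi) (psi_cond : conductor psi lam)
  (r : nat) (r_gt0 : (0 < r)%N)
  (W : vectType K) (dimW : \dim {:W} = (2 * r)%N)
  (beta : {skew_symmetric W}) (betaP : is_psymplectic beta)
  (B A : set W) (goodB : good_lattice lam beta B)
  (selfdualA : selfdual_lattice lam beta A)
  (sBA : B `<=` A) (sAB : A `<=` dual_lattice lam beta B)
  (bstar : quotientSpace (dual_lattice lam beta B) B)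
  (l : nat) (dim_bstar : \dim {:bstar} = (2 * l)%N)
  (x : {vspace bstar}) (xE : [set y | y \in x] = [set qproj bstar a | a in A])
  (eps phi : l.-tuple bstar) (eps_x : basis_of x eps)
  (eps_phi : symplectic_basis (qform lam beta (Q:=bstar)) eps phi)
  (theta : 'End(bstar) -> residue K)
  (thetaP : is_theta (qform lam beta (Q:=bstar)) x eps phi theta) :
  let q : rat := #|residue K|%:R in
  let KB := stabilizer beta B in
  let S := weil_op psi A l x theta in
  let E := Esub psi beta A lam B in
  let E1 := Esub1 psi beta A lam B in
  let Ei := Epiece psi beta A lam B in
  let even := false in
  let odd := true in
  [/\ (* (i) *)
      [/\ nonzero_space (E 0%N),
          nonzero_space (parity_part odd (E 0%N)) <-> (0 < l)%N,
          forall n s, (1 <= n)%N ->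
            nonzero_space (parity_part s (E n)) <-> (0 < l)%N &
          forall n s, nonzero_space (parity_part s (E1 n)) <-> (l < r)%N],
      (* (ii) *)
      [/\ forall i, nonzero_space (Ei i) ->
            invariant_under KB S (Ei i) /\
            irreducible_rep psi beta A KB S (Ei i),
          forall i j, i <> j -> nonzero_space (Ei i) -> nonzero_space (Ei j) ->
            ~ equivalent_reps KB S (Ei i) (Ei j),
          multiplicity_free psi beta A KB S &
          hilbert_sum psi beta A Ei] &
      (* (iii) *)
      [/\ has_dim (parity_part even (E 0%N)) (1 + 1 / 2 * (q ^+ l - 1)),
          has_dim (parity_part odd (E 0%N)) (1 / 2 * (q ^+ l - 1)),
          forall n s, (1 <= n)%N ->
            has_dim (parity_part s (E n))
              (1 / 2 * q ^ ((2 * r * n)%:Z - l%:Z) * (q ^+ (2 * l) - 1)) &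
          forall n s,
            has_dim (parity_part s (E1 n))
              (1 / 2 * q ^+ (2 * r * n + l) * (q ^ (2 * (r%:Z - l%:Z)) - 1))]].
Proof.
move=> q KB S E E1 Ei even odd.
have [nd _ _] := betaP; have bP := skew_alternating nd.
have [lB sBsB sBBs] := goodB; have [lA dA] := selfdualA.
have mB := lattice_omodule lB; have mA := lattice_omodule lA.
have gA := omodule_subgroup mA.
have HC : lattice_chain lam beta B A.
  split=> //; first exact: (dual_reflexive bP sBsB eps_phi).
  by move=> w; exact: lattice_absorbing.
have iAB : has_index A B (#|residue K| ^ l).
  exact: (index_AB bP eps_phi sAB xE eps_x).
have iBA : has_index (dual_lattice lam beta B) A (#|residue K| ^ l).
  exact: (index_BsA bP eps_phi gA sBA sAB xE eps_x).
have iAB' : exists n, has_index A B n by exists (#|residue K| ^ l)%N.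
have lix := layer_index_exists HC lA dimW iBA iAB.
pose mS (g : 'End(W)) : R[i] := (omega psi lam (theta (qmorph bstar g)))^-1 *
  omega psi lam 1 ^ (1 - (jdefect l x (qmorph bstar g))%:Z) *
  sqrtC #|residue K|%:R ^+ jdefect l x (qmorph bstar g).
have SE g f : KB g -> S g f = (fun w => mS g * Mop psi beta A g f w) by [].
have q0 : (0 < #|residue K|)%N by exact/ltnW/residue_gt1.
(* Both Gauss sums are nonzero: [theta] takes nonzero values on isometries, and the residual map of
   [g] is one. *)
have mS0 g : KB g -> mS g != 0.
  move=> gK; have gP : isometry_group beta g by case: gK.
  have tP : isometry_group (qform lam beta (Q:=bstar)) (qmorph bstar g).
    apply: (qmorph_isometry bP sBsB gP) => v.
      by move=> Bv; apply/(stabilizer_B HC gK).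
    by move=> Bv; apply/(stabilizer_Bs HC gK).
  have [t0 _ _ _] := thetaP.
  rewrite /mS !mulf_neq0 ?invr_eq0 ?expfz_neq0 ?expf_neq0 //.
  - by apply: (omega_neq0 psi_char psi_cond charF); exact: t0.
  - by apply: (omega_neq0 psi_char psi_cond charF); exact: oner_neq0.
  - by rewrite sqrtC_eq0 pnatr_eq0 -lt0n.
have Q1 : 1 < q by rewrite ltr1n residue_gt1.
have Q0 : q != 0 by rewrite gt_eqF // (lt_trans ltr01).
(* The boolean summand is the contribution of the orbit [A], present for even functions only. *)
have dim0 s : has_dim (parity_part s (E 0%N))
    (1 / 2 * (q ^+ l - 1) + (~~ s)%:R).
  rewrite /E EsubE; have [d dP dE] := layer_has_dim psi_char psi_cond HC s (index_layer0 iBA).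
  rewrite (_ : _ + _ = d%:R) //.
  have : (d * 2 + s)%:R = (#|residue K| ^ l + ~~ s)%:R :> rat by rewrite dE.
  rewrite !natrD natrM natrX -/q => h.
  have -> : d%:R = (d%:R * 2 + s%:R - s%:R) / 2 :> rat by field.
  by rewrite h; case: s {dP dE h} => /=; field.
have dimE n s : (1 <= n)%N -> has_dim (parity_part s (E n))
    (1 / 2 * q ^ ((2 * r * n)%:Z - l%:Z) * (q ^+ (2 * l) - 1)).
  case: n => // n _; rewrite /E EsubE.
  have [m mP mE] := index_layer_even HC lA dimW iBA iAB n.
  have [d dP] := layer_has_dim psi_char psi_cond HC s mP; rewrite /= !addn0 => dE.
  rewrite -mulrA -mE -dE natrM mulrCA mul1r mulVf ?mulr1 //.
have dimE1 n s : has_dim (parity_part s (E1 n))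
    (1 / 2 * q ^+ (2 * r * n + l) * (q ^ (2 * (r%:Z - l%:Z)) - 1)).
  rewrite /E1 Esub1E.
  have [m mP [mE _]] := index_layer_odd HC lA dimW iBA iAB n.
  have [d dP] := layer_has_dim psi_char psi_cond HC s mP; rewrite /= !addn0 => dE.
  rewrite -mulrA -mE -dE natrM mulrCA mul1r mulVf ?mulr1 //.
have le_lr : (l <= r)%N by have [m _ []] := index_layer_odd HC lA dimW iBA iAB 0.
have half0 : (1 / 2 : rat) != 0 by [].
have qX (k : nat) : (q ^+ k - 1 != 0) = (0 < k)%N.
  case: k => [|k]; first by rewrite expr0 subrr eqxx.
  by rewrite subr_eq0 gt_eqF // exprn_egt1.
split.
- split.
  (* The even part already has positive dimension, whatever [l] is. *)
  + have [_] := has_dim_nonzero (dim0 even); case.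
      by rewrite gt_eqF // ltr_wpDl // mulr_ge0 // subr_ge0 exprn_ege1 // ltW.
    by move=> f [Ef _] f0; exists f.
  + have := has_dim_nonzero (dim0 odd).
    by rewrite addr0 mulf_eq0 negb_or half0 qX.
  + move=> n s n1; have := has_dim_nonzero (dimE n s n1).
    by rewrite !mulf_eq0 !negb_or half0 (expfz_neq0 _ Q0) qX muln_gt0.
  + move=> n s; have := has_dim_nonzero (dimE1 n s).
    (* With [l <= r] the integer exponent becomes a natural number, and the last factor vanishes
       exactly when [l = r]. *)
    have -> : 2 * (r%:Z - l%:Z) = (2 * (r - l))%N%:Z by lia.
    by rewrite !mulf_eq0 !negb_or half0 (expf_neq0 _ Q0) qX muln_gt0 subn_gt0.
- split.
  + move=> i; rewrite /Ei EpieceE => nz; split.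
      exact: (layer_space_invariant psi_char psi_cond HC iAB' lix SE).
    exact: (layer_space_irreducible psi_char psi_cond HC lA iAB' lix SE mS0).
  + move=> i j ij; rewrite /Ei !EpieceE => nz _ eqv; apply: ij.
    have [e1 e2] := layer_space_inequivalent psi_char psi_cond HC iAB' lix SE mS0 nz eqv.
    exact: piece_eq.
  + exact: (multiplicity_free_weil psi_char psi_cond HC lA iAB' lix SE mS0).
  + exact: (hilbert_sum_pieces psi_char HC lix).
- split=> //.
  + by have := dim0 even; rewrite addrC.
  + by have := dim0 odd; rewrite addr0.
Qed.
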